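(* Let $G$ be a finite, simple, connected $k$-regular graph. If $L(G)\leq 2k-1$, then $G$ is hamiltonian. Moreover, the condition cannot be relaxed: there exists a connected $k$-regular graph $G$ with $L(G)=2k$ that is not hamiltonian.
   Context: All graphs are finite, simple and nontrivial (at least two vertices). For a connected graph $G$, the leaf number $L(G)$ is the maximum number of leaves (vertices of degree $1$) over all spanning trees of $G$. A graph is hamiltonian if it contains a cycle through all its vertices.
   Formalization: The sharpness claim is stated for every k other than 0 and 2: for k = 2 every connected k-regular graph is a cycle, hence hamiltonian with leaf number 2, and for k = 0 no nontrivial connected k-regular graph exists, so no such example can exist for these two values. *)

(* Defs.v *)
From mathcomp Require Import all_boot.

Set Implicit Arguments.
Unset Strict Implicit.
Unset Printing Implicit Defensive.

Section Graph.
Variables (T : finType) (e : rel T).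

Definition simple_graph : Prop := symmetric e /\ irreflexive e.

Definition nontrivial : Prop := 1 < #|T|.

Definition degree (x : T) : nat := #|[set y | e x y]|.

Definition regular (k : nat) : Prop := forall x, degree x = k.

Definition connected : bool := [forall x, [forall y, connect e x y]].

(* A cycle is a duplicate-free closed walk through at least 3 vertices: ucycle *)
(* alone would also accept a single edge x -- y -- x. Bounding the length by   *)
(* #|T| loses nothing and makes the property decidable, see acyclicP.          *)
Definition acyclic : bool :=
  [forall n : 'I_#|T|.+1, [forall c : n.-tuple T, (2 < n) ==> ~~ ucycleb e c]].

Definition is_tree : bool := connected && acyclic.

Definition num_leaves : nat := #|[set x | degree x == 1]|.

(* In particular K_2 is not hamiltonian. *)
Definition hamiltonian : Prop :=
  exists c : seq T, [/\ 2 < size c, ucycle e c & forall x, x \in c].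

Definition edges : {set {set T}} :=
  [set [set p.1; p.2] | p in [set p : T * T | e p.1 p.2]].

Lemma acyclicP :
  reflect (forall c : seq T, 2 < size c -> ~ ucycle e c) acyclic.
Proof.
apply: (iffP forallP) => [acy c c_gt2 ucyc | acy n].
  have /andP[_ c_uniq] := ucyc.
  have c_le : size c < #|T|.+1 by rewrite ltnS -(card_uniqP c_uniq) max_card.
  move/forallP/(_ (in_tuple c)): (acy (Ordinal c_le)).
  by rewrite /= c_gt2 /=; move/negP; apply.
apply/forallP=> c; apply/implyP=> n_gt2; apply/negP.
by apply: acy; rewrite size_tuple.
Qed.

End Graph.

(* The spanning subgraph with edge set F; its vertex set is all of T. *)
Definition adj (T : finType) (F : {set {set T}}) : rel T :=
  [rel x y | [set x; y] \in F].

Definition spanning_tree (T : finType) (e : rel T) (F : {set {set T}}) : bool :=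
  (F \subset edges e) && is_tree (adj F).

(* The maximum over an empty range is 0, but a connected graph always has a    *)
(* spanning tree.                                                              *)
Definition leaf_number (T : finType) (e : rel T) : nat :=
  \max_(F : {set {set T}} | spanning_tree e F) num_leaves (adj F).

(* Main.v *)
(* A connected set grows to a dominating one without losing outer neighbours,  *)
(* and hanging these on a spanning tree of it makes them leaves; so with       *)
(* L(G) <= 2k-1 every connected set has at most 2k-1 outer neighbours, and     *)
(* when there are almost that many, few vertices lie beyond them. This forbids *)
(* cut vertices. Let C be a longest cycle missing x and                        *)
(* A = N(x) on C. Averaging |N(x) u N(a) u N(a+)| over a in A, as Asratian and *)
(* Khachatrian do in localised Ore conditions, gives |G| <= 2k+4 unless all    *)
(* these unions have size 2k+1; in that case the gaps of C between vertices of *)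
(* A are either all trivial or all bypassed by chords from a+ to a-. If the    *)
(* component of x off C has several vertices, a Dirac-type count of crossing   *)
(* chords and the lengths of the gaps make G too large. Otherwise N(x) lies on *)
(* C, and counting the edges leaving the successors of A contradicts the fact  *)
(* that crossing chords would lengthen C.                                      *)
(* Sharpness: in a spanning tree a cut vertex is never a leaf, and neither are *)
(* all the vertices of a closed neighbourhood.                                 *)

Require Import Defs.
From mathcomp Require Import all_boot zify.

Set Implicit Arguments.
Unset Strict Implicit.
Unset Printing Implicit Defensive.

(* [lia] on the arithmetic hypotheses only (boolean ones make it case-split),  *)
(* with the sort of a finType written in a single way so that atoms match.      *)
Ltac slia := repeat match goal with
  | H : is_true (leq _ _) |- _ => revert H
  | H : @eq nat _ _ |- _ => revert H
  end; clear;
  repeat match goal with |- context [@Equality.sort ?X] =>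
    let S := eval cbn in (Equality.sort X) in progress change (Equality.sort X) with S
  end; intros; lia.

(** * Connected sets and leaves of spanning trees *)

(** The leaf number enters only through connected sets [D]. The outer neighbours of a dominating
    connected set become leaves when hung on a spanning tree of it, and every connected set grows to
    a dominating one without losing outer neighbours. So L(G) <= 2k-1 gives |ext D| < 2k for all
    connected [D] ([cset_leaves]). By regularity, if |ext D| is 2k-1 or 2k-2, only a few vertices
    lie beyond ([tight_out_card], [near_tight_out_card]), and there are no cut vertices, since each
    side would supply k outer neighbours ([no_cut]).

    Suppose that a longest cycle C misses x. Put A = N(x) on C, and write a+ and a- for the
    successor and predecessor of a. The connected set {x, a, a+} has a closed neighbourhood of at
    most 2k+2 vertices, while the edges between A and A+ show that the average of these sizes over A
    is at least 2k+1. So |G| <= 2k+4, or all sizes equal 2k+1 and |G| <= 2k+7 ([flat_or_small]); in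
    the second case either A meets every pair of consecutive vertices of C, or every a+ is adjacent
    to a- and no a- lies in A+ ([flat_gaps]).

    A component H of G - C with several vertices is impossible ([component_absurd]). If |H| = 2, its
    vertices have the same neighbours on C, and some connected set has 2k outer neighbours
    ([pair_absurd]). If |H| >= 3, counting chords at two successors of attachment vertices bounds
    |G| from below ([dirac_count]), and ears through H force long gaps on C ([gap_shift]); both
    together exceed the upper bounds on |G|.

    Hence N(x) lies on C for every longest cycle C and every x off it. Apart from x, A and A+ at
    most three vertices remain, forming R ([small_order]), while comparing the degree sums of A and
    A+ gives k + e(A,R) <= e(R,A+) ([edge_count]). For each way in which R can be distributed over
    the gaps, crossing chords that would lengthen C leave too few edges from R to A+
    ([isolated_absurd]).

    For sharpness, two copies of K_(k+1) minus a matching hang on one or two roots. The roots are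
    cut vertices, hence never leaves of a spanning tree, and each copy contains a closed
    neighbourhood and so one further non-leaf; exactly 2k leaves remain possible
    ([cut_graph_leaves]). *)

Section Leaves.
Variables (T : finType) (e : rel T).
Hypotheses (symE : symmetric e) (irrE : irreflexive e).

Definition nbh (v : T) : {set T} := [set y | e v y].
Definition ext (D : {set T}) : {set T} :=
  [set y | (y \notin D) && [exists x in D, e x y]].
Definition out (D : {set T}) : {set T} := ~: (D :|: ext D).

(** The nonempty connected sets, presented by an order of construction along which spanning trees
    can be grown. *)
Inductive cset : {set T} -> Prop :=
| cset1 x : cset [set x]
| csetU (D : {set T}) x y : cset D -> x \in D -> e x y -> y \notin D -> cset (y |: D).

Lemma extP (D : {set T}) y :
  reflect (y \notin D /\ exists2 x, x \in D & e x y) (y \in ext D).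
Proof.
rewrite inE; apply: (iffP andP) => [[yD /existsP[x /andP[xD xy]]]|[yD [x xD xy]]].
  by split=> //; exists x.
by split=> //; apply/existsP; exists x; rewrite xD.
Qed.

Lemma in_ext (D : {set T}) x y : x \in D -> e x y -> y \notin D -> y \in ext D.
Proof. by move=> xD xy yD; apply/extP; split=> //; exists x. Qed.

Lemma in_out (D : {set T}) y : (y \in out D) = (y \notin D) && (y \notin ext D).
Proof. by rewrite !inE negb_or. Qed.

Lemma outP (D : {set T}) y :
  reflect (y \notin D /\ forall x, x \in D -> ~~ e x y) (y \in out D).
Proof.
rewrite in_out; apply: (iffP andP) => [[yD yE]|[yD yE]]; split=> //.
  by move=> x xD; apply: contra yE => xy; apply: in_ext xy yD.
by apply/negP => /extP[_ [x xD xy]]; move: (yE x xD); rewrite xy.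
Qed.

Lemma cset_nonempty D : cset D -> exists x, x \in D.
Proof. by case=> [x|D' x y _ _ _ _]; [exists x|exists y]; rewrite !inE eqxx. Qed.

Lemma cset_cut D (X : {set T}) : cset D -> X \subset D -> X != set0 -> X != D ->
  exists x y, [/\ x \in X, y \in D, y \notin X & e x y].
Proof.
move=> cD; elim: cD X => {D} [x|D x y cD IH xD xy yD] X sX X0 XD.
  by case/negP: XD; move: sX X0; rewrite subset1 => /orP[|/eqP->]; rewrite ?eqxx.
have [yX|yX] := boolP (y \in X); last first.
  have sXD : X \subset D.
    apply/subsetP => z zX; move/subsetP: sX => /(_ z zX); rewrite !inE.
    by case: eqP => // zy; rewrite -zy zX in yX.
  have [eXD|nXD] := eqVneq X D.
    by exists x, y; rewrite eXD xD !inE eqxx.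
  have [u [w [uX wD wX uw]]] := IH X sXD X0 nXD.
  by exists u, w; rewrite uX wX uw !inE wD orbT.
have [xX|xX] := boolP (x \in X); last first.
  by exists y, x; rewrite yX xX symE xy !inE xD orbT.
have sXD : X :\ y \subset D.
  apply/subsetP => z; rewrite !inE => /andP[zy zX].
  by move/subsetP: sX => /(_ z zX); rewrite !inE (negPf zy).
have xXy : x \in X :\ y.
  by rewrite !inE xX andbT; apply: contraNneq yD => <-.
have X0' : X :\ y != set0 by apply/set0Pn; exists x.
have nXD : X :\ y != D.
  apply: contra XD => /eqP <-; rewrite setD1K //.
have [u [w [uX wD wX uw]]] := IH _ sXD X0' nXD.
exists u, w; move: uX wX; rewrite !inE => /andP[_ ->] wX; rewrite wD uw orbT; split=> //.
by move: wX; case: eqP => //= wy; rewrite -wy wD in yD.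
Qed.

Lemma cset_addnbrs D (B : {set T}) : cset D -> B \subset ext D -> cset (D :|: B).
Proof.
move: {2}#|B| (leqnn #|B|) => n; elim: n B => [|n IH] B.
  by rewrite leqn0 cards_eq0 => /eqP-> cD _; rewrite setU0.
move=> Bn cD sB; have [->|/set0Pn[y yB]] := eqVneq B set0; first by rewrite setU0.
have -> : D :|: B = y |: (D :|: (B :\ y)).
  by rewrite setUCA setD1K.
have /extP[yD [x xD xy]] := subsetP sB y yB.
apply: (@csetU _ x) => //.
- apply: IH => //; first by move: Bn; rewrite (cardsD1 y B) yB; slia.
  by apply: subset_trans sB; apply: subD1set.
- by rewrite inE xD.
- by rewrite !inE eqxx /= (negPf yD).
Qed.

Lemma ext_add D l : l \in ext D ->
  ext (l |: D) = (ext D :\ l) :|: (nbh l :&: out D).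
Proof.
move=> lE; have [lD _] := extP _ _ lE.
apply/setP => y; rewrite in_setU in_setD1 in_setI [y \in nbh l]in_set in_out.
apply/idP/idP => [/extP[]|].
  rewrite !inE negb_or => /andP[yl yD] [x]; rewrite !inE yl yD /=.
  case/orP => [/eqP->|xD] xy.
    by rewrite xy /=; case: existsP.
  by have -> : [exists x in D, e x y] by apply/existsP; exists x; rewrite xD.
case/orP => [/andP[yl /extP[yD [x xD xy]]]|/and3P[ly yD yE]]; apply/extP.
  by split; [rewrite !inE negb_or yl|exists x; rewrite // !inE xD orbT].
split; last by exists l; rewrite // !inE eqxx.
by rewrite !inE negb_or yD andbT; apply: contraTneq ly => ->; rewrite irrE.
Qed.

(** Absorbing [l] costs the outer neighbour [l] and gains its neighbours beyond [ext D]. The bounds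
    on [out D] rest on this balance. *)
Lemma card_ext_add D l : l \in ext D ->
  #|ext (l |: D)|.+1 = #|ext D| + #|nbh l :&: out D|.
Proof.
move=> lE; rewrite ext_add // cardsU.
have -> : #|(ext D :\ l) :&: (nbh l :&: out D)| = 0.
  apply/eqP; rewrite cards_eq0; apply/eqP/setP => y; rewrite in_set0 !in_setI in_setD1 in_out.
  by case: (y \in ext D); rewrite ?andbF.
by rewrite (cardsD1 l (ext D)) lE; slia.
Qed.

Lemma out_add D l : l \in ext D -> out (l |: D) = out D :\: nbh l.
Proof.
move=> lE; have [lD _] := extP _ _ lE; apply/setP => y.
rewrite in_setD [LHS]in_out ext_add // !(in_setU, in_setI, in_setD1, in_set1, in_out).
have [->|yl] := eqVneq y l => /=; first by rewrite lE ?andbF.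
by case: (y \in D); case: (y \in ext D); case: (y \in nbh l).
Qed.

(** A spanning tree of [D], as an edge set on the whole vertex type: vertices outside [D] stay
    isolated, so connectedness is asked only inside [D]. *)
Definition tree_on (D : {set T}) (F : {set {set T}}) : Prop :=
  [/\ F \subset edges e,
      forall x y, adj F x y -> x \in D /\ y \in D,
      {in D &, forall x y, connect (adj F) x y}
    & forall c, 2 < size c -> ~ ucycle (adj F) c].

Lemma adj_sym (F : {set {set T}}) : symmetric (adj F).
Proof. by move=> x y; rewrite /adj /= setUC. Qed.

Lemma adj_edge (F : {set {set T}}) x y : F \subset edges e -> adj F x y -> e x y.
Proof.
move=> /subsetP sF xy; have /imsetP[[u v]] := sF _ xy; rewrite inE /= => uv E.
have: x \in [set u; v] by rewrite -E !inE eqxx.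
have: y \in [set u; v] by rewrite -E !inE eqxx orbT.
have: u \in [set x; y] by rewrite E !inE eqxx.
have: v \in [set x; y] by rewrite E !inE eqxx orbT.
by rewrite !inE => /orP[]/eqP E1 /orP[]/eqP E2 /orP[]/eqP E3 /orP[]/eqP E4;
  move: uv; subst; rewrite ?irrE // => uv; rewrite // symE.
Qed.

Lemma set2_inj (x y z : T) : y != x -> [set y; z] = [set x; y] -> z = x.
Proof.
move=> yx E; have: z \in [set x; y] by rewrite -E !inE eqxx orbT.
rewrite !inE => /orP[/eqP//|/eqP zy]; have: x \in [set y; z] by rewrite E !inE eqxx.
by rewrite zy !inE orbb => /eqP xy; rewrite xy eqxx in yx.
Qed.

Lemma tree_add D F x y : tree_on D F -> x \in D -> e x y -> y \notin D ->
  [/\ tree_on (y |: D) ([set x; y] |: F),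
      degree (adj ([set x; y] |: F)) y = 1
    & forall z, z \notin [set x; y] ->
        degree (adj ([set x; y] |: F)) z = degree (adj F) z].
Proof.
move=> [sF FD cF aF] xD xy yD; set F' := _ |: F.
have yx : y != x by apply: contraNneq yD => ->.
have Fy z : adj F' y z = (z == x).
  rewrite /adj /= !inE; apply/orP/eqP => [[/eqP|]|->]; first exact: set2_inj.
    by move=> yz; case: (FD _ _ yz); rewrite (negPf yD).
  by left; rewrite setUC.
have FF u v : u != y -> v != y -> adj F' u v = adj F u v.
  move=> uy vy; rewrite /adj /= !inE; case: eqP => //= E.
  have: y \in [set u; v] by rewrite E !inE eqxx orbT.
  by rewrite !inE !(eq_sym y) (negPf uy) (negPf vy).
have subF : subrel (adj F) (adj F') by move=> u v; rewrite /adj /= !inE => ->; rewrite orbT.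
have cF' u v : u \in D -> v \in D -> connect (adj F') u v.
  move=> uD vD; apply: connect_sub (cF u v uD vD) => a b ab.
  by apply: connect1; apply: subF.
split; last 2 first.
- by rewrite /degree (_ : [set z | _] = [set x]) ?cards1 //; apply/setP => z; rewrite in_set Fy !inE.
- move=> z; rewrite !inE negb_or => /andP[zx zy]; rewrite /degree; apply: eq_card => w.
  rewrite !in_set; have [->|wy] := eqVneq w y; last by rewrite FF.
  rewrite adj_sym Fy (negPf zx); apply/esym/negbTE/negP => zw.
  by case: (FD _ _ zw); rewrite (negPf yD).
split.
- apply/subsetP => E; rewrite !inE => /orP[/eqP->|]; last exact: (subsetP sF).
  by apply/imsetP; exists (x, y); rewrite ?inE.
- move=> u v uv; have [uy|uy] := eqVneq u y.
    by move: uv; rewrite uy Fy => /eqP->; rewrite !inE eqxx xD orbT.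
  have [vy|vy] := eqVneq v y.
    by move: uv; rewrite adj_sym vy Fy => /eqP->; rewrite !inE eqxx xD orbT.
  by move: uv; rewrite FF // => /FD[uD vD]; rewrite !inE uD vD !orbT.
- have cxy : connect (adj F') x y by apply: connect1; rewrite adj_sym Fy.
  have cyx : connect (adj F') y x by apply: connect1; rewrite Fy.
  move=> u v; rewrite !inE => /orP[/eqP->|uD] /orP[/eqP->|vD] //.
  + exact: connect_trans cyx (cF' _ _ _ _).
  + by apply: connect_trans cxy; apply: cF'.
  + exact: cF'.
move=> c c2 /andP[cyc uc]; have [yc|yc] := boolP (y \in c); last first.
  apply: (aF c) => //; rewrite /ucycle uc andbT.
  apply: (sub_in_cycle _ _ cyc); last exact: (introT allP (fun _ => id)).
  by move=> u v uc' vc'; rewrite FF //; [apply: contraNneq yc => <-|apply: contraNneq yc => <-].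
(* A cycle through [y], rotated to start there, would have [x], the only neighbour of [y], both
   second and last. *)
have [i p rc] := rot_to yc.
have: cycle (adj F') (y :: p) by rewrite -rc rot_cycle.
have up : uniq (y :: p) by rewrite -rc rot_uniq.
have sp : 2 < size (y :: p) by rewrite -rc size_rot.
case: p up sp {rc} => // a p; rewrite /= inE negb_or => /and3P[/andP[ya yp] ap up] sp.
rewrite Fy => /andP[/eqP ax]; subst a.
case/lastP: p ap yp up sp => // p b; rewrite rcons_path last_rcons => xp _ _ _ /andP[_].
rewrite adj_sym Fy => /eqP bx; move: xp.
by rewrite bx mem_rcons inE eqxx.
Qed.

Lemma cset_tree D : cset D -> exists F, tree_on D F.
Proof.
elim=> {D} [x|D x y cD [F tF] xD xy yD].
  exists set0; split; rewrite ?sub0set //.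
  - by move=> u v; rewrite /adj /= in_set0.
  - by move=> ? ? /set1P-> /set1P->; apply: connect0.
  - by move=> [|a [|b c]] // _ /andP[] /=; rewrite /adj /= in_set0.
by have [tF' _ _] := tree_add tF xD xy yD; exists ([set x; y] |: F).
Qed.

Lemma tree_attach D F (B : {set T}) : tree_on D F -> B \subset ext D ->
  exists F', tree_on (D :|: B) F' /\ {in B, forall v, degree (adj F') v = 1}.
Proof.
move=> tF; move: {2}#|B| (leqnn #|B|) => n; elim: n B => [|n IH] B.
  rewrite leqn0 cards_eq0 => /eqP-> _; rewrite setU0; exists F; split=> // v; by rewrite inE.
move=> Bn sB; have [->|/set0Pn[y yB]] := eqVneq B set0.
  by rewrite setU0; exists F; split=> // v; rewrite inE.
have [|| F' [tF' dF']] := IH (B :\ y).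
- by move: Bn; rewrite (cardsD1 y B) yB; slia.
- by apply: subset_trans sB; apply: subD1set.
have /extP[yD [x xD xy]] := subsetP sB y yB.
have xD' : x \in D :|: B :\ y by rewrite inE xD.
have yD' : y \notin D :|: B :\ y by rewrite !inE eqxx (negPf yD).
have [tF'' d1 d2] := tree_add tF' xD' xy yD'.
exists ([set x; y] |: F'); split.
  by rewrite (_ : D :|: B = y |: (D :|: B :\ y)) // setUCA setD1K.
move=> v vB; have [->//|vy] := eqVneq v y.
rewrite d2 ?dF' //; first by rewrite !inE vy.
rewrite !inE negb_or vy andbT; apply: contraTneq xD => <-.
by have /extP[] := subsetP sB v vB.
Qed.

Hypothesis connE : connected e.

Lemma connected_cut (X : {set T}) : X != set0 -> X != setT ->
  exists x y, [/\ x \in X, y \notin X & e x y].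
Proof.
move=> /set0Pn[x xX] XT.
have /subsetPn[y _ yX] : ~~ (setT \subset X) by rewrite subTset.
have /connectP[p xp yp] : connect e x y by move/forallP: connE => /(_ x)/forallP/(_ y).
elim: p x xX xp yp => [|z p IH] x xX /=; first by move=> _ yx; rewrite yx xX in yX.
move=> /andP[xz zp] yp; have [zX|zX] := boolP (z \in X); first exact: (IH z).
by exists x, z.
Qed.

Lemma out_frontier D : cset D -> out D != set0 ->
  exists l o, [/\ l \in ext D, o \in out D & e l o].
Proof.
move=> /cset_nonempty[x xD] /set0Pn[z zO].
have [||l [o [lX oX lo]]] := @connected_cut (D :|: ext D).
- by apply/set0Pn; exists x; rewrite inE xD.
- by apply: contraTneq zO => E; rewrite /out E !inE.
have oO : o \in out D by rewrite inE.
exists l, o; split=> //; move: lX; rewrite inE => /orP[lD|//].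
by have [_ /(_ l lD)] := outP _ _ oO; rewrite lo.
Qed.

(* Absorbing an outer neighbour that sees a vertex beyond [ext D] trades it for *)
(* at least one new outer neighbour.                                           *)
Lemma cset_grow D : cset D ->
  exists D', [/\ cset D', out D' = set0 & #|ext D| <= #|ext D'| ].
Proof.
move: {2}#|~: D| (leqnn #|~: D|) => n; elim: n D => [|n IH] D Dn cD.
  exists D; split=> //; apply/setP => y; rewrite in_out inE.
  by move: Dn; rewrite leqn0 cards_eq0 => /eqP/setP/(_ y); rewrite !inE => /negbFE->.
have [O0|O0] := eqVneq (out D) set0; first by exists D.
have [l [o [lE oO lo]]] := out_frontier cD O0.
have [lD [x xD xl]] := extP _ _ lE.
have [|| D' [cD' OD' ED']] := IH (l |: D).
- rewrite -ltnS; apply: leq_trans Dn; apply: proper_card; apply/properP; split.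
    by apply/subsetP => z; rewrite !inE negb_or => /andP[].
  by exists l; rewrite !inE ?lD ?eqxx.
- exact: csetU xl lD.
exists D'; split=> //; apply: leq_trans ED'.
have := card_ext_add lE.
have: 0 < #|nbh l :&: out D| by apply/card_gt0P; exists o; rewrite in_setI in_set lo.
slia.
Qed.

(** Since [D] dominates, a spanning tree of [D] with [ext D] hung on it spans the graph. *)
Lemma dominating_leaves D : cset D -> out D = set0 -> #|ext D| <= leaf_number e.
Proof.
move=> cD O0; have [F tF] := cset_tree cD.
have [F' [[sF' _ cF' aF'] dF']] := tree_attach tF (subxx (ext D)).
have DT : D :|: ext D = setT by rewrite -[LHS]setCK -/(out D) O0 setC0.
have st : spanning_tree e F'.
  rewrite /spanning_tree sF' /=; apply/andP; split.
    apply/forallP => x; apply/forallP => y; apply: cF'; rewrite DT inE //.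
  exact/acyclicP.
apply: leq_trans (leq_bigmax_cond _ st).
apply: subset_leq_card; apply/subsetP => v vE; rewrite inE; apply/eqP; exact: dF'.
Qed.

Lemma cset_leaves D : cset D -> #|ext D| <= leaf_number e.
Proof.
move=> cD; have [D' [cD' O0 le]] := cset_grow cD.
exact: leq_trans le (dominating_leaves cD' O0).
Qed.

Lemma exists_spanning_tree : 0 < #|T| -> exists F, spanning_tree e F.
Proof.
move=> /card_gt0P[x _]; have [D [cD O0 _]] := cset_grow (cset1 x).
have [F tF] := cset_tree cD.
have [F' [[sF' _ cF' aF'] _]] := tree_attach tF (subxx (ext D)).
have DT : D :|: ext D = setT by rewrite -[LHS]setCK -/(out D) O0 setC0.
exists F'; rewrite /spanning_tree sF' /=; apply/andP; split; last exact/acyclicP.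
by apply/forallP => u; apply/forallP => y; apply: cF'; rewrite DT inE.
Qed.

End Leaves.

(** * Double counting and connected sets *)

Section Counting.
Variables (T : finType) (e : rel T).
Hypotheses (symE : symmetric e) (irrE : irreflexive e).
Local Notation nbh := (nbh e).
Local Notation cset := (cset e).

Lemma in_nbh x y : (y \in nbh x) = e x y.
Proof. by rewrite inE. Qed.

Lemma card_nbhI x (B : {set T}) : #|nbh x :&: B| = \sum_(y in B) e x y.
Proof.
rewrite -sum1_card [RHS]big_mkcond [LHS]big_mkcond /=; apply: eq_bigr => y _.
by rewrite in_setI in_nbh; case: (e x y); case: (y \in B).
Qed.

Lemma double_count (A B : {set T}) :
  \sum_(x in A) #|nbh x :&: B| = \sum_(y in B) #|nbh y :&: A|.
Proof.
under eq_bigr do rewrite card_nbhI; rewrite exchange_big /=.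
by apply: eq_bigr => y _; rewrite card_nbhI; apply: eq_bigr => x _; rewrite symE.
Qed.

(** A decidable form of [cset], which permits extremal choices among connected sets. *)
Definition csetb (D : {set T}) : bool :=
  (D != set0) && [forall X : {set T}, [&& X \subset D, X != set0 & X != D] ==>
    [exists x in X, [exists y in D :\: X, e x y]]].

Lemma cset_fill v (X D : {set T}) : cset X -> v \in X -> X \subset D ->
  (forall Y : {set T}, v \in Y -> Y \subset D -> Y != D ->
     exists x y, [/\ x \in Y, y \in D, y \notin Y & e x y]) -> cset D.
Proof.
move=> cX vX sX cut; move: {2}#|D :\: X| (leqnn #|D :\: X|) => n.
elim: n X cX vX sX => [|n IH] X cX vX sX.
  rewrite leqn0 cards_eq0 setD_eq0 => sD.
  by rewrite (_ : D = X) //; apply/eqP; rewrite eqEsubset sD.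
have [<-//|XD] := eqVneq X D; have [x [y [xX yD yX xy]]] := cut X vX sX XD.
move=> le; apply: (IH (y |: X)); rewrite ?(inE, vX, orbT) //.
- exact: csetU xy yX.
- by rewrite subUset sub1set yD.
- rewrite -ltnS; apply: leq_trans le; apply: proper_card; apply/properP; split.
    by apply/subsetP => z; rewrite !inE negb_or => /andP[/andP[_ ->] ->].
  by exists y; rewrite !inE ?eqxx ?yD ?yX.
Qed.

Lemma csetP D : reflect (cset D) (csetb D).
Proof.
apply: (iffP andP) => [[/set0Pn[v vD] /forallP cut]|cD].
  apply: (@cset_fill v [set v]); rewrite ?set11 ?sub1set //; first exact: cset1.
  move=> Y vY sY YD; move/implyP: (cut Y); rewrite sY YD.
  have -> : Y != set0 by apply/set0Pn; exists v.
  move=> /(_ isT)/existsP[x /andP[xY /existsP[y /andP[]]]].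
  by rewrite inE => /andP[yY yD] xy; exists x, y.
have [v vD] := cset_nonempty cD; split; first by apply/set0Pn; exists v.
apply/forallP => X; apply/implyP => /and3P[sX X0 XD].
have [x [y [xX yD yX xy]]] := cset_cut symE cD sX X0 XD.
by apply/existsP; exists x; rewrite xX; apply/existsP; exists y; rewrite inE yX yD.
Qed.

Lemma csetUset v D1 D2 : cset D1 -> cset D2 -> v \in D1 -> v \in D2 -> cset (D1 :|: D2).
Proof.
move=> c1 c2 v1 v2; apply: (@cset_fill v D1); rewrite ?subsetUl // => Y vY sY YD.
have cut D' : cset D' -> v \in D' -> ~~ (D' \subset Y) -> D' \subset D1 :|: D2 ->
    exists x y, [/\ x \in Y, y \in D1 :|: D2, y \notin Y & e x y].
  move=> cD vD nD sD; have [||| x [y [xY yD yY xy]]] := @cset_cut _ _ symE D' (Y :&: D') cD.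
  - exact: subsetIr.
  - by apply/set0Pn; exists v; rewrite inE vY.
  - by apply: contra nD => /eqP <-; apply: subsetIl.
  move: xY yY; rewrite !inE yD andbT => /andP[xY _] yY; exists x, y; split=> //.
  by move/subsetP: sD => /(_ y yD); rewrite inE.
have [n1|n1] := boolP (D1 \subset Y); last by apply: (cut D1) => //; apply: subsetUl.
have [n2|n2] := boolP (D2 \subset Y); last by apply: (cut D2) => //; apply: subsetUr.
by case/negP: YD; rewrite eqEsubset sY subUset n1.
Qed.

(** A largest proper connected subset containing [v] misses only one vertex, because adding a vertex
    along a crossing edge must give all of [D]. *)
Lemma cset_noncut v D : cset D -> v \in D -> D != [set v] ->
  exists u, [/\ u \in D, u != v & cset (D :\ u)].
Proof.
move=> cD vD Dv; pose P (X : {set T}) := [&& csetb X, v \in X & X \proper D].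
have P0 : P [set v].
  rewrite /P set11 properE sub1set vD /= andbC; apply/andP; split; last exact/csetP/cset1.
  by apply: contra Dv => sD; rewrite eqEsubset sD sub1set.
case: (arg_maxnP (fun X : {set T} => #|X|) P0) => X /and3P[/csetP cX vX pX] Xmax.
have [sX [u uD uX]] := properP pX.
have [||x [y [xX yD yX xy]]] := cset_cut symE cD sX.
- by apply/set0Pn; exists v.
- by apply: contraNneq uX => ->.
exists y; split=> //; first by apply: contraNneq yX => ->.
suff -> : D :\ y = X by [].
apply/eqP; rewrite eqEsubset; apply/andP; split; last first.
  apply/subsetP => z zX; rewrite !inE (subsetP sX) // andbT.
  by apply: contraNneq yX => <-.
apply/negPn/negP => /subsetPn[z]; rewrite !inE => /andP[zy zD] zX.
have /Xmax : P (y |: X).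
  apply/and3P; split; first by apply/csetP; apply: csetU xy yX.
    by rewrite !inE vX orbT.
  apply/properP; split; first by rewrite subUset sub1set yD.
  by exists z; rewrite // !inE negb_or zy.
by rewrite cardsU1 yX /= add1n ltnn.
Qed.

End Counting.

(** * Connected sets with nearly 2k outer neighbours *)

Section Regular.
Variables (T : finType) (e : rel T) (k : nat).
Hypotheses (symE : symmetric e) (irrE : irreflexive e) (connE : connected e).
Hypotheses (regE : regular e k) (k3 : 2 < k).
Local Notation nbh := (nbh e).
Local Notation ext := (ext e).
Local Notation out := (out e).
Local Notation cset := (cset e).
Hypothesis leafE : forall D, cset D -> #|ext D| < 2 * k.

Lemma card_nbh x : #|nbh x| = k.
Proof. exact: regE. Qed.

Section Tight.
Variable D : {set T}.
Hypotheses (cD : cset D) (tD : #|ext D|.+1 = 2 * k).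

(** Absorbing an outer neighbour with two neighbours beyond would produce 2k outer neighbours. *)
Lemma tight_leaf l : l \in ext D -> #|nbh l :&: out D| <= 1.
Proof.
move=> lE; have [lD [x xD xl]] := extP _ _ _ lE.
have := card_ext_add irrE lE; have := leafE (csetU cD xD xl lD); slia.
Qed.

Lemma tight_leaf_eq l o o' : l \in ext D -> o \in out D -> o' \in out D ->
  e l o -> e l o' -> o = o'.
Proof.
move=> lE oO oO' lo lo'; apply/eqP/negPn/negP => oo'.
have := tight_leaf lE; rewrite leqNgt => /negP; apply.
apply: (@leq_trans #|[set o; o']|); first by rewrite cards2 oo'.
by apply: subset_leq_card; rewrite subUset !sub1set !in_setI !in_nbh lo lo' oO oO'.
Qed.
End Tight.

(** With exactly one neighbour beyond, the trade is even, so tightness can be carried along a walk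
    into [out D]. *)
Lemma tight_add D l o : cset D -> #|ext D|.+1 = 2 * k -> l \in ext D ->
  o \in out D -> e l o -> cset (l |: D) /\ #|ext (l |: D)|.+1 = 2 * k.
Proof.
move=> cD tD lE oO lo; have [lD [x xD xl]] := extP _ _ _ lE.
split; first exact: csetU xl lD.
have := card_ext_add irrE lE; have := tight_leaf cD tD lE.
have: 0 < #|nbh l :&: out D| by apply/card_gt0P; exists o; rewrite in_setI in_set lo.
slia.
Qed.

Lemma in_ext_add D l o : l \in ext D -> o \in out D -> e l o -> o \in ext (l |: D).
Proof. by move=> lE oO lo; rewrite ext_add // in_setU in_setI in_nbh lo oO orbT. Qed.

(** After [l] is absorbed, [o] is an outer neighbour of a tight set, and only [o] has left
    [out D]. *)
Lemma tight_out_nbr D l o : cset D -> #|ext D|.+1 = 2 * k -> l \in ext D ->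
  o \in out D -> e l o -> #|nbh o :&: out D| <= 1.
Proof.
move=> cD tD lE oO lo; have [cD1 tD1] := tight_add cD tD lE oO lo.
apply: leq_trans (tight_leaf cD1 tD1 (in_ext_add lE oO lo)).
apply: subset_leq_card; apply/subsetP => z; rewrite out_add // !in_setI in_setD !in_nbh.
move=> /andP[oz zO]; rewrite oz zO andbT /=; apply/negP => lz.
by have := tight_leaf_eq cD tD lE oO zO lo lz => E; rewrite E irrE in oz.
Qed.

(** Otherwise connectedness yields adjacent [x] and [y] in [out D] such that [x] has a neighbour [l]
    in [ext D] and [y] has none. Absorbing [l] and [x] makes [y] an outer neighbour of a tight set,
    so [y] has at most one neighbour besides [x], against k >= 3. *)
Lemma tight_out_ext D o : cset D -> #|ext D|.+1 = 2 * k -> o \in out D ->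
  exists2 l, l \in ext D & e l o.
Proof.
move=> cD tD oO; apply/exists_inP; apply: contraT => noL; exfalso.
pose X := ~: [set o in out D | ~~ [exists l in ext D, e l o]].
have [||x [y [xX yX xy]]] := @connected_cut _ _ connE X.
- have [d dD] := cset_nonempty cD; apply/set0Pn; exists d.
  by rewrite !inE dD.
- by apply/eqP => E; have := in_setT o; rewrite -E in_setC in_set oO noL.
move: yX; rewrite in_setC negbK in_set => /andP[yO nyL].
have xO : x \in out D.
  apply/outP; split; first by apply/negP => xD; have [_ /(_ x xD)] := outP _ _ _ yO; rewrite xy.
  move=> d dD; apply/negP => dx; case/negP: nyL; apply/existsP; exists x; rewrite xy andbT.
  by apply: in_ext dD dx _; apply/negP => xD; have [_ /(_ x xD)] := outP _ _ _ yO; rewrite xy.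
move: xX; rewrite in_setC in_set xO /= negbK => /existsP[l /andP[lE lx]].
have [cD1 tD1] := tight_add cD tD lE xO lx.
have x1 := in_ext_add lE xO lx.
have nly : ~~ e l y by apply: contra nyL => ly; apply/existsP; exists l; rewrite lE.
have y1 : y \in out (l |: D) by rewrite out_add // in_setD in_nbh nly.
have [cD2 tD2] := tight_add cD1 tD1 x1 y1 xy.
have y2 := in_ext_add x1 y1 xy.
have := tight_leaf cD2 tD2 y2.
have sN : nbh y \subset x |: (nbh y :&: out (x |: (l |: D))).
  apply/subsetP => z; rewrite in_setU in_setI !in_nbh in_set1 => yz; rewrite yz /=.
  have zO : z \in out D.
    rewrite in_out; apply/andP; split; apply/negP => zD.
      by have [_ /(_ z zD)] := outP _ _ _ yO; rewrite symE yz.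
    by case/negP: nyL; apply/existsP; exists z; rewrite zD symE.
  have [//|zx] := eqVneq z x; rewrite out_add // in_setD in_nbh out_add // in_setD in_nbh zO andbT.
  apply/andP; split; apply/negP => zz.
    have yz1 := tight_leaf_eq cD1 tD1 x1 y1 _ xy zz.
    rewrite yz1 ?irrE // in yz; rewrite out_add // in_setD in_nbh zO andbT.
    by apply: contraNN zx => lz; rewrite (tight_leaf_eq cD tD lE xO zO lx lz).
  by move: zx; rewrite (tight_leaf_eq cD tD lE xO zO lx zz) eqxx.
have := subset_leq_card sN; rewrite card_nbh cardsU1; slia.
Qed.

Lemma tight_out_deg D o : cset D -> #|ext D|.+1 = 2 * k -> o \in out D ->
  k <= #|nbh o :&: ext D|.+1.
Proof.
move=> cD tD oO; have [l lE lo] := tight_out_ext cD tD oO.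
have := tight_out_nbr cD tD lE oO lo.
have : nbh o \subset (nbh o :&: ext D) :|: (nbh o :&: out D).
  apply/subsetP => z; rewrite in_setU !in_setI in_nbh in_out => oz; rewrite oz /=.
  have [_ noD] := outP _ _ _ oO.
  by case: (boolP (z \in D)) => zD; [move: (noD z zD); rewrite symE oz|rewrite orbN].
move/subset_leq_card; rewrite card_nbh => /leq_trans/(_ (leq_card_setU _ _)); slia.
Qed.

(** Each vertex beyond sends k-1 edges to the 2k-1 outer neighbours, each of which receives at most
    one; three such vertices would send 3k-3 > 2k-1. *)
Lemma tight_out_card D : cset D -> #|ext D|.+1 = 2 * k -> #|out D| <= 2.
Proof.
move=> cD tD; have := double_count symE (out D) (ext D).
have le1 : #|out D| * k.-1 <= \sum_(x in out D) #|nbh x :&: ext D|.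
  rewrite -sum_nat_const; apply: leq_sum => o oO; have := tight_out_deg cD tD oO; slia.
have le2 : \sum_(y in ext D) #|nbh y :&: out D| <= #|ext D|.
  by rewrite -sum1_card; apply: leq_sum => l; apply: tight_leaf.
nia.
Qed.

(** The tight argument with one unit of slack: absorbing vertices along a walk reaches a tight set
    after few steps, or else the edge count applies directly. The value 6 arises only in the last
    case, which forces k = 3. *)
Lemma near_tight_out_card D : cset D -> #|ext D|.+2 = 2 * k ->
  #|out D| <= 6 /\ (3 < k -> #|out D| <= 5) /\ (4 < k -> #|out D| <= 4).
Proof.
move=> cD tD.
have Dadd D' l : cset D' -> l \in ext D' -> cset (l |: D').
  by move=> cD' /extP[lD [x xD xl]]; apply: csetU xl lD.
have split_out D' l : l \in ext D' ->
    #|out D'| = #|out (l |: D')| + #|nbh l :&: out D'|.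
  by move=> lE; rewrite out_add // -(cardsID (nbh l) (out D')) addnC setIC.
have [/exists_inP[l lE l2]|/exists_inPn all1] :=
  boolP [exists l in ext D, 1 < #|nbh l :&: out D| ].
  (* Such an [l] has exactly two neighbours beyond; absorbing it gives a tight set, so at most 2 + 2
     vertices are beyond [D]. *)
  have cD1 := Dadd _ _ cD lE; have := card_ext_add irrE lE; have := leafE cD1.
  move=> le1 eq1; have tD1 : #|ext (l |: D)|.+1 = 2 * k by slia.
  have := tight_out_card cD1 tD1; have := split_out _ _ lE; slia.
have le1 l : l \in ext D -> #|nbh l :&: out D| <= 1.
  by move=> /all1; rewrite -leqNgt.
have uniq_nb l o o' : l \in ext D -> o \in out D -> o' \in out D -> e l o -> e l o' -> o = o'.
  move=> lE oO oO' lo lo'; apply/eqP/negPn/negP => oo'.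
  have := le1 l lE; rewrite leqNgt => /negP; apply.
  apply: (@leq_trans #|[set o; o']|); first by rewrite cards2 oo'.
  by apply: subset_leq_card; rewrite subUset !sub1set !in_setI !in_nbh lo lo' oO oO'.
have card1 l o : l \in ext D -> o \in out D -> e l o -> #|nbh l :&: out D| = 1.
  move=> lE oO lo; have := le1 l lE.
  have: 0 < #|nbh l :&: out D| by apply/card_gt0P; exists o; rewrite in_setI in_nbh lo.
  slia.
have nbO o : o \in out D -> #|nbh o :&: ext D| + #|nbh o :&: out D| = k.
  move=> oO; rewrite -(card_nbh o) -(cardsID (ext D) (nbh o)); congr (_ + _).
  apply: eq_card => z; rewrite in_setI in_setD in_out in_nbh.
  have [oz|] := boolP (e o z); rewrite ?andbF // andbT.
  have [_ noD] := outP _ _ _ oO.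
  by case: (boolP (z \in D)) => // zD; move: (noD z zD); rewrite symE oz.
have nbO1 l o : l \in ext D -> o \in out D -> e l o ->
    nbh o :&: out (l |: D) = nbh o :&: out D.
  move=> lE oO lo; rewrite out_add //; apply/setP => z; rewrite !in_setI in_setD !in_nbh.
  case oz: (e o z) => //=; case zO: (z \in out D); rewrite ?andbF // andbT.
  by apply/negP => lz; have E := uniq_nb l o z lE oO zO lo lz; rewrite E irrE in oz.
have dc (O' : {set T}) : O' \subset out D -> \sum_(o in O') #|nbh o :&: ext D| <= #|ext D|.
  move=> sO; rewrite double_count // -sum1_card; apply: leq_sum => l lE.
  by apply: leq_trans (le1 l lE); apply: subset_leq_card; apply: setIS.
have [/existsP[o /existsP[l /and4P[oO lE lo o2]]]|no2] := boolP
  [exists o, exists l, [&& o \in out D, l \in ext D, e l o & 1 < #|nbh o :&: out D| ]].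
  (* Absorbing [l] is neutral and absorbing [o] then gains one. The new set is tight, and [out D]
     consists of [o], its two neighbours there and at most two more vertices. *)
  have cD1 := Dadd _ _ cD lE; have eq1 := card_ext_add irrE lE.
  have l1 := card1 _ _ lE oO lo; have E1 := split_out _ _ lE.
  have o1 := in_ext_add lE oO lo; have cD2 := Dadd _ _ cD1 o1.
  have eq2 := card_ext_add irrE o1; have E2 := split_out _ _ o1.
  rewrite (nbO1 _ _ lE oO lo) in eq2 E2; have := leafE cD2 => lt2.
  have tD2 : #|ext (o |: (l |: D))|.+1 = 2 * k by slia.
  have le2 := tight_out_card cD2 tD2.
  suff: 4 < k -> #|out (o |: (l |: D))| <= 1 by slia.
  (* If two vertices were left over, they and [o] would send at least 2(k-1) - 2 + (k-2) = 3k-6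
     edges to [ext D], which receives at most 2k-2. *)
  move=> k5; rewrite leqNgt; apply/negP => gt1.
  set O2 := out (o |: (l |: D)) in le2 gt1 E2.
  have sO2 : O2 \subset out D :\ o.
    rewrite /O2 out_add // out_add //; apply/subsetP => z; rewrite !in_setD !in_nbh in_set1.
    by case/and3P => _ lz ->; rewrite andbT; apply: contraNneq lz => ->.
  have := dc (o |: O2); rewrite subUset sub1set oO (subset_trans sO2 (subD1set _ _)) => /(_ isT).
  rewrite big_setU1 /=; last by apply/negP => /(subsetP sO2); rewrite !inE eqxx.
  have sE2 : ext (o |: (l |: D)) \subset ext D :|: (nbh o :&: out D).
    rewrite ext_add // ext_add // -(nbO1 _ _ lE oO lo).
    apply: setUSS (subxx _); apply/subsetP => z; rewrite in_setD1 in_setU in_setD1 in_setI in_nbh.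
    case/andP => zo /orP[/andP[_ //]|/andP[lz zO]].
    by rewrite (uniq_nb l z o) ?eqxx in zo.
  have ge2 : \sum_(i in O2) #|nbh i :&: ext (o |: (l |: D))| <=
      \sum_(i in O2) #|nbh i :&: ext D| + \sum_(i in O2) #|nbh i :&: (nbh o :&: out D)|.
    rewrite -big_split /=; apply: leq_sum => i iO; apply: leq_trans (leq_card_setU _ _).
    by apply: subset_leq_card; rewrite -setIUr; apply: setIS.
  have ge3 : #|O2| * k.-1 <= \sum_(i in O2) #|nbh i :&: ext (o |: (l |: D))|.
    by rewrite -sum_nat_const; apply: leq_sum => i iO; have := tight_out_deg cD2 tD2 iO; slia.
  have le3 : \sum_(i in O2) #|nbh i :&: (nbh o :&: out D)| <= #|nbh o :&: out D|.
    rewrite double_count // -sum1_card; apply: leq_sum => i iO; apply: tight_leaf cD2 tD2 _ _.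
    by rewrite ext_add // in_setU (nbO1 _ _ lE oO lo) iO orbT.
  have := nbO _ oO; nia.
have le1O o : o \in out D -> (exists2 l, l \in ext D & e l o) -> #|nbh o :&: out D| <= 1.
  move=> oO [l lE lo]; rewrite leqNgt; apply/negP => o2; case/negP: no2.
  by apply/existsP; exists o; apply/existsP; exists l; rewrite oO lE lo.
pose O1 := [set o in out D | [exists l in ext D, e l o]].
have O1P o : reflect (o \in out D /\ exists2 l, l \in ext D & e l o) (o \in O1).
  by rewrite [o \in O1]in_set; apply: (iffP andP) => -[-> /exists_inP].
have sO1 : O1 \subset out D by apply/subsetP => o /O1P[].
have O1le : #|O1| <= 2.
  have := dc _ sO1.
  have : #|O1| * k.-1 <= \sum_(i in O1) #|nbh i :&: ext D|.
    rewrite -sum_nat_const; apply: leq_sum => i /O1P[iO Li].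
    have := nbO _ iO; have := le1O _ iO Li; slia.
  nia.
have [E|nE] := eqVneq O1 (out D); first by rewrite -E; slia.
have [||x [y [xX yX xy]]] := @connected_cut _ _ connE (~: (out D :\: O1)).
- by have [d dD] := cset_nonempty cD; apply/set0Pn; exists d; rewrite in_setC in_setD in_out dD andbF.
- apply: contra nE => /eqP EX; rewrite eqEsubset sO1 -setD_eq0 /=.
  by rewrite -(setCK (out D :\: O1)) EX setCT.
move: yX; rewrite in_setC negbK in_setD => /andP[yO1 yO].
have xO : x \in out D.
  apply/outP; split; first by apply/negP => xD; have [_ /(_ x xD)] := outP _ _ _ yO; rewrite xy.
  move=> d dD; apply/negP => dx; case/O1P: yO1; split=> //; exists x => //.
  by apply: in_ext dD dx _; apply/negP => xD; have [_ /(_ x xD)] := outP _ _ _ yO; rewrite xy.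
have xO1 : x \in O1 by move: xX; rewrite in_setC in_setD xO andbT negbK.
have [_ [l lE lx]] := O1P _ xO1.
have cD1 := Dadd _ _ cD lE; have eq1 := card_ext_add irrE lE.
have l1 := card1 _ _ lE xO lx; have E1 := split_out _ _ lE.
have o1 := in_ext_add lE xO lx; have cD2 := Dadd _ _ cD1 o1.
have eq2 := card_ext_add irrE o1; have E2 := split_out _ _ o1.
rewrite (nbO1 _ _ lE xO lx) in eq2 E2.
have x1 : nbh x :&: out D = [set y].
  apply/eqP; rewrite eq_sym eqEcard sub1set in_setI in_nbh xy yO cards1.
  by apply: le1O => //; exists l.
rewrite x1 cards1 in eq2 E2.
have nly : ~~ e l y.
  by apply/negP => ly; case/O1P: yO1; split=> //; exists l.
have yo1 : y \in out (l |: D) by rewrite out_add // in_setD in_nbh nly.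
have y2 := in_ext_add o1 yo1 xy; have cD3 := Dadd _ _ cD2 y2.
have eq3 := card_ext_add irrE y2; have E3 := split_out _ _ y2.
(* All neighbours of [y] except [x] are still beyond, so absorbing [y] gains at least k-2 outer
   neighbours. Only one is available, whence k = 3. *)
have sN : nbh y \subset x |: (nbh y :&: out (x |: (l |: D))).
  apply/subsetP => z; rewrite in_setU in_setI !in_nbh in_set1 => yz; rewrite yz /=.
  have zO : z \in out D.
    rewrite in_out; apply/andP; split; apply/negP => zD.
      by have [_ /(_ z zD)] := outP _ _ _ yO; rewrite symE yz.
    by case/O1P: yO1; split=> //; exists z; rewrite // symE.
  have [//|zx] := eqVneq z x; rewrite out_add // in_setD in_nbh out_add // in_setD in_nbh zO andbT /=.
  apply/andP; split; apply/negP => zz.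
    have: z \in nbh x :&: out D by rewrite in_setI in_nbh zz.
    by rewrite x1 in_set1 => /eqP zy; rewrite zy irrE in yz.
  by move: zx; rewrite (uniq_nb l z x) ?eqxx.
have := subset_leq_card sN; rewrite card_nbh cardsU1 => leN.
have lt3 := leafE cD3.
have k4 : k = 3 by slia.
have tD3 : #|ext (y |: (x |: (l |: D)))|.+1 = 2 * k by slia.
have := tight_out_card cD3 tD3; slia.
Qed.

(** * Absence of cut vertices *)

Section Cut.
Variables (v : T) (A : {set T}).
Hypotheses (vA : v \notin A) (A0 : A != set0).
Hypotheses (closA : forall a, a \in A -> nbh a \subset v |: A) (degv : #|nbh v :&: A| < k).

(** Take [D] with the most outer neighbours in [A] and, among these, the most vertices. If there are
    fewer than k, then [D] and [ext D] cover [A], and every outer neighbour in [A] has two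
    neighbours in [D]. Expelling from [D] a vertex other than [v] that does not disconnect it gains
    an outer neighbour and loses none. *)
Lemma cut_side : exists D, [/\ cset D, v \in D, D \subset v |: A & k <= #|ext D :&: A| ].
Proof.
pose P D := [&& csetb e D, v \in D & D \subset v |: A].
(* A lexicographic order: the factor exceeds every possible [#|D|]. *)
pose f D := #|ext D :&: A| * #|T|.+1 + #|D|.
have P0 : P [set v].
  by rewrite /P set11 sub1set setU11 andbT andbT; apply/(csetP symE)/cset1.
case: (arg_maxnP f P0) => D /and3P[/(csetP symE) cD vD sD] Dmax.
exists D; split=> //; rewrite leqNgt; apply/negP => ltk.
have Pmax X : cset X -> v \in X -> X \subset v |: A -> f X <= f D.
  by move=> cX vX sX; apply: Dmax; rewrite /P vX sX !andbT; apply/(csetP symE).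
have covA : A \subset D :|: ext D.
  apply/negPn/negP => nA.
  have [||x [y [xX yX xy]]] := @connected_cut _ _ connE (A :\: (D :|: ext D)).
  - by rewrite setD_eq0.
  - by apply/negP => /eqP/setP/(_ v); rewrite in_setD (negPf vA) andbF in_setT.
  move: xX; rewrite in_setD in_setU negb_or => /andP[/andP[xD xE] xA].
  have yD : y \notin D by apply: contra xE => yD; apply: in_ext yD _ xD; rewrite symE.
  have /(subsetP (closA xA)) : y \in nbh x by rewrite in_nbh.
  rewrite in_setU1 => /orP[/eqP yv|yA]; first by rewrite yv vD in yD.
  have yE : y \in ext D by move: yX; rewrite in_setD yA andbT negbK in_setU (negPf yD).
  have [_ [d dD dy]] := extP _ _ _ yE.
  have: f (y |: D) <= f D.
    apply: Pmax; first exact: csetU dy yD.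
      by rewrite in_setU1 vD orbT.
    by rewrite subUset sub1set in_setU1 yA orbT.
  rewrite /f cardsU1 yD leqNgt => /negP; apply.
  suff: #|ext D :&: A| <= #|ext (y |: D) :&: A| by clear; nia.
  rewrite (cardsD1 y (ext D :&: A)) in_setI yE yA -ltnS.
  apply: (@leq_ltn_trans #|(x |: ((ext D :&: A) :\ y))|).
    by rewrite cardsU1 in_setD1 in_setI (negPf xE) /= andbF.
  rewrite ltnS; apply: subset_leq_card; rewrite ext_add //; apply/subsetP => z.
  rewrite in_setU1 in_setI in_setU !in_setD1 !in_setI in_nbh.
  case/orP => [/eqP->|/and3P[-> -> ->]//]; rewrite xA andbT symE xy /=.
  by rewrite in_out xD xE orbT.
have two w : w \in ext D :&: A -> 2 <= #|nbh w :&: D|.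
  rewrite in_setI => /andP[wE wA].
  have : nbh w \subset (nbh w :&: D) :|: ((ext D :&: A) :\ w).
    apply/subsetP => z wz; have := subsetP (closA wA) z wz; rewrite in_nbh in wz.
    rewrite in_setU1 in_setU in_setD1 !in_setI in_nbh wz /=.
    case/orP => [/eqP->|zA]; first by rewrite vD.
    have := subsetP covA z zA; rewrite in_setU => /orP[->//|->]; rewrite zA orbC andbT.
    by rewrite (_ : z != w) //; apply: contraTneq wz => ->; rewrite irrE.
  move/subset_leq_card; rewrite card_nbh => /leq_trans/(_ (leq_card_setU _ _)).
  by move: ltk; rewrite (cardsD1 w (ext D :&: A)) in_setI wE wA; slia.
have Dv : D != [set v].
  apply/eqP => Ev; have [a aA] := set0Pn _ A0.
  have sAN : A \subset nbh v :&: A.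
    apply/subsetP => z zA; rewrite in_setI in_nbh zA andbT.
    have := subsetP covA z zA; rewrite Ev in_setU in_set1 => /orP[/eqP zv|/extP[_ [d /set1P->//]]].
    by rewrite zv (negPf vA) in zA.
  have : nbh a \subset v |: (A :\ a).
    apply/subsetP => z az; have := subsetP (closA aA) z az; rewrite !in_setU1 in_setD1.
    case/orP => [->//|->]; rewrite andbT orbC; apply/orP; left.
    by apply: contraTneq az => ->; rewrite in_nbh irrE.
  move/subset_leq_card; rewrite card_nbh cardsU1 in_setD1 (negPf vA) andbF /=.
  have := subset_leq_card sAN; rewrite (cardsD1 a A) aA; slia.
have [u [uD uv cDu]] := cset_noncut symE cD vD Dv.
have uA : u \in A by have := subsetP sD u uD; rewrite in_setU1 (negPf uv).
have vDu : v \in D :\ u by rewrite in_setD1 eq_sym uv.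
have [x [y [xX yX xD uy]]] : exists x y, [/\ x = u, y \in D :\ u, true & e y u].
  have [||x [y [xX yD yX xy]]] := cset_cut symE cD (subD1set D u).
  - by apply/set0Pn; exists v.
  - by apply/eqP => E; move: uD; rewrite -E in_setD1 eqxx.
  exists u, x; split=> //; move: yX; rewrite in_setD1 yD andbT negbK => /eqP yu.
  by rewrite -yu.
have : f (D :\ u) <= f D.
  by apply: Pmax => //; apply: subset_trans sD; apply: subD1set.
rewrite /f (cardsD1 u D) uD leqNgt => /negP; apply.
have le : #|u |: (ext D :&: A)| <= #|ext (D :\ u) :&: A|.
  apply: subset_leq_card; apply/subsetP => z; rewrite in_setU1 => /orP[/eqP->|zEA].
    by rewrite in_setI uA andbT; apply: in_ext yX uy _; rewrite in_setD1 eqxx.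
  have := two z zEA; move: zEA; rewrite !in_setI => /andP[zE zA] g2; rewrite zA andbT.
  have [zD _] := extP _ _ _ zE.
  have: 0 < #|(nbh z :&: D) :\ u| by move: g2; rewrite (cardsD1 u (nbh z :&: D)); case: (u \in _); slia.
  case/card_gt0P => d; rewrite in_setD1 in_setI in_nbh => /and3P[du zd dD].
  apply: (@in_ext _ _ _ d); rewrite ?in_setD1 ?du ?dD 1?symE //.
  by rewrite (negPf zD) andbF.
have uE : u \notin ext D by apply/negP => /extP[]; rewrite uD.
move: le; rewrite cardsU1 in_setI (negPf uE) /= => le.
have T0 : 0 < #|T| by apply/card_gt0P; exists u.
apply: leq_trans (_ : #|ext D :&: A|.+1 * #|T|.+1 + #|D :\ u| <= _).
  have aux M N a : 0 < N -> M + (1 + a) < N.+1 + M + a by clear; lia.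
  by rewrite mulSn /=; apply: aux T0.
by rewrite leq_add2r leq_mul2r le orbT.
Qed.
End Cut.

(** Each side contains a neighbour of [v], so neither contains all k of them and [cut_side] applies
    to both. The union of the two sets obtained is connected through [v] and has 2k outer
    neighbours. *)
Lemma no_cut v (A : {set T}) b : v \notin A -> A != set0 -> b \notin v |: A ->
  (forall a, a \in A -> nbh a \subset v |: A) -> False.
Proof.
move=> vA A0 bA closA; pose B := ~: (v |: A).
have vB : v \notin B by rewrite in_setC in_setU1 eqxx.
have B0 : B != set0 by apply/set0Pn; exists b; rewrite in_setC.
have closB b' : b' \in B -> nbh b' \subset v |: B.
  rewrite in_setC in_setU1 negb_or => /andP[bv bnA]; apply/subsetP => z; rewrite in_nbh => bz.
  rewrite in_setU1 in_setC in_setU1; case: eqVneq => //= zv; apply: contra bnA => zA.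
  have /(subsetP (closA _ zA)) : b' \in nbh z by rewrite in_nbh symE.
  by rewrite in_setU1 (negPf bv).
have side (X Y : {set T}) : [disjoint X & Y] -> Y != set0 -> v \notin Y ->
    (forall y, y \in Y -> nbh y \subset v |: Y) -> #|nbh v :&: X| < k.
  move=> dXY Y0 vY clY.
  have [|y [z [yY zY yz]]] := @connected_cut _ _ connE Y Y0.
  - by apply/eqP => E; rewrite E in_setT in vY.
  have /(subsetP (clY y yY)) : z \in nbh y by rewrite in_nbh.
  rewrite in_setU1 (negPf zY) orbF => /eqP zv.
  rewrite -(card_nbh v); apply: proper_card; apply/properP; split; first exact: subsetIl.
  exists y; first by rewrite in_nbh -zv symE.
  rewrite in_setI negb_and orbC; apply/orP; left; apply/negP => yX.
  by have := disjointFr dXY yX; rewrite yY.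
have dAB : [disjoint A & B].
  rewrite -setI_eq0; apply/eqP/setP => z; rewrite in_setI in_setC in_setU1 in_set0.
  by case: (z \in A); rewrite ?orbT.
have dBA : [disjoint B & A] by rewrite disjoint_sym.
have [D1 [c1 v1 s1 k1]] := cut_side vA A0 closA (side _ _ dAB B0 vB closB).
have [D2 [c2 v2 s2 k2]] := cut_side vB B0 closB (side _ _ dBA A0 vA closA).
have := leafE (csetUset symE c1 c2 v1 v2).
have mono (D D' X Y : {set T}) : v \in D -> [disjoint X & Y] -> v \notin X ->
    D' \subset v |: Y -> ext D :&: X \subset ext (D :|: D').
  move=> vD dXY vX sD'; apply/subsetP => z; rewrite in_setI => /andP[/extP[zD [d dD dz]] zX].
  apply: (@in_ext _ _ _ d) => //; first by rewrite in_setU dD.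
  rewrite in_setU negb_or zD; apply/negP => /(subsetP sD'); rewrite in_setU1 => /orP[/eqP zv|zY].
    by rewrite zv (negPf vX) in zX.
  by rewrite (disjointFr dXY zX) in zY.
have m1 := mono D1 D2 _ _ v1 dAB vA s2.
have m2 : ext D2 :&: B \subset ext (D1 :|: D2).
  by rewrite setUC; apply: mono v2 dBA vB s1.
have : #|(ext D1 :&: A) :|: (ext D2 :&: B)| <= #|ext (D1 :|: D2)|.
  by apply: subset_leq_card; rewrite subUset m1.
have dd : (ext D1 :&: A) :&: (ext D2 :&: B) = set0.
  apply/setP => z; rewrite !in_setI in_set0; case zA: (z \in A); rewrite ?andbF //.
  by rewrite (disjointFr dAB zA) !andbF.
rewrite cardsU dd cards0; slia.
Qed.

End Regular.

(** * Longest cycles *)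

Section Segments.
Variables (T : finType) (e : rel T).
Hypotheses (symE : symmetric e) (irrE : irreflexive e).

(** Paths listed with both ends, which suits concatenation, reversal and closing up to a cycle. *)
Definition seg (u : T) (p : seq T) (v : T) : bool :=
  if p is a :: q then [&& a == u, path e a q & last a q == v] else false.

Lemma seg1 u : seg u [:: u] u.
Proof. by rewrite /= !eqxx. Qed.

Lemma seg_cat u p v u' q w : seg u p v -> e v u' -> seg u' q w -> seg u (p ++ q) w.
Proof.
case: p => //= a p /and3P[/eqP-> up /eqP pv] vu'; case: q => //= b q /and3P[/eqP-> uq /eqP qw].
by rewrite eqxx cat_path last_cat up pv /= vu' uq qw eqxx.
Qed.

Lemma seg_cons u v p w : e u v -> seg v p w -> seg u (u :: p) w.
Proof. by move=> uv; apply: (seg_cat (seg1 u) uv). Qed.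

Lemma seg_rcons u p v w : seg u p v -> e v w -> seg u (p ++ [:: w]) w.
Proof. by move=> up vw; apply: seg_cat up vw (seg1 w). Qed.

Lemma seg_rev u p v : seg u p v -> seg v (rev p) u.
Proof.
elim: p u => //= a p IH u /and3P[/eqP-> up /eqP pv].
case: p up pv IH => [_ /= -> _|b p /= /andP[ub bp] pv IH]; first by rewrite !eqxx.
rewrite rev_cons -cats1; apply: (@seg_rcons _ _ b); last by rewrite symE.
by apply: IH; rewrite eqxx bp pv eqxx.
Qed.

Lemma seg_cycle u p v : seg u p v -> e v u -> cycle e p.
Proof. by case: p => //= a p /and3P[/eqP-> up /eqP pv] vu; rewrite rcons_path up pv. Qed.

Lemma seg_size2 u p v : seg u p v -> u != v -> 1 < size p.
Proof. by case: p => [|a [|b p]] //= /andP[/eqP-> /eqP->]; rewrite eqxx. Qed.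

Lemma count_perm (s t : seq T) : (forall P : pred T, count P s = count P t) -> perm_eq s t.
Proof. by move=> st; apply/permP => P; apply: st. Qed.

Definition longest_cycle (c : seq T) : Prop :=
  [/\ ucycle e c, 2 < size c &
      forall c', ucycle e c' -> 2 < size c' -> size c' <= size c].

(* [N] is the new cycle; it loses [M] from the old one and gains the ear [h].   *)
Lemma reroute c h N M : longest_cycle c -> uniq (c ++ h) ->
  perm_eq (N ++ M) (c ++ h) -> cycle e N -> size h <= size M.
Proof.
move=> [_ c2 cmax] uch pN cN.
have sz : size N + size M = size c + size h.
  by have := perm_size pN; rewrite !size_cat.
have uN : uniq N by move: uch; rewrite -(perm_uniq pN) cat_uniq => /and3P[].
have [gt2|le2] := ltnP 2 (size N); last by slia.
have := cmax N; rewrite /ucycle cN uN => /(_ isT gt2); slia.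
Qed.

Lemma longest_rev c : longest_cycle c -> longest_cycle (rev c).
Proof.
move=> [/andP[cc uc] c2 cmax]; split; rewrite ?size_rev //.
rewrite /ucycle rev_uniq uc andbT rev_cycle.
by rewrite (eq_cycle (e' := e)) // => u v; rewrite symE.
Qed.

End Segments.

Section Cycle.
Variables (T : finType) (e : rel T).
Hypotheses (symE : symmetric e) (irrE : irreflexive e).
Variable c : seq T.
Hypothesis longC : longest_cycle e c.
Local Notation f := (next c).
Local Notation n := (size c).

Lemma uniqC : uniq c. Proof. by have [/andP[]] := longC. Qed.
Lemma sizeC : 2 < n. Proof. by have [] := longC. Qed.

Lemma e_next x : x \in c -> e x (f x).
Proof. by have [/andP[cc _] _ _] := longC; apply: next_cycle. Qed.

Lemma iter_eq i j x : i = j -> iter i f x = iter j f x.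
Proof. by move->. Qed.

Lemma mem_iter i x : (iter i f x \in c) = (x \in c).
Proof. by elim: i => //= i IH; rewrite mem_next. Qed.

Lemma perm_traject x : x \in c -> perm_eq (traject f x n) c.
Proof.
move=> xc; have [i p rc] := rot_to xc.
have: fcycle f (x :: p) by rewrite -rc rot_cycle; apply: cycle_next uniqC.
rewrite /= rcons_path => /andP[/fpathP[m Ep] _].
have -> : n = m.+1 by rewrite -(size_rot i) rc Ep /= size_traject.
by rewrite [traject _ _ _]/= -Ep -rc perm_rot.
Qed.

Lemma uniq_traject x : x \in c -> uniq (traject f x n).
Proof. by move=> xc; rewrite (perm_uniq (perm_traject xc)) uniqC. Qed.

Lemma iter_inj i j x : x \in c -> i < n -> j < n -> iter i f x = iter j f x -> i = j.
Proof.
move=> xc ilt jlt; rewrite -(nth_traject f ilt) -(nth_traject f jlt) => /eqP.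
by rewrite nth_uniq ?size_traject ?uniq_traject // => /eqP.
Qed.

Lemma next_inj : injective f.
Proof. by apply: can_inj (prev_next uniqC). Qed.

Lemma iter_size x : x \in c -> iter n f x = x.
Proof.
move=> xc; have := mem_iter n x; rewrite xc -(perm_mem (perm_traject xc)).
case/trajectP => i ilt E; case: i => [|i] in ilt E *; first by [].
have n0 : 0 < n by apply: leq_trans ilt.
move: E; rewrite -(prednK n0) !iterS => /next_inj E.
have : i = n.-1 by apply/esym/(@iter_inj _ _ x) => //; slia.
slia.
Qed.

Lemma mem_iterP x y : x \in c -> y \in c -> exists2 i, i < n & y = iter i f x.
Proof. by move=> xc; rewrite -(perm_mem (perm_traject xc)) => /trajectP[i ilt ->]; exists i. Qed.

Lemma iter_pred i x : x \in c -> i < n -> iter (n - i) f (iter i f x) = x.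
Proof. by move=> xc ilt; rewrite -iterD subnK ?iter_size // ltnW. Qed.

Lemma prev_iter x : x \in c -> prev c x = iter n.-1 f x.
Proof.
move=> xc; apply: next_inj; rewrite next_prev ?uniqC // -iterS prednK ?iter_size //.
by apply: leq_trans sizeC.
Qed.

Lemma seg_traject x m : x \in c -> 0 < m -> seg e x (traject f x m) (iter m.-1 f x).
Proof.
case: m => // m xc _ /=; rewrite eqxx /= last_traject eqxx andbT.
elim: m x xc => //= m IH x xc; rewrite e_next //=; apply: IH; by rewrite mem_next.
Qed.

Definition ear (x : T) (h : seq T) (y : T) : Prop :=
  [/\ seg e x h y, uniq h & forall z, z \in h -> z \notin c].

Lemma ear1 x : x \notin c -> ear x [:: x] x.
Proof. by move=> xc; split=> //; [apply: seg1|move=> z; rewrite inE => /eqP->]. Qed.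

Lemma ear_rev x h y : ear x h y -> ear y (rev h) x.
Proof.
by move=> [sg uh hc]; split; [apply: seg_rev|rewrite rev_uniq|move=> z; rewrite mem_rev; apply: hc].
Qed.

Lemma ear_uniq x h y : ear x h y -> uniq (c ++ h).
Proof.
move=> [_ uh hc]; rewrite cat_uniq uniqC uh andbT /=.
by apply/hasPn => z /hc.
Qed.

Lemma traject_split x i j : i <= j ->
  traject f x j = traject f x i ++ traject f (iter i f x) (j - i).
Proof. by move=> ij; rewrite -trajectD subnKC. Qed.

Lemma count_traject x P : x \in c -> count P c = count P (traject f x n).
Proof. by move=> xc; apply/permP; rewrite perm_sym perm_traject. Qed.

Section Ear.
Variables (x y : T) (h : seq T).
Hypothesis earh : ear x h y.

(** The ear could replace the [g] vertices between its two attachment vertices. *)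
Lemma gap_ear a g : a \in c -> g.+1 < n -> e a x -> e (iter g.+1 f a) y -> size h <= g.
Proof.
move=> ac gn ax by_; have [sh _ _] := earh.
pose b := iter g.+1 f a; have bc : b \in c by rewrite mem_iter.
rewrite -(size_traject f (f a) g).
apply: (@reroute _ e c h (traject f b (n - g) ++ h)) => //; first exact: ear_uniq earh.
  apply: count_perm => P; rewrite !count_cat.
  rewrite (@count_traject (f a)) ?mem_next // (@traject_split (f a) g n) ?count_cat; last by slia.
  by rewrite -iterSr -/b; slia.
apply: (seg_cycle (u := b) (v := y)); last by rewrite symE.
apply: seg_cat (seg_traject bc _) _ sh; first by slia.
suff -> : iter (n - g).-1 f b = a by [].
by rewrite /b -iterD (_ : _ + _ = n) ?iter_size //; slia.
Qed.

Variables (s1 : T) (m : nat).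
Hypotheses (s1c : s1 \in c) (m0 : 0 < m) (mn : m < n).
Let s2 := iter m f s1.
Hypotheses (e1 : e (iter n.-1 f s1) x) (e2 : e (iter m.-1 f s1) y).

Let s2c : s2 \in c. Proof. by rewrite mem_iter. Qed.
Let ic i : iter i f s1 \in c. Proof. by rewrite mem_iter. Qed.

Let countC P : count P c = count P (traject f s1 m) + count P (traject f s2 (n - m)).
Proof.
rewrite -count_cat -traject_split; last by slia.
exact: count_traject.
Qed.

Let segI j : j < m ->
  seg e (iter m.-1 f s1) (rev (traject f (iter j f s1) (m - j))) (iter j f s1).
Proof.
move=> jm; apply: seg_rev => //.
rewrite (_ : iter m.-1 f s1 = iter (m - j).-1 f (iter j f s1)) ?seg_traject ?ic //; first by slia.
by rewrite -iterD; apply: iter_eq; slia.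
Qed.

Let segII : seg e s2 (traject f s2 (n - m)) (iter n.-1 f s1).
Proof.
rewrite (_ : iter n.-1 f s1 = iter (n - m).-1 f s2) ?seg_traject //; first by slia.
by rewrite /s2 -iterD; apply: iter_eq; slia.
Qed.

(** From the vertex before [s2] go back to the end of the chord, over to [s2], on to the vertex
    before [s1] and home through the ear. Only the first [j] vertices from [s1] on are lost. *)
Lemma cross_first j : j < m -> e (iter j f s1) s2 -> size h <= j.
Proof.
move=> jm js2; have [sh _ _] := earh; rewrite -(size_traject f s1 j).
apply: (@reroute _ e c h
  (rev (traject f (iter j f s1) (m - j)) ++ traject f s2 (n - m) ++ h)) => //.
- exact: ear_uniq earh.
- apply: count_perm => P; rewrite !count_cat count_rev countC.
  by rewrite (@traject_split s1 j m) ?count_cat; slia.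
apply: (seg_cycle (u := iter m.-1 f s1) (v := y)); last by rewrite symE.
exact: seg_cat (segI jm) js2 (seg_cat segII e1 sh).
Qed.

(** From the vertex before [s2] go back to the [j]-th vertex, over to [s1], on to the [i]-th, over
    to [s2], on to the vertex before [s1] and home through the ear. Only the vertices strictly
    between the chords are lost. *)
Lemma cross_second i j : i < j -> j < m -> e (iter i f s1) s2 -> e (iter j f s1) s1 ->
  size h <= j - i.+1.
Proof.
move=> ij jm is2 js1; have [sh _ _] := earh.
rewrite -(size_traject f (iter i.+1 f s1) (j - i.+1)).
apply: (@reroute _ e c h
  (rev (traject f (iter j f s1) (m - j)) ++ traject f s1 i.+1 ++ traject f s2 (n - m) ++ h)) => //.
- exact: ear_uniq earh.
- apply: count_perm => P; rewrite !count_cat count_rev countC.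
  rewrite (@traject_split s1 j m) ?count_cat; last by slia.
  by rewrite (@traject_split s1 i.+1 j) ?count_cat ?subnKC //; slia.
apply: (seg_cycle (u := iter m.-1 f s1) (v := y)); last by rewrite symE.
apply: seg_cat (segI jm) js1 (seg_cat _ is2 (seg_cat segII e1 sh)).
exact: (seg_traject (m := i.+1) s1c).
Qed.

(** The detour through [z] serves as a chord between [s1] and [s2], and the resulting tour loses
    nothing. *)
Lemma no_common_off z : z \notin c -> z \notin h -> e s1 z -> e s2 z -> False.
Proof.
move=> zc zh s1z s2z; have [sh uh hc] := earh.
suff: size (z :: h) <= size (Nil T) by [].
apply: (@reroute _ e c (z :: h)
  (rev (traject f s1 m) ++ z :: traject f s2 (n - m) ++ h)) => //.
- have := ear_uniq earh; rewrite !cat_uniq /= negb_or zh zc /=.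
  by case/and3P => -> -> ->.
- apply: count_perm => P; rewrite !count_cat /= !count_cat count_rev countC; rewrite addn0 -addnA; congr (_ + _); by rewrite addnCA.
apply: (seg_cycle (u := iter m.-1 f s1) (v := y)); last by rewrite symE.
have := segI m0; rewrite /= subn0 => sI.
by apply: seg_cat sI s1z (seg_cons _ (seg_cat segII e1 sh)); rewrite symE.
Qed.

(* Both chords [e s1 p1] and [e s2 p2] bypass an attachment vertex of the ear. *)
Lemma gap_chords : 2 < m -> m.+1 < n -> e s1 (iter n.-2 f s1) -> e s2 (iter m.-2 f s1) ->
  size h + 3 <= m.
Proof.
move=> m3 mn2 ch1 ch2; have [sh _ _] := earh.
suff: size h <= m - 3 by slia.
rewrite -(size_traject f (f s1) (m - 3)).
apply: (@reroute _ e c h ([:: iter n.-1 f s1; s1] ++ rev (traject f s2 (n - m.+1)) ++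
   [:: iter m.-2 f s1; iter m.-1 f s1] ++ rev h)) => //.
- exact: ear_uniq earh.
- apply: count_perm => P; rewrite !count_cat !count_rev countC.
  rewrite (@traject_split s1 1 m) ?count_cat; last by slia.
  rewrite (@traject_split (iter 1 f s1) (m - 3) (m - 1)) ?count_cat; last by slia.
  rewrite (@traject_split s2 (n - m.+1) (n - m)) ?count_cat; last by slia.
  have -> : m - 1 - (m - 3) = 2 by slia.
  have -> : n - m - (n - m.+1) = 1 by slia.
  rewrite /= -iterSr /s2 -iterD.
  have -> : (m - 3).+1 = m.-2 by slia.
  have -> : n - m.+1 + m = n.-1 by slia.
  have -> : f (iter m.-2 f s1) = iter m.-1 f s1.
    by rewrite -iterS (_ : m.-2.+1 = m.-1) //; slia.
  slia.
apply: (seg_cycle (u := iter n.-1 f s1) (v := x)); last by rewrite symE.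
have eN : e (iter n.-1 f s1) s1.
  have := e_next (ic n.-1); rewrite -iterS prednK ?iter_size //; slia.
have eM : e (iter m.-2 f s1) (iter m.-1 f s1).
  have := e_next (ic m.-2); rewrite -iterS (_ : m.-2.+1 = m.-1) //; slia.
have sII : seg e (iter n.-2 f s1) (rev (traject f s2 (n - m.+1))) s2.
  apply: seg_rev => //.
  rewrite (_ : iter n.-2 f s1 = iter (n - m.+1).-1 f s2) ?seg_traject //; first by slia.
  by rewrite /s2 -iterD; apply: iter_eq; slia.
apply: (@seg_cat _ e _ _ s1) (seg_cons eN (seg1 e s1)) ch1 _.
apply: seg_cat sII ch2 _.
apply: (@seg_cat _ e _ _ (iter m.-1 f s1)) (seg_cons eM (seg1 e _)) e2 _.
exact: seg_rev.
Qed.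
End Ear.

(** [x] takes the place of [f a], which is reinserted between [w] and [f w]. *)
Lemma swap_insert x a w : x \notin c -> a \in c -> w \in c ->
  e a x -> e (f (f a)) x -> w != a -> w != f a -> e (f a) w -> e (f a) (f w) -> False.
Proof.
move=> xc ac wc ax bx wa wfa yw yfw; have n3 := sizeC.
pose b := f (f a); have bc : b \in c by rewrite !mem_next.
have [i ilt Ew] := mem_iterP bc wc.
have En : iter n.-2 f b = a.
  by rewrite /b -!iterSr (_ : n.-2.+2 = n) ?iter_size //; slia.
have En' : iter n.-1 f b = f a.
  by rewrite -[in RHS]En -iterS (_ : n.-2.+1 = n.-1) //; slia.
have ia : i.+2 < n.
  have n1 : i <> n.-1 by move=> Ei; rewrite Ew Ei En' eqxx in wfa.
  have n2 : i <> n.-2 by move=> Ei; rewrite Ew Ei En eqxx in wa.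
  by move: n1 n2 ilt n3; clear; lia.
suff: size [:: x] <= size (Nil T) by [].
apply: (@reroute _ e c [:: x]
   ([:: x] ++ traject f b i.+1 ++ [:: f a] ++ traject f (iter i.+1 f b) (n - i.+2))) => //.
- by rewrite cats1 rcons_uniq xc uniqC.
- apply: count_perm => P; rewrite !count_cat /=.
  rewrite (@count_traject (f a)) ?mem_next //.
  rewrite (@traject_split (f a) 1 n) ?count_cat; last by slia.
  rewrite (@traject_split _ i.+1 (n - 1)) ?count_cat; last by slia.
  have -> : n - 1 - i.+1 = n - i.+2 by slia.
  by rewrite /= -/b; slia.
have Ea : iter (n - i.+2).-1 f (iter i.+1 f b) = a.
  by rewrite -iterD -En; apply: iter_eq; slia.
apply: (seg_cycle (u := x) (v := a)) => //.
apply: seg_cat (seg1 e x) _ (seg_cat (seg_traject bc _) _ (seg_cat (seg1 e _) yfw _)) => //.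
- by rewrite symE.
- by rewrite /= -Ew symE.
- by rewrite Ew -iterS -[X in seg _ _ _ X]Ea; apply: seg_traject; rewrite ?mem_iter //; slia.
Qed.

(** From [f p2] round to [s1], over to [p2], back to [s2], over to [f s1], on to the vertex before
    [s2] and home through [x]: this tour covers [c] and [x]. *)
Lemma cross_gap2 x s1 m q : x \notin c -> s1 \in c -> 2 < m -> m <= q -> q.+1 < n ->
  let s2 := iter m f s1 in let p2 := iter q f s1 in
  e (f (f s1)) x -> e (iter m.-1 f s1) x -> e (f p2) x ->
  e s1 p2 -> e s2 (f s1) -> False.
Proof.
move=> xc s1c m3 mq qn s2 p2 bx ax px ch1 ch2.
have ic i : iter i f s1 \in c by rewrite mem_iter.
suff: size [:: x] <= size (Nil T) by [].
apply: (@reroute _ e c [:: x]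
   (traject f (f p2) (n - q.+1) ++ [:: s1] ++ rev (traject f s2 (q.+1 - m)) ++ [:: f s1] ++
    traject f (f (f s1)) (m - 2) ++ [:: x])) => //.
- by rewrite cats1 rcons_uniq xc uniqC.
- apply: count_perm => P; rewrite !count_cat count_rev (@count_traject s1) //.
  rewrite (@traject_split s1 q.+1 n) ?count_cat; last by slia.
  rewrite (@traject_split s1 m q.+1) ?count_cat; last by slia.
  rewrite (@traject_split s1 2 m) ?count_cat; last by slia.
  by rewrite /= /s2 /p2; slia.
apply: (seg_cycle (u := f p2) (v := x)); last by rewrite symE.
have E1 : iter (n - q.+1).-1 f (f p2) = iter n.-1 f s1.
  by rewrite -iterSr -iterD; apply: iter_eq; slia.
have E2 : iter (q.+1 - m).-1 f s2 = p2.
  by rewrite -iterD; apply: iter_eq; slia.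
have E3 : iter (m - 2).-1 f (f (f s1)) = iter m.-1 f s1.
  by rewrite -[f (f s1)]/(iter 2 f s1) -iterD; apply: iter_eq; slia.
have eN : e (iter n.-1 f s1) s1.
  have := e_next (ic n.-1); rewrite -iterS prednK ?iter_size //; slia.
apply: (@seg_cat _ e _ _ (iter n.-1 f s1) s1); last 1 first.
- apply: (seg_cat (seg1 e s1) ch1); apply: (@seg_cat _ e _ _ s2 (f s1)) => //.
    by apply: seg_rev => //; rewrite -[X in seg _ _ _ X]E2 seg_traject ?ic //; slia.
  apply: (@seg_cat _ e _ _ (f s1) (f (f s1))); [exact: seg1|by apply: e_next; rewrite mem_next|].
  apply: seg_rcons ax; rewrite -E3; apply: seg_traject; rewrite ?mem_next //; slia.
- by rewrite -E1; apply: seg_traject; rewrite ?mem_next ?ic //; slia.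
- exact: eN.
Qed.

End Cycle.

(** * Components of the graph off the cycle *)

Section Off.
Variables (T : finType) (e : rel T).
Hypotheses (symE : symmetric e) (irrE : irreflexive e).
Variable c : seq T.
Hypothesis longC : longest_cycle e c.
Local Notation f := (next c).
Local Notation n := (size c).
Local Notation uniqC := (uniqC longC).
Local Notation sizeC := (sizeC longC).

Lemma nextK : cancel f (prev c). Proof. exact: prev_next uniqC. Qed.
Lemma prevK : cancel (prev c) f. Proof. exact: next_prev uniqC. Qed.

Lemma e_prev x : x \in c -> e (prev c x) x.
Proof. by move=> xc; rewrite -{2}(prevK x); apply: (e_next longC); rewrite mem_prev. Qed.

Lemma next_neq x : x \in c -> f x != x.
Proof. by move=> xc; apply: contraTneq (e_next longC xc) => ->; rewrite irrE. Qed.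

Lemma next2_neq x : x \in c -> f (f x) != x.
Proof.
move=> xc; apply/eqP => E; have := @iter_inj _ _ _ longC 2 0 x xc; have := sizeC.
by move=> n3 /(_ n3 (ltnW (ltnW n3)) E).
Qed.

Lemma parity (X : {set T}) : X != set0 -> {subset X <= c} ->
  (forall v, v \in X -> f (f v) \in X) -> forall v, v \in c -> v \in X \/ prev c v \in X.
Proof.
move=> /set0Pn[a aX] sX clX v vc; have [i _ ->] := mem_iterP longC (sX a aX) vc.
elim: i => [|i [] IH]; first by left.
  by right; rewrite iterS nextK.
by left; rewrite iterS -[iter i f a]prevK; apply: clX.
Qed.

Lemma orbit_closed (X : {set T}) a : a \in X -> a \in c ->
  (forall v, v \in X -> f v \in X) -> {subset c <= X}.
Proof.
move=> aX ac clX v vc; have [i _ ->] := mem_iterP longC ac vc.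
by elim: i => //= i IH; apply: clX.
Qed.

Lemma arc_split a b : a \in c -> b \in c -> a != b ->
  exists m, [/\ 0 < m, m < n, f b = iter m f (f a), iter n.-1 f (f a) = a & iter m.-1 f (f a) = b].
Proof.
move=> ac bc ab; have [i ilt Eb] := mem_iterP longC ac bc.
have i0 : 0 < i by case: i ilt Eb ab => // _ ->; rewrite eqxx.
exists i; split=> //.
- by rewrite Eb -iterS -iterSr.
- by rewrite -iterSr prednK ?(iter_size longC) //; have := sizeC; slia.
- by rewrite -iterSr prednK.
Qed.

Lemma ear_size x h y : ear e c x h y -> 0 < size h.
Proof. by case=> + _ _; case: h. Qed.

Section Ends.
Variables (x y : T) (h : seq T) (a b : T).
Hypotheses (earh : ear e c x h y) (ac : a \in c) (bc : b \in c) (ax : e a x) (by_ : e b y).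

Lemma no_consecutive : b != f a.
Proof.
apply/eqP => E; have := ear_size earh.
have := @gap_ear _ _ symE _ longC _ _ _ earh a 0 ac; rewrite /= -E by_ => /(_ _ ax isT).
by have := sizeC; move=> /ltnW -> /(_ isT); case: h.
Qed.

Hypothesis ab : a != b.

Lemma next_indep : ~~ e (f a) (f b).
Proof.
apply/negP => ef; have [m [m0 mn Eb E1 E2]] := arc_split ac bc ab.
have := @cross_first _ _ symE _ longC _ _ _ earh (f a) m; rewrite mem_next E1 E2 -Eb.
by move=> /(_ ac m0 mn ax by_ 0 m0 ef); have := ear_size earh; case: h.
Qed.

(** [cross_first] at [j = 1]: one vertex would be lost, fewer than the ear brings. *)
Lemma next2_indep : 1 < size h -> ~~ e (f (f a)) (f b).
Proof.
move=> h2; apply/negP => ef; have [m [m0 mn Eb E1 E2]] := arc_split ac bc ab.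
have m1 : 1 < m.
  rewrite ltn_neqAle m0 andbT; apply/eqP => m1; move: E2; rewrite -m1 /= => E2.
  by have := no_consecutive; rewrite E2 eqxx.
have := @cross_first _ _ symE _ longC _ _ _ earh (f a) m; rewrite mem_next E1 E2 -Eb.
move=> /(_ ac m0 mn ax by_ 1 m1 ef); move: h2; slia.
Qed.

Lemma next_no_common z : z \notin c -> z \notin h -> e (f a) z -> e (f b) z -> False.
Proof.
move=> zc zh az bz; have [m [m0 mn Eb E1 E2]] := arc_split ac bc ab.
have := @no_common_off _ _ symE _ longC _ _ _ earh (f a) m; rewrite mem_next E1 E2 -Eb.
by move=> /(_ ac m0 mn ax by_ z zc zh az bz).
Qed.
End Ends.

(** For [x] off the cycle, its component in the graph without the cycle. *)
Definition offcomp (x : T) : {set T} :=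
  [set z | connect [rel u v | [&& e u v, u \notin c & v \notin c]] x z].

Section Comp.
Variable x : T.
Hypothesis xc : x \notin c.
Local Notation H := (offcomp x).

Let off_sym : connect_sym [rel u v | [&& e u v, u \notin c & v \notin c]].
Proof. by apply: sym_connect_sym => u v /=; rewrite symE; congr (_ && _); rewrite andbC. Qed.

Lemma comp_refl : x \in H.
Proof. by rewrite inE connect0. Qed.

Lemma comp_off z : z \in H -> z \notin c.
Proof.
rewrite inE => /connectP[p]; elim/last_ind: p => [_ ->//|p w _].
by rewrite rcons_path last_rcons => /andP[_ /and3P[_ _ wc]] ->.
Qed.

Lemma comp_closed y z : y \in H -> e y z -> z \notin c -> z \in H.
Proof.
move=> yH yz zc; have yc := comp_off yH; move: yH; rewrite !inE => /connect_trans; apply.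
by apply: connect1; rewrite /= yz yc.
Qed.

Lemma comp_ear y z : y \in H -> z \in H -> exists h, ear e c y h z /\ {subset h <= H}.
Proof.
move=> yH zH; have yc := comp_off yH.
have: connect [rel u v | [&& e u v, u \notin c & v \notin c]] y z.
  by move: yH zH; rewrite !inE off_sym; apply: connect_trans.
case/connectP => p0 /shortenP[p yp up _] Ez.
have hH : {subset y :: p <= H}.
  elim: p y yH yp {up yc Ez} => [|w p IH] y yH /=; first by move=> _ u; rewrite inE => /eqP->.
  move=> /andP[/and3P[yw _ wc] wp] u; rewrite inE => /orP[/eqP->//|].
  exact: (IH w (comp_closed yH yw wc) wp).
exists (y :: p); split=> //; split=> //; last by move=> u /hH/comp_off.
rewrite /= eqxx -Ez eqxx andbT; apply: sub_path yp => u v /=; by case/and3P.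
Qed.

Lemma comp_ear2 y z : y \in H -> z \in H -> y != z ->
  exists h, [/\ ear e c y h z, {subset h <= H} & 1 < size h].
Proof.
move=> yH zH yz; have [h [eh sh]] := comp_ear yH zH; exists h; split=> //.
by have [sg _ _] := eh; apply: seg_size2 sg yz.
Qed.

Lemma cset_comp : cset e H.
Proof.
apply: (@cset_fill _ e x [set x]); rewrite ?set11 ?sub1set ?comp_refl //; first exact: cset1.
move=> Y xY sY YH; have /subsetPn[z zH zY] : ~~ (H \subset Y).
  by apply: contra YH => sH; rewrite eqEsubset sY.
have := zH; rewrite inE => /connectP[p xp Ez].
suff key q y : y \in Y -> path [rel u v | [&& e u v, u \notin c & v \notin c]] y q -> z = last y q ->
    exists u v, [/\ u \in Y, v \in H, v \notin Y & e u v] by apply: key xY xp Ez.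
elim: q y => [|w q IH] y yY /=; first by move=> _ E; rewrite E yY in zY.
move=> /andP[/and3P[yw yc wc] wp] E.
have [wY|wY] := boolP (w \in Y); first exact: (IH w wY wp E).
by exists y, w; split=> //; apply: comp_closed (subsetP sY _ yY) yw wc.
Qed.

Definition att : {set T} := [set a in c | [exists y in H, e a y]].

Lemma attP a : reflect (a \in c /\ exists2 y, y \in H & e a y) (a \in att).
Proof. by rewrite [a \in att]in_set; apply: (iffP andP) => -[-> /exists_inP]. Qed.

Lemma att_next a : a \in att -> f a \notin att.
Proof.
move=> /attP[ac [y yH ay]]; apply/negP => /attP[fc [z zH fz]].
have [h [eh _]] := comp_ear yH zH.
by have := no_consecutive eh ac ay fz; rewrite eqxx.
Qed.

Lemma att_next_off a y : a \in att -> y \in H -> ~~ e (f a) y.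
Proof.
move=> aA yH; apply/negP => fy; have := att_next aA; apply/negP/negPn.
by apply/attP; split; [rewrite mem_next; case/attP: aA|exists y].
Qed.

Lemma att_indep a b : a \in att -> b \in att -> ~~ e (f a) (f b).
Proof.
have [<- _ _|ab] := eqVneq a b; first by rewrite irrE.
move=> /attP[ac [y yH ay]] /attP[bc [z zH bz]].
by have [h [eh _]] := comp_ear yH zH; apply: next_indep eh ac bc ay bz ab.
Qed.

Lemma att_no_common a b z : a \in att -> b \in att -> a != b -> z \notin c ->
  e (f a) z -> e (f b) z -> False.
Proof.
move=> aA bA ab zc az bz; have zH : z \notin H.
  by apply/negP => zH; have := att_next_off aA zH; rewrite az.
case/attP: aA => ac [y yH ay]; case/attP: bA => bc [w wH bw].
have [h [eh sh]] := comp_ear yH wH.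
apply: (next_no_common eh ac bc ay bw ab zc) az bz; exact: contra (sh z) zH.
Qed.

End Comp.

End Off.

(** * Predecessors, by reversing the cycle *)

Section Reversed.
Variables (T : finType) (e : rel T).
Hypotheses (symE : symmetric e) (irrE : irreflexive e).
Variable c : seq T.
Hypothesis longC : longest_cycle e c.
Let longR : longest_cycle e (rev c) := longest_rev symE longC.
Local Notation uniqC := (uniqC longC).

Lemma next_revE x : next (rev c) x = prev c x.
Proof. exact: next_rev uniqC x. Qed.

Lemma ear_revc x h y : ear e c x h y -> ear e (rev c) x h y.
Proof. by case=> sg uh hc; split=> // z /hc; rewrite mem_rev. Qed.

Lemma prev_indep x y h a b : ear e c x h y -> a \in c -> b \in c -> e a x -> e b y ->
  a != b -> ~~ e (prev c a) (prev c b).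
Proof.
move=> /ear_revc eh ac bc ax by_ ab; rewrite -!next_revE.
by apply: (next_indep symE longR eh); rewrite ?mem_rev.
Qed.

Lemma prev2_indep x y h a b : ear e c x h y -> a \in c -> b \in c -> e a x -> e b y ->
  a != b -> 1 < size h -> ~~ e (prev c (prev c a)) (prev c b).
Proof.
move=> /ear_revc eh ac bc ax by_ ab h2; rewrite -!next_revE.
by apply: (next2_indep symE longR eh); rewrite ?mem_rev.
Qed.

Lemma prev_no_common x y h a b z : ear e c x h y -> a \in c -> b \in c -> e a x -> e b y ->
  a != b -> z \notin c -> z \notin h -> e (prev c a) z -> e (prev c b) z -> False.
Proof.
move=> /ear_revc eh ac bc ax by_ ab zc zh; rewrite -!next_revE.
by apply: (next_no_common symE longR eh); rewrite ?mem_rev.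
Qed.

Variable x : T.
Hypothesis xc : x \notin c.

Lemma att_prev a : a \in att e c x -> prev c a \notin att e c x.
Proof. by move=> aA; apply/negP => /(att_next symE longC xc); rewrite (prevK longC) aA. Qed.

Lemma att_prev_off a y : a \in att e c x -> y \in offcomp e c x -> ~~ e (prev c a) y.
Proof.
move=> aA yH; apply: contra (att_prev aA) => ay; apply/attP; split; last by exists y.
by rewrite mem_prev; case/attP: aA.
Qed.

Lemma att_prev_indep a b : a \in att e c x -> b \in att e c x -> ~~ e (prev c a) (prev c b).
Proof.
have [<- _ _|ab] := eqVneq a b; first by rewrite irrE.
move=> /attP[ac [y yH ay]] /attP[bc [z zH bz]].
by have [h [eh _]] := comp_ear symE xc yH zH; apply: prev_indep eh ac bc ay bz ab.
Qed.

End Reversed.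

(** * Averaging over the neighbours of a missed vertex *)

Section AsratianKhachatrian.
Variables (T : finType) (e : rel T) (k : nat).
Hypotheses (symE : symmetric e) (irrE : irreflexive e) (connE : connected e).
Hypotheses (regE : regular e k) (k3 : 2 < k).
Local Notation nbh := (nbh e).
Local Notation ext := (ext e).
Local Notation out := (out e).
Local Notation cset := (cset e).
Hypothesis leafE : forall D, cset D -> #|ext D| < 2 * k.
Variable c : seq T.
Hypothesis longC : longest_cycle e c.
Local Notation f := (next c).

Lemma card_out (D : {set T}) : #|T| = #|D| + #|ext D| + #|out D|.
Proof.
rewrite -(cardsC (D :|: ext D)) cardsU (_ : _ :&: _ = set0) ?cards0 ?subn0 //.
by apply/setP => z; rewrite in_setI in_set0; apply/negP => /andP[zD /extP[]]; rewrite zD.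
Qed.

Variable x : T.
Hypothesis xc : x \notin c.
Definition nbc : {set T} := nbh x :&: [set z in c].
Local Notation A := nbc.
Local Notation S := (f @: A).

Lemma nbcP a : reflect (a \in c /\ e a x) (a \in A).
Proof. by rewrite in_setI in_nbh in_set symE andbC; apply: andP. Qed.

Lemma nbc_att : A \subset att e c x.
Proof.
apply/subsetP => a /nbcP[ac ax]; apply/attP; split=> //; exists x => //; exact: comp_refl.
Qed.

Lemma in_nextS v : (v \in S) = (prev c v \in A).
Proof.
apply/imsetP/idP => [[a aA ->]|vA]; first by rewrite (nextK longC).
by exists (prev c v); rewrite // (prevK longC).
Qed.

Lemma card_nextS (B : {set T}) : #|f @: B| = #|B|.
Proof. by apply: card_imset; apply: next_inj longC. Qed.

Let star a := f a |: (a |: [set x]).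

Let star_set a : a \in A ->
  [/\ cset (star a), #|star a| = 3 & star a :|: ext (star a) = nbh x :|: nbh a :|: nbh (f a)].
Proof.
move=> /nbcP[ac ax]; have fax := e_next longC ac; have fa := next_neq irrE longC ac.
have fc : f a \in c by rewrite mem_next.
have ax' : a \notin [set x] by rewrite in_set1; apply: contraNneq xc => <-.
have fx' : f a \notin a |: [set x].
  by rewrite !inE negb_or fa; apply: contraNneq xc => <-.
split.
- apply: (@csetU _ _ _ a) => //; last by rewrite in_setU1 eqxx.
  by apply: (@csetU _ _ _ x); rewrite ?set11 1?symE //; apply: cset1.
- by rewrite !cardsU1 fx' ax' cards1.
apply/setP => z; rewrite in_setU [RHS]in_setU [z \in _ :|: nbh a]in_setU !in_nbh; apply/idP/idP.
  case/orP => [|/extP[_ [d]]].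
    by rewrite !inE => /or3P[]/eqP->; rewrite ?fax ?ax ?orbT 1?symE ?ax // symE fax ?orbT.
  by rewrite !inE => /or3P[]/eqP-> ->; rewrite ?orbT.
move=> zU; have [//|zS] := boolP (z \in star a); apply/orP; right.
by case/orP: zU => [/orP[]|] zU; apply: (in_ext _ zU zS); rewrite !inE eqxx ?orbT.
Qed.

(* [star a] has the unions below as closed neighbourhood, hence the upper bound *)
(* [2k+2]; double counting the edges between [A] and [S] bounds their average   *)
(* from below by [2k+1].                                                        *)
Lemma flat_or_small : A != set0 -> #|T| <= 2 * k + 4 \/
  (#|T| <= 2 * k + 7 /\ (3 < k -> #|T| <= 2 * k + 6) /\ (4 < k -> #|T| <= 2 * k + 5)) /\
  (forall a, a \in A -> nbh a \subset nbh x :|: nbh (f a) :|: (x |: S)).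
Proof.
move=> A0.
pose U a := nbh x :|: nbh a :|: nbh (f a).
have cU a : a \in A -> #|U a| = #|ext (star a)| + 3.
  move=> aA; have [_ c3 EU] := star_set aA; rewrite /U -EU cardsU c3 (_ : _ :&: _ = set0) ?cards0; first slia.
  by apply/setP => z; rewrite in_setI in_set0; apply/negP => /andP[zD /extP[]]; rewrite zD.
have [/exists_inP[a aA /eqP tU]|/exists_inPn noT] :=
    boolP [exists a in A, #|U a| == 2 * k + 2].
  left; have [cD c3 _] := star_set aA.
  have tD : #|ext (star a)|.+1 = 2 * k by move: tU; rewrite cU //; slia.
  have := tight_out_card symE irrE connE regE k3 leafE cD tD.
  rewrite (card_out (star a)); slia.
have leU a : a \in A -> #|U a| <= 2 * k + 1.
  move=> aA; have [cD _ _] := star_set aA; have := noT a aA; have := leafE cD.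
  by rewrite cU // => lt /eqP ne; move: lt ne; clear; lia.
pose M a := nbh x :|: nbh (f a); pose X a := x |: (nbh a :&: S).
have attA a : a \in A -> a \in att e c x by apply/subsetP/nbc_att.
have xS : x \notin S by apply: contra xc => /imsetP[a /nbcP[ac _] ->]; rewrite mem_next.
(* A neighbour of [x] off the cycle lies in the component of [x], to which [f a] sends no edge. *)
have MI a : a \in A -> nbh x :&: nbh (f a) = nbh (f a) :&: A.
  move=> aA; apply/setP => z; rewrite !in_setI [z \in [set _ in c]]in_set !in_nbh.
  have [fz|] := boolP (e (f a) z); rewrite ?andbF //= andbT.
  have [xz|//] := boolP (e x z); apply/esym/negPn/negP => zc.
  have := att_next_off symE longC xc (attA a aA) (comp_closed xc (comp_refl e c x) xz zc).
  by rewrite fz.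
have cM a : a \in A -> #|M a| + #|nbh (f a) :&: A| = 2 * k.
  move=> aA; rewrite -MI // cardsU !(card_nbh regE).
  have := subset_leq_card (subsetIl (nbh x) (nbh (f a))); rewrite (card_nbh regE); slia.
have cX a : #|X a| = #|nbh a :&: S| + 1.
  by rewrite cardsU1 in_setI (negPf xS) andbF addnC.
have MX a : a \in A -> #|M a :|: X a| = #|M a| + #|X a|.
  move=> aA; rewrite cardsU (_ : M a :&: X a = set0) ?cards0 ?subn0 //.
  apply/setP => z; rewrite in_set0; apply/negP => /setIP[/setUP zM /setU1P zX].
  rewrite !in_nbh in zM; have xE := comp_refl e c x.
  case: zX => [zx|/setIP[_ /imsetP[b bA zb]]].
    case: zM; rewrite zx; first by rewrite irrE.
    exact/negP/(att_next_off symE longC xc (attA a aA) xE).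
  case: zM; rewrite zb.
    rewrite symE; exact/negP/(att_next_off symE longC xc (attA b bA) xE).
  exact/negP/(att_indep symE irrE longC xc (attA a aA) (attA b bA)).
have sub a : a \in A -> M a :|: X a \subset U a.
  move=> /nbcP[_ ax]; apply/subsetP => z; rewrite /U !in_setU in_set1 in_setI !in_nbh.
  by case/orP => [/orP[->|->]|/orP[/eqP->|/andP[-> _]]]; rewrite ?ax ?orbT.
(* [M a] and [X a] are disjoint parts of [U a], which has at most 2k+1 elements. *)
have le1 a : a \in A -> #|nbh a :&: S| <= #|nbh (f a) :&: A|.
  move=> aA; have := subset_leq_card (sub a aA); rewrite MX // cX.
  have := leU a aA; have := cM a aA; slia.
(* Both sums count the edges between [A] and [S], so equality holds in [le1] for every [a]. *)
have eqS : \sum_(a in A) #|nbh a :&: S| = \sum_(a in A) #|nbh (f a) :&: A|.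
  by rewrite double_count // big_imset //= => a b _ _; apply: next_inj longC _ _.
have eq1 a : a \in A -> #|nbh a :&: S| = #|nbh (f a) :&: A|.
  move=> aA; apply/eqP; rewrite eqn_leq le1 //=.
  move: eqS; rewrite (bigD1 a) //= [RHS](bigD1 a) //= => eqS.
  have : \sum_(i in A | i != a) #|nbh i :&: S| <= \sum_(i in A | i != a) #|nbh (f i) :&: A|.
    by apply: leq_sum => i /andP[iA _]; apply: le1.
  by move: eqS; clear; lia.
have UE a : a \in A -> U a = M a :|: X a.
  move=> aA; apply/eqP; rewrite eq_sym eqEcard sub //= MX // cX.
  have := leU a aA; have := cM a aA; have := eq1 a aA; slia.
right; split; last first.
  move=> a aA; apply: (@subset_trans _ _ (mem (U a))).
    by apply/subsetP => z za; rewrite !in_setU za orbT.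
  rewrite UE // subUset subsetUl /= subUset sub1set !in_setU in_set1 eqxx orbT /=.
  by apply/subsetP => z /setIP[_ zS]; rewrite !in_setU zS !orbT.
have [a aA] := set0Pn _ A0; have [cD c3 _] := star_set aA.
(* [U a] has exactly 2k+1 elements, three of them in [star a]. *)
have tD : #|ext (star a)|.+2 = 2 * k.
  have := cU a aA; rewrite UE // MX // cX; have := cM a aA; have := eq1 a aA; move: k3; slia.
have := near_tight_out_card symE irrE connE regE k3 leafE cD tD.
have := card_out (star a); rewrite c3 => cT.
by move: tD cT; clear; lia.
Qed.

(** Flatness at the neighbour [p a] of [a] leaves two options: [p a] is in [S], or it is adjacent to
    [f a]. In the first case the vertex [p (p a)] of [A] cannot take the second option, whose chord
    would join two predecessors; so a one-vertex gap propagates backwards around the cycle. *)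
Lemma flat_gaps :
  (forall a, a \in A -> nbh a \subset nbh x :|: nbh (f a) :|: (x |: S)) ->
  (forall v, v \in c -> v \in A \/ f v \in A) \/
  (forall a, a \in A -> prev c a \notin S /\ e (f a) (prev c a)).
Proof.
move=> flat; have attA a : a \in A -> a \in att e c x by apply/subsetP/nbc_att.
have xE : x \in offcomp e c x by apply: comp_refl.
have small_or a : a \in A -> prev c a \in S \/ e (f a) (prev c a).
  move=> aA; have /nbcP[ac _] := aA.
  have /(subsetP (flat a aA)) : prev c a \in nbh a by rewrite in_nbh symE (e_prev longC).
  rewrite !in_setU !in_nbh in_set1 -!orbA => /or4P[xp|->|/eqP px|->]; try by [left|right].
    by have := att_prev_off symE longC xc (attA a aA) xE; rewrite symE xp.
  by have := ac; rewrite -(mem_prev c) px (negPf xc).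
pose X := [set a in A | prev c a \in S].
have [X0|X0] := eqVneq X set0.
  right=> a aA; have nS : prev c a \notin S.
    by apply/negP => pS; have := in_set0 a; rewrite -X0 [a \in X]in_set aA pS.
  by split=> //; case: (small_or a aA) => // pS; rewrite pS in nS.
left=> v vc; have longR := longest_rev symE longC.
have: v \in X \/ prev (rev c) v \in X.
  apply: (parity longR); rewrite ?mem_rev //.
    by move=> a; rewrite [a \in X]in_set mem_rev => /andP[/nbcP[]].
  move=> a; rewrite !(next_revE longC) !(in_set (fun a => (a \in A) && (prev c a \in S))).
  case/andP => aA; rewrite in_nextS => bA; rewrite bA /=.
  case: (small_or _ bA) => // ch.
  have := att_prev_indep symE irrE longC xc (attA _ aA) (attA _ bA).
  by rewrite -{1}(prevK longC (prev c a)) ch.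
rewrite (prev_rev (uniqC longC)) !(in_set (fun a => (a \in A) && (prev c a \in S))).
by case=> /andP[->]; [left|right].
Qed.

End AsratianKhachatrian.

(** * Several vertices off the cycle *)

Section Component.
Variables (T : finType) (e : rel T) (k : nat).
Hypotheses (symE : symmetric e) (irrE : irreflexive e) (connE : connected e).
Hypotheses (regE : regular e k) (k3 : 2 < k).
Local Notation nbh := (nbh e).
Local Notation ext := (ext e).
Local Notation out := (out e).
Local Notation cset := (cset e).
Hypothesis leafE : forall D, cset D -> #|ext D| < 2 * k.
Variable c : seq T.
Hypothesis longC : longest_cycle e c.
Local Notation f := (next c).
Local Notation p := (prev c).
Variable x0 : T.
Hypothesis x0c : x0 \notin c.
Local Notation H := (offcomp e c x0).
Local Notation A := (att e c x0).
Hypothesis H2 : 1 < #|H|.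
Local Notation nbc := (nbc e c).

Let offH y : y \in H -> y \notin c. Proof. exact: comp_off. Qed.

Lemma nbc_comp y : y \in H -> nbc y \subset A.
Proof.
move=> yH; apply/subsetP => a /(nbcP symE)[ac ay]; apply/attP; split=> //; by exists y.
Qed.

Lemma nbh_comp y : y \in H -> nbh y \subset H :|: nbc y.
Proof.
move=> yH; apply/subsetP => z yz; rewrite in_setU.
case: (boolP (z \in c)) => zc; last by rewrite (comp_closed x0c yH _ zc) // -in_nbh.
by rewrite orbC in_setI yz in_set zc.
Qed.

Lemma no_gap1 a y z : a \in c -> y \in H -> z \in H -> y != z -> e a y -> e (f (f a)) z -> False.
Proof.
move=> ac yH zH yz ay bz; have [h [eh _ h2]] := comp_ear2 symE x0c yH zH yz.
have := @gap_ear _ _ symE _ longC _ _ _ eh a 1 ac (sizeC longC) ay bz; move: h2; slia.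
Qed.

(** Otherwise [y] would separate the rest of its component from the cycle. *)
Lemma other_vertex y : y \in H -> exists z, [/\ z \in H, z != y & nbc z != set0].
Proof.
move=> yH; have [/exists_inP[z zH /andP[zy z0]]|/exists_inPn noz] :=
  boolP [exists z in H, (z != y) && (nbc z != set0)]; first by exists z.
exfalso.
have [a ac] : exists a, a \in c.
  by have := sizeC longC; case: c => // a s _; exists a; rewrite inE eqxx.
apply: (@no_cut _ e k symE irrE connE regE k3 leafE y (H :\ y) a).
- by rewrite in_setD1 eqxx.
- have: 0 < #|H :\ y| by move: H2; rewrite (cardsD1 y) yH.
  by rewrite card_gt0.
- by rewrite setD1K //; apply/negP => /offH; rewrite ac.
- move=> z /setD1P[zy zH]; rewrite setD1K //; apply: subset_trans (nbh_comp zH) _.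
  by rewrite subUset subxx /=; have := noz z zH; rewrite zy /= negbK => /eqP->; rewrite sub0set.
Qed.

Lemma other_att a : a \in c -> exists b, b \in A :\ a.
Proof.
move=> ac; apply/set0Pn/negP => /eqP A0.
apply: (@no_cut _ e k symE irrE connE regE k3 leafE a H (f a)).
- by apply/negP => /offH; rewrite ac.
- by apply/set0Pn; exists x0; apply: comp_refl.
- rewrite in_setU1 negb_or (next_neq irrE longC) //=; apply/negP => /offH.
  by rewrite mem_next ac.
- move=> z zH; apply: subset_trans (nbh_comp zH) _; rewrite subUset subsetUr /=.
  apply/subsetP => b bz; rewrite in_setU1; apply/orP; left; apply/negPn/negP => ba.
  have := in_set0 b; rewrite -A0 in_setD1 ba /= => /negP; apply.
  exact: (subsetP (nbc_comp zH)).
Qed.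

(** Two independent edges between the component and the cycle: neither one vertex of [H] nor one
    vertex of the cycle meets all such edges, as it would be a cut vertex. *)
Lemma two_edges : exists y z a b,
  [/\ y \in H, z \in H & y != z] /\ [/\ a \in nbc y, b \in nbc z & a != b].
Proof.
have [y [yH _ /set0Pn[a ay]]] := other_vertex (comp_refl e c x0).
have [z [zH zy /set0Pn[b bz]]] := other_vertex yH.
have [ab|ab] := eqVneq a b; last by exists y, z, a, b; rewrite eq_sym zy.
have /(nbcP symE)[ac _] := ay.
have [d /setD1P[da /attP[dc [w wH dw]]]] := other_att ac.
have [wy|wy] := eqVneq w y.
  exists z, w, a, d; split; split=> //; first by rewrite wy.
  - by rewrite ab.
  - exact/(nbcP symE).
  - by rewrite eq_sym.
exists y, w, a, d; split; split=> //; first by rewrite eq_sym.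
- exact/(nbcP symE).
- by rewrite eq_sym.
Qed.

Lemma att_deg a : a \in A -> #|nbh a :&: H| + 2 <= k.
Proof.
move=> aA; have /attP[ac _] := aA; rewrite -(card_nbh regE a) -(cardsID H (nbh a)) leq_add2l.
apply: (@leq_trans #|[set f a; p a]|).
  rewrite cards2 (_ : f a != p a) //; apply/eqP => E.
  by have := next2_neq longC ac; rewrite E (prevK longC) eqxx.
have nH v : v \in c -> v \notin H by move=> vc; apply/negP => /offH; rewrite vc.
apply: subset_leq_card; rewrite subUset !sub1set !in_setD !nH ?mem_next ?mem_prev //= !in_nbh.
by rewrite (e_next longC) //= symE (e_prev longC).
Qed.

(** * A component with two vertices *)

Section Pair.
Variables x y : T.
Hypotheses (EH : H = [set x; y]) (xy : x != y).

Let xH : x \in H. Proof. by rewrite EH !inE eqxx. Qed.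
Let yH : y \in H. Proof. by rewrite EH !inE eqxx orbT. Qed.

Lemma pair_adj : e x y.
Proof.
have [|||u [v [uX vH vX uv]]] := cset_cut symE (cset_comp e x0c) (_ : [set x] \subset H).
- by rewrite sub1set.
- by apply/set0Pn; exists x; rewrite in_set1.
- by rewrite EH; apply/negP => /eqP/setP/(_ y); rewrite !inE eqxx eq_sym (negPf xy) orbT.
move: uX vH vX uv; rewrite EH !inE => /eqP-> /orP[/eqP->|/eqP->] //; by rewrite eqxx.
Qed.

Lemma card_pair_nbc z : z \in H -> #|nbc z| = k.-1.
Proof.
move=> zH; have := card_nbh regE z; rewrite -(cardsID [set v in c] (nbh z)).
suff -> : #|nbh z :\: [set v in c]| = 1 by rewrite /nbc; slia.
pose w := if z == x then y else x.
rewrite (_ : _ :\: _ = [set w]) ?cards1 //; apply/setP => v; rewrite in_setD !in_set in_set1.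
have zw : e z w.
  rewrite /w; case: eqP => [->|/eqP zx]; first exact: pair_adj.
  by move: zH; rewrite EH !inE (negPf zx) => /eqP->; rewrite symE pair_adj.
apply/andP/eqP => [[vc zv]|->]; last first.
  by split=> //; apply: offH; rewrite /w; case: ifP.
have := comp_closed x0c zH zv vc; rewrite EH !inE.
have: v != z by apply: contraTneq zv => ->; rewrite irrE.
move: zH; rewrite EH !inE /w => /orP[]/eqP->; first by rewrite eqxx => /negPf-> /eqP->.
by rewrite [y == x]eq_sym (negPf xy) orbC => /negPf-> /eqP->.
Qed.

Lemma pair_att : A = nbc x :|: nbc y.
Proof.
apply/eqP; rewrite eqEsubset subUset !nbc_comp // !andbT; apply/subsetP => a /attP[ac [z zH az]].
rewrite in_setU; move: zH; rewrite EH !inE => /orP[]/eqP E; rewrite E in az; rewrite !(symE _ a) az ac;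
  by rewrite ?orbT.
Qed.

Local Notation S := (f @: A).
Local Notation P := (p @: A).

Let inS v : (v \in S) = (p v \in A).
Proof.
apply/imsetP/idP => [[a aA ->]|vA]; first by rewrite (nextK longC).
by exists (p v); rewrite // (prevK longC).
Qed.

Let inP v : (v \in P) = (f v \in A).
Proof.
apply/imsetP/idP => [[a aA ->]|vA]; first by rewrite (prevK longC).
by exists (f v); rewrite // (nextK longC).
Qed.

Let cardS : #|S| = #|A|. Proof. by apply: card_imset; apply: next_inj longC. Qed.
Let cardP : #|P| = #|A|. Proof. by apply: card_imset; apply: can_inj (prevK longC). Qed.

Let attc a : a \in A -> a \in c. Proof. by case/attP. Qed.

Let SPoff v : v \in S :|: P -> v \in c /\ v \notin A.
Proof.
case/setUP => /imsetP[a aA ->]; rewrite ?mem_next ?mem_prev (attc aA); split=> //.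
  by have := att_next symE longC x0c aA.
by have := att_prev symE longC x0c aA.
Qed.

Let SP_ext (D : {set T}) v : v \in S :|: P -> A \subset D -> v \notin D -> v \in ext D.
Proof.
case/setUP => /imsetP[a aA ->] /subsetP sD vD.
  by apply: (in_ext (sD a aA) _ vD); apply: (e_next longC); apply: attc.
by apply: (in_ext (sD a aA) _ vD); rewrite symE (e_prev longC) // attc.
Qed.

(** Otherwise both private neighbourhoods [X] and [Y] are nonempty. One-vertex gaps occur only
    between two vertices of [X] or two of [Y], at most |X|-1 and |Y|-1 times, so [S] and [P] overlap
    little and form at least 2k outer neighbours of {x, y} with [A]. *)
Lemma pair_same : nbc x = nbc y.
Proof.
apply/eqP/negPn/negP => ne.
pose X := nbc x :\: nbc y; pose Y := nbc y :\: nbc x.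
have cx := card_pair_nbc xH; have cy := card_pair_nbc yH.
have IX := cardsID (nbc y) (nbc x); have IY := cardsID (nbc x) (nbc y).
rewrite -/X -/Y [nbc y :&: nbc x]setIC in IX IY.
have X0 : 0 < #|X|.
  rewrite card_gt0 setD_eq0; apply: contra ne => sxy.
  by rewrite eqEcard sxy cx cy leqnn.
pose small (Z : {set T}) := [set a in Z | f (f a) \in Z].
(* If [Z] were closed under double steps, a vertex of [Z'] or its predecessor would lie in [Z],
   against disjointness or the rule that attachment vertices are not consecutive. *)
have small_lt (Z Z' : {set T}) : 0 < #|Z| -> Z \subset A -> 0 < #|Z'| -> Z' \subset A ->
    [disjoint Z & Z'] -> #|small Z| < #|Z|.
  move=> Z0 sZ /card_gt0P[b bZ'] sZ' dZ; apply: proper_card; apply/properP; split.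
    by apply/subsetP => a; rewrite [a \in small Z]in_set => /andP[].
  have [/exists_inP[a aZ aN]|/exists_inPn all] := boolP [exists a in Z, a \notin small Z].
    by exists a.
  exfalso.
  have [|||bZ|pZ] := @parity _ _ _ longC Z _ _ _ b (attc (subsetP sZ' b bZ')).
  - by rewrite -card_gt0.
  - by move=> a /(subsetP sZ)/attc.
  - by move=> a aZ; have := all a aZ; rewrite negbK [a \in small Z]in_set aZ.
  - by rewrite (disjointFr dZ bZ) in bZ'.
  - have := att_prev symE longC x0c (subsetP sZ' b bZ').
    by rewrite (subsetP sZ _ pZ).
have sXA : X \subset A by apply: subset_trans (subsetDl _ _) (nbc_comp xH).
have sYA : Y \subset A by apply: subset_trans (subsetDl _ _) (nbc_comp yH).
have dXY : [disjoint X & Y].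
  rewrite -setI_eq0; apply/eqP/setP => v; rewrite in_setI !in_setD in_set0.
  by case: (v \in nbc x); rewrite ?andbF.
have dYX : [disjoint Y & X] by rewrite disjoint_sym.
have Y0 : 0 < #|Y| by move: X0 IX IY cx cy; slia.
have ltX := small_lt X Y X0 sXA Y0 sYA dXY.
have ltY := small_lt Y X Y0 sYA X0 sXA dYX.
have SI : S :&: P \subset f @: (small X :|: small Y).
  apply/subsetP => v /setIP[/imsetP[a aA ->]]; rewrite inP => bA.
  apply: imset_f; have ac := attc aA.
  have nxy : a \in nbc x -> f (f a) \notin nbc y.
    move=> /(nbcP symE)[_ ax]; apply/negP => /(nbcP symE)[_ bY].
    exact: no_gap1 ac xH yH xy ax bY.
  have nyx : a \in nbc y -> f (f a) \notin nbc x.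
    move=> /(nbcP symE)[_ ay]; apply/negP => /(nbcP symE)[_ bX].
    by apply: no_gap1 ac yH xH _ ay bX; rewrite eq_sym.
  move: aA bA nxy nyx; rewrite pair_att !in_setU.
  rewrite [a \in small X]in_set [a \in small Y]in_set !in_setD.
  case: (a \in nbc x); case: (a \in nbc y); case: (f (f a) \in nbc x); case: (f (f a) \in nbc y) => //= _ _ h1 h2;
    by [have := h1 isT|have := h2 isT].
have cSI := subset_leq_card SI; rewrite card_imset in cSI; last exact: next_inj longC.
have cU := cardsU (nbc x) (nbc y); rewrite -pair_att in cU.
have cSP := cardsU S P; rewrite cardS cardP in cSP.
have leU : #|small X :|: small Y| <= #|small X| + #|small Y| := leq_card_setU _ _.
have ge2k : 2 * k <= #|S :|: P|.
  have le1 := subset_leq_card (subsetIl S P); rewrite cardS in le1.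
  have le2 := subset_leq_card (subsetIl (nbc x) (nbc y)).
  move: IX IY cx cy ltX ltY cSI cU cSP leU X0 Y0 le1 le2 k3; slia.
have cxy : cset [set x; y].
  rewrite setUC; apply: (@csetU _ _ _ x); rewrite ?set11 ?pair_adj //; first exact: cset1.
  by rewrite in_set1 eq_sym.
have cD : cset ([set x; y] :|: A).
  apply: cset_addnbrs => //; apply/subsetP => a aA; have [ac [z zH az]] := attP _ _ _ _ aA.
  rewrite -EH; apply: (in_ext zH); first by rewrite symE.
  by apply/negP => /offH; rewrite ac.
have := leafE cD; rewrite ltnNge => /negP; apply; apply: leq_trans ge2k _.
apply: subset_leq_card; apply/subsetP => v vSP; have [vc vA] := SPoff vSP.
apply: SP_ext vSP (subsetUr _ _) _; rewrite in_setU negb_or vA andbT -EH.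
by apply/negP => /offH; rewrite vc.
Qed.

Let EA : A = nbc x. Proof. by rewrite pair_att -pair_same setUid. Qed.

Let Ax a : a \in A -> e a x. Proof. by rewrite EA => /(nbcP symE)[]. Qed.
Let Ay a : a \in A -> e a y. Proof. by rewrite EA pair_same => /(nbcP symE)[]. Qed.
Let cardA : #|A| = k.-1. Proof. by rewrite EA card_pair_nbc. Qed.

Let SP0 : S :&: P = set0.
Proof.
apply/setP => v; rewrite in_set0; apply/negP => /setIP[/imsetP[a aA ->]]; rewrite inP => bA.
exact: no_gap1 (attc aA) xH yH xy (Ax aA) (Ay bA).
Qed.

Let cardSP : #|S :|: P| = 2 * k - 2.
Proof. rewrite cardsU SP0 cards0 cardS cardP cardA; slia. Qed.

Let xA : x \notin A. Proof. by apply/negP => /attc; rewrite (negPf (offH xH)). Qed.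
Let yA : y \notin A. Proof. by apply/negP => /attc; rewrite (negPf (offH yH)). Qed.

Let D := x |: A.

Let cD (B : {set T}) : B \subset A -> cset (x |: B).
Proof.
move=> sB; apply: cset_addnbrs; first exact: cset1.
apply/subsetP => a /(subsetP sB) aA; apply: (in_ext (set11 x)); first by rewrite symE Ax.
by rewrite in_set1; apply: contraTneq aA => ->.
Qed.

Let ySP : y \notin S :|: P.
Proof. by apply/negP => /SPoff[]; rewrite (negPf (offH yH)). Qed.

(** These are already 2k-1 outer neighbours, so there are no others and [D] is tight. *)
Let extD : ext D = y |: (S :|: P).
Proof.
apply/esym/eqP; rewrite eqEcard cardsU1 ySP cardSP; apply/andP; split; last first.
  have := leafE (cD (subxx A)); rewrite -/D; slia.
apply/subsetP => v /setU1P[->|vSP].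
  apply: (@in_ext _ _ _ x); rewrite ?setU11 ?pair_adj // in_setU1 negb_or (negPf yA).
  by rewrite eq_sym xy.
have [vc vA] := SPoff vSP; apply: SP_ext vSP (subsetUr _ _) _.
by rewrite in_setU1 negb_or vA andbT; apply: contraTneq vc => ->; apply: offH.
Qed.

Let tD : #|ext D|.+1 = 2 * k.
Proof. rewrite extD cardsU1 ySP cardSP; move: k3; slia. Qed.

Let csub v : v \in c -> [|| v \in A, v \in S, v \in P | v \in out D].
Proof.
move=> vc; rewrite in_out extD in_setU1 !in_setU1 in_setU.
rewrite (_ : (v == x) = false); last by apply: contraTF vc => /eqP->; apply: offH.
rewrite (_ : (v == y) = false); last by apply: contraTF vc => /eqP->; apply: offH.
by case: (v \in A); case: (v \in S); case: (v \in P).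
Qed.

Let k4 : 3 < k.
Proof.
have : 0 < #|A| by rewrite cardA; move: k3; slia.
case/card_gt0P => a aA; have := att_deg aA.
suff -> : nbh a :&: H = H by move: H2; slia.
apply/setIidPr; rewrite EH; apply/subsetP => z; rewrite in_nbh !inE => /orP[]/eqP->.
  exact: Ax.
exact: Ay.
Qed.

Let ear_xy : exists h, ear e c x h y /\ 1 < size h.
Proof. by have [h [eh _ h2]] := comp_ear2 symE x0c xH yH xy; exists h. Qed.

Let far_next a b : a \in A -> b \in A -> a != b -> ~~ e (f (f a)) (f b).
Proof.
move=> aA bA ab; have [h [eh h2]] := ear_xy.
exact: (next2_indep symE longC eh (attc aA) (attc bA) (Ax aA) (Ay bA) ab h2).
Qed.

Let far_prev a b : a \in A -> b \in A -> a != b -> ~~ e (p (p a)) (p b).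
Proof.
move=> aA bA ab; have [h [eh h2]] := ear_xy.
exact: (prev2_indep symE longC eh (attc aA) (attc bA) (Ax aA) (Ay bA) ab h2).
Qed.

Let out_notin o : o \in out D -> [/\ o \notin A, o \notin S, o \notin P, o != x & o != y].
Proof.
rewrite in_out extD in_setU1 negb_or in_setU1 in_setU !negb_or.
by case/andP => /andP[-> ->] /and3P[-> -> ->].
Qed.

Let out_nbh_y o : o \in out D -> ~~ e o y.
Proof.
move=> oO; have [oA _ _ ox oy] := out_notin oO; apply/negP => yo.
have /(subsetP (nbh_comp yH))/setUP[] : o \in nbh y by rewrite in_nbh symE.
  by rewrite EH !inE (negPf ox) (negPf oy).
by move/(subsetP (nbc_comp yH)); rewrite (negPf oA).
Qed.

Let out_deg o : o \in out D -> k <= (#|nbh o :&: S| + #|nbh o :&: P|).+1.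
Proof.
move=> oO; apply: leq_trans (tight_out_deg symE irrE connE regE k3 leafE (cD (subxx A)) tD oO) _.
rewrite ltnS; apply: leq_trans (leq_card_setU _ _); apply: subset_leq_card.
rewrite extD -setIUr; apply/subsetP => z /setIP[oz /setU1P[zy|zSP]]; last by rewrite in_setI oz.
by have := out_nbh_y oO; rewrite -zy -in_nbh oz.
Qed.

Let out_S1 o : o \in out D -> p o \in S -> #|nbh o :&: S| <= 1.
Proof.
move=> oO /imsetP[a aA pa]; have oE : o = f (f a) by rewrite -pa (prevK longC).
apply: (@leq_trans #|[set f a]|); last by rewrite cards1.
apply: subset_leq_card; apply/subsetP => z /setIP[oz /imsetP[b bA zb]].
have [->|ab] := eqVneq a b; first by rewrite zb in_set1.
by have := far_next aA bA ab; rewrite -oE -zb -in_nbh oz.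
Qed.

Let out_P1 o : o \in out D -> f o \in P -> #|nbh o :&: P| <= 1.
Proof.
move=> oO /imsetP[a aA fa]; have oE : o = p (p a) by rewrite -fa (nextK longC).
apply: (@leq_trans #|[set p a]|); last by rewrite cards1.
apply: subset_leq_card; apply/subsetP => z /setIP[oz /imsetP[b bA zb]].
have [->|ab] := eqVneq a b; first by rewrite zb in_set1.
by have := far_prev aA bA ab; rewrite -oE -zb -in_nbh oz.
Qed.

(** Off the cycle, [o] would see at most one vertex of [S] and one of [P], but it needs k-1 >= 3
    neighbours there. *)
Let out_c o : o \in out D -> o \in c.
Proof.
move=> oO; apply/negPn/negP => oc; have := out_deg oO.
have S1 : #|nbh o :&: S| <= 1.
  apply/card_le1_eqP => u v /setIP[ou /imsetP[a aA ua]] /setIP[ov /imsetP[b bA vb]].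
  have [ab|ab] := eqVneq a b; first by rewrite ua vb ab.
  exfalso; apply: (att_no_common symE longC x0c aA bA ab oc).
    by rewrite -ua symE -in_nbh.
  by rewrite -vb symE -in_nbh.
have P1 : #|nbh o :&: P| <= 1.
  apply/card_le1_eqP => u v /setIP[ou /imsetP[a aA ua]] /setIP[ov /imsetP[b bA vb]].
  have [ab|ab] := eqVneq a b; first by rewrite ua vb ab.
  have [oA _ _ ox oy] := out_notin oO.
  have [h [eh sh _]] := comp_ear2 symE x0c xH yH xy.
  exfalso; apply: (prev_no_common symE longC eh (attc aA) (attc bA) (Ax aA) (Ay bA) ab oc).
  - by apply/negP => /sh; rewrite EH !inE (negPf ox) (negPf oy).
  - by rewrite -ua symE -in_nbh.
  - by rewrite -vb symE -in_nbh.
by move: S1 P1 k4; slia.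
Qed.

Let out_prev o : o \in out D -> p o \in S \/ p o \in out D.
Proof.
move=> oO; have [oA oS _ _ _] := out_notin oO.
have := csub (_ : p o \in c); rewrite mem_prev out_c // => /(_ isT).
case/or4P => [pA|->|pP|->]; try by [left|right].
  by rewrite inS pA in oS.
by move: pP; rewrite inP (prevK longC) (negPf oA).
Qed.

Let out_next o : o \in out D -> f o \in P \/ f o \in out D.
Proof.
move=> oO; have [oA _ oP _ _] := out_notin oO.
have := csub (_ : f o \in c); rewrite mem_next out_c // => /(_ isT).
case/or4P => [fA|fS|->|->]; try by [left|right].
  by rewrite inP fA in oP.
by move: fS; rewrite inS (nextK longC) (negPf oA).
Qed.

(** A single vertex beyond [D] between [S] and [P] sees at most one vertex of each, too few.
    Otherwise two consecutive ones [o1] and [o2] fill the middle of a gap following some [a], and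
    the path x, a, f a, o1, o2 has at least 3k-4 >= 2k outer neighbours. *)
Let out0 : out D = set0.
Proof.
apply/eqP/negPn/negP => /set0Pn[o oO].
have tl := tight_leaf_eq irrE k3 leafE (cD (subxx A)) tD.
have [o1 [o1O o2O]] : exists o1, o1 \in out D /\ f o1 \in out D.
  case: (out_next oO) => [fP|]; last by exists o.
  case: (out_prev oO) => [pS|pO]; last by exists (p o); rewrite (prevK longC).
  have := out_S1 oO pS; have := out_P1 oO fP; have := out_deg oO; move: k4; slia.
have le2 := tight_out_card symE irrE connE regE k3 leafE (cD (subxx A)) tD.
have o1c := out_c o1O; have o12 : f o1 != o1 by apply: next_neq.
have EO : out D = [set o1; f o1].
  apply/esym/eqP; rewrite eqEcard cards2 eq_sym o12 le2 andbT.
  by rewrite subUset !sub1set o1O.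
have pS : p o1 \in S.
  case: (out_prev o1O) => //; rewrite EO !inE => /orP[/eqP E|/eqP E].
    by have := o12; rewrite -{1}E (prevK longC) eqxx.
  by have := next2_neq longC o1c; rewrite -E (prevK longC) eqxx.
have fP : f (f o1) \in P.
  case: (out_next o2O) => //; rewrite EO !inE => /orP[/eqP E|/eqP E].
    by have := next2_neq longC o1c; rewrite E eqxx.
  by move: (next_inj longC E) => E'; rewrite E' eqxx in o12.
have [a aA pa] := imsetP pS; set o2 := f o1 in o2O o12 EO fP *.
have e12 : e o1 o2 by apply: e_next.
have ea1 : e (p o1) o1 by apply: e_prev.
have e2f : e o2 (f o2) by apply: (e_next longC); rewrite mem_next.
have extS z : z \in S -> z \in ext D by rewrite extD !in_setU => ->; rewrite orbT.
have extP' z : z \in P -> z \in ext D by rewrite extD !in_setU => ->; rewrite !orbT.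
have n2p : ~~ e o2 (p o1).
  apply/negP => E; have := tl (p o1) o1 o2 (extS _ pS) o1O o2O ea1.
  by rewrite symE => /(_ E) E12; rewrite -E12 eqxx in o12.
have n1f : ~~ e o1 (f o2).
  apply/negP => E; have := tl (f o2) o1 o2 (extP' _ fP) o1O o2O.
  by rewrite ![e (f o2) _]symE => /(_ E e2f) E12; rewrite -E12 eqxx in o12.
have aD : a \notin [set x] by rewrite in_set1; apply: contraTneq aA => ->.
have paA : p o1 \notin A by have [] := SPoff (_ : p o1 \in S :|: P); rewrite // in_setU pS.
have pac : p o1 \in c by rewrite mem_prev.
have cx v : v \in c -> v != x by move=> vc; apply: contraTneq vc => ->; apply: offH.
have cy v : v \in c -> v != y by move=> vc; apply: contraTneq vc => ->; apply: offH.
have [o1A o1S o1P o1x o1y] := out_notin o1O; have [o2A o2S o2P o2x o2y] := out_notin o2O.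
pose D1 := p o1 |: (a |: [set x]); pose D2 := o1 |: D1; pose D3 := o2 |: D2.
have nA u v : u \notin A -> v \in A -> u != v by move=> uA vA; apply: contraNneq uA => ->.
have nS u v : u \notin S -> v \in S -> u != v by move=> uA vA; apply: contraNneq uA => ->.
have nP u v : u \notin P -> v \in P -> u != v by move=> uA vA; apply: contraNneq uA => ->.
have c1 : cset D1.
  apply: (@csetU _ _ _ a).
  - by apply: (@csetU _ _ _ x); rewrite ?set11 1?symE ?Ax //; apply: cset1.
  - by rewrite setU11.
  - by rewrite pa; apply: (e_next longC); apply: attc.
  - by rewrite !inE negb_or nA //= cx.
have o1D1 : o1 \notin D1 by rewrite !inE !negb_or (nS _ _ o1S pS) (nA _ _ o1A aA).
have c2 : cset D2 by apply: (@csetU _ _ _ (p o1)); rewrite ?setU11.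
have o2D2 : o2 \notin D2 by rewrite !inE !negb_or o12 (nS _ _ o2S pS) (nA _ _ o2A aA).
have c3 : cset D3 by apply: (@csetU _ _ _ o1); rewrite ?setU11.
have := leafE c3; rewrite ltnNge => /negP; apply.
(* Following a vertex of [S], [o1] has at most one neighbour in [S] and hence k-2 in [P];
   symmetrically, [o2] has k-2 in [S]. *)
pose P' := f o2 |: (nbh o1 :&: P); pose S' := nbh o2 :&: S.
have leD : #|y |: ((A :\ a) :|: (P' :|: S'))| <= #|ext D3|.
  have ninD3 u : u != o2 -> u != o1 -> u != p o1 -> u != a -> u != x -> u \notin D3.
    by move=> /negPf h1 /negPf h2 /negPf h3 /negPf h4 /negPf h5; rewrite !inE h1 h2 h3 h4 h5.
  have o2D3 : o2 \in D3 by rewrite setU11.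
  have o1D3 : o1 \in D3 by rewrite !inE eqxx orbT.
  have xD3 : x \in D3 by rewrite !inE eqxx !orbT.
  have sAP u : u \in P -> u \notin A /\ u \in c.
    by move=> uP; have [] := SPoff (_ : u \in S :|: P); rewrite // in_setU uP orbT.
  have sAS u : u \in S -> u \notin A /\ u \in c.
    by move=> uP; have [] := SPoff (_ : u \in S :|: P); rewrite // in_setU uP.
  have SPn u v : u \in S -> v \in P -> v != u.
    move=> uS vP; apply/eqP => E; have := in_set0 u; rewrite -SP0 in_setI uS -E vP.
    by [].
  have PD u : u \in P -> u \notin D3.
    move=> uP; have [uA uc] := sAP u uP; apply: ninD3; rewrite ?cx //.
    - by rewrite eq_sym nP.
    - by rewrite eq_sym nP.
    - exact: SPn.
    - exact: nA.
  apply: subset_leq_card; apply/subsetP => z.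
  rewrite !in_setU in_set1 in_setD1 -!orbA 
    => /orP[/eqP->|/orP[/andP[za zA]|/orP[/set1P->|/orP[/setIP[oz zP]|/setIP[oz zS]]]]].
  - by apply: (in_ext xD3 pair_adj); apply: ninD3; rewrite eq_sym // cy // attc.
  - apply: (in_ext xD3); first by rewrite symE Ax.
    by apply: ninD3; rewrite // 1?eq_sym ?nA // cx ?attc.
  - exact: in_ext o2D3 e2f (PD _ fP).
  - by apply: (in_ext o1D3 _ (PD _ zP)); rewrite -in_nbh.
  - have [zA zc] := sAS z zS; apply: (in_ext o2D3); first by rewrite -in_nbh.
    apply: ninD3; rewrite ?cx //; try by rewrite eq_sym nS.
      by apply: contraNneq n2p => <-; rewrite -in_nbh.
    exact: nA.
apply: leq_trans leD.
have dS : (#|nbh o1 :&: S| <= 1) by apply: out_S1.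
have dP : (#|nbh o2 :&: P| <= 1) by apply: out_P1.
have d1 := out_deg o1O; have d2 := out_deg o2O.
have cP' : #|P'| = (#|nbh o1 :&: P|).+1 by rewrite cardsU1 in_setI in_nbh (negPf n1f).
have PS0 : P' :&: S' = set0.
  apply/setP => z; rewrite in_set0; apply/negP => /setIP[zP' /setIP[_ zS]].
  have zP : z \in P by case/setU1P: zP' => [->|/setIP[]].
  by have := in_set0 z; rewrite -SP0 in_setI zS zP.
have cPS : #|P' :|: S'| = #|P'| + #|S'| by rewrite cardsU PS0 cards0 subn0.
have PSA : P' :|: S' \subset S :|: P.
  rewrite subUset subUset sub1set [f o2 \in _]in_setU fP orbT /=.
  by rewrite (subset_trans (subsetIr _ _) (subsetUr _ _)) (subset_trans (subsetIr _ _) (subsetUl _ _)).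
have A0 : (A :\ a) :&: (P' :|: S') = set0.
  apply/setP => z; rewrite in_set0; apply/negP => /setIP[/setD1P[_ zA] /(subsetP PSA)/SPoff[_]].
  by rewrite zA.
have cAPS : #|(A :\ a) :|: (P' :|: S')| = #|A :\ a| + #|P' :|: S'| by rewrite cardsU A0 cards0 subn0.
have yn : y \notin (A :\ a) :|: (P' :|: S').
  rewrite in_setU negb_or in_setD1 (negPf yA) andbF /=.
  by apply: contra ySP; apply: (subsetP PSA).
rewrite cardsU1 yn cAPS cPS cP'; have := cardsD1 a A; rewrite aA cardA.
by rewrite /S'; move: dS dP d1 d2 k4; slia.
Qed.

Let c_cases v : v \in c -> [\/ v \in A, v \in S | v \in P].
Proof. by move/csub; rewrite out0 in_set0 orbF => /or3P. Qed.

(** Otherwise [f a] is adjacent to all of [P]. All gaps now have two vertices, so [f (f b)] is in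
    [P] for another [b] of [A], and [far_next] excludes this chord. *)
Let no_full_next a : a \in A -> [exists b in A :\ a, e b (f a)].
Proof.
move=> aA; apply: contraT => /exists_inPn nob; exfalso.
have fSP : f a \in S :|: P by rewrite in_setU imset_f.
have sN : nbh (f a) \subset a |: (nbh (f a) :&: P).
  apply/subsetP => z az; rewrite in_setU1 in_setI az /=; rewrite in_nbh in az.
  case zc: (z \in c); last first.
    have zO : z \notin out D by rewrite out0 in_set0.
    move: zO; rewrite in_out negb_and !negbK extD => /orP[]/setU1P[zx|].
    - by have := att_next_off symE longC x0c aA xH; rewrite -zx az.
    - by move=> /attc; rewrite zc.
    - by have := att_next_off symE longC x0c aA yH; rewrite -zx az.
    - by move=> /SPoff[]; rewrite zc.
  case: (c_cases zc) => [zA|/imsetP[b bA zb]|->]; last by rewrite orbT.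
    apply/orP; left; apply/negPn/negP => za.
    by have := nob z; rewrite in_setD1 za zA symE az => /(_ isT).
  by have := att_indep symE irrE longC x0c aA bA; rewrite -zb az.
have EP : nbh (f a) :&: P = P.
  apply/eqP; rewrite eqEcard subsetIr cardP cardA.
  have := subset_leq_card sN; rewrite (card_nbh regE) cardsU1; case: (a \notin _); slia.
have /card_gt0P[b /setD1P[ba bA]] : 0 < #|A :\ a|.
  by have := cardsD1 a A; rewrite aA cardA; move: k4; slia.
have ffb : f (f b) \in P.
  case: (c_cases (_ : f (f b) \in c)); rewrite ?mem_next ?attc //.
    by move=> bA'; exfalso; apply: no_gap1 (attc bA) xH yH xy (Ax bA) (Ay bA').
  by rewrite inS (nextK longC); have := att_next symE longC x0c bA => /negPf->.
have : f (f b) \in nbh (f a) :&: P by rewrite EP.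
by rewrite in_setI in_nbh symE (negPf (far_next bA aA ba)).
Qed.

Let no_full_prev a : a \in A -> [exists b in A :\ a, e b (p a)].
Proof.
move=> aA; apply: contraT => /exists_inPn nob; exfalso.
have sN : nbh (p a) \subset a |: (nbh (p a) :&: S).
  apply/subsetP => z az; rewrite in_setU1 in_setI az /=; rewrite in_nbh in az.
  case zc: (z \in c); last first.
    have zO : z \notin out D by rewrite out0 in_set0.
    move: zO; rewrite in_out negb_and !negbK extD => /orP[]/setU1P[zx|].
    - by have := att_prev_off symE longC x0c aA xH; rewrite -zx az.
    - by move=> /attc; rewrite zc.
    - by have := att_prev_off symE longC x0c aA yH; rewrite -zx az.
    - by move=> /SPoff[]; rewrite zc.
  case: (c_cases zc) => [zA|->|/imsetP[b bA zb]]; [|by rewrite orbT|].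
    apply/orP; left; apply/negPn/negP => za.
    by have := nob z; rewrite in_setD1 za zA symE az => /(_ isT).
  by have := att_prev_indep symE irrE longC x0c aA bA; rewrite -zb az.
have ES : nbh (p a) :&: S = S.
  apply/eqP; rewrite eqEcard subsetIr cardS cardA.
  have := subset_leq_card sN; rewrite (card_nbh regE) cardsU1; case: (a \notin _); slia.
have /card_gt0P[b /setD1P[ba bA]] : 0 < #|A :\ a|.
  by have := cardsD1 a A; rewrite aA cardA; move: k4; slia.
have ppb : p (p b) \in S.
  case: (c_cases (_ : p (p b) \in c)); rewrite ?mem_prev ?attc //.
    move=> bA'; exfalso; apply: (no_gap1 (attc bA') xH yH xy (Ax bA')).
    by rewrite !(prevK longC) Ay.
  by rewrite inP (prevK longC); have := att_prev symE longC x0c bA => /negPf->.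
have : p (p b) \in nbh (p a) :&: S by rewrite ES.
by rewrite in_setI in_nbh symE (negPf (far_prev bA aA ba)).
Qed.

(** Removing [a] from {x} with [A] turns [a] into an outer neighbour and keeps [f a] and [p a],
    which have other neighbours in [A]. This makes 2k outer neighbours. *)
Lemma pair_absurd : False.
Proof.
have : 0 < #|A| by rewrite cardA; move: k3; slia.
case/card_gt0P => a aA.
have c' := cD (subD1set A a); have := leafE c'; rewrite ltnNge => /negP; apply.
have e2k : #|a |: (y |: (S :|: P))| = 2 * k.
  rewrite cardsU1 cardsU1 ySP cardSP in_setU1 negb_or.
  rewrite (_ : a != y); last by apply: contraTneq aA => ->.
  rewrite (_ : a \notin S :|: P); last by apply/negP => /SPoff[]; rewrite aA.
  by move: k3; slia.
rewrite -e2k; apply: subset_leq_card; apply/subsetP => z.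
have xD' : x \in x |: A :\ a by rewrite setU11.
case/setU1P => [->|/setU1P[->|zSP]].
- apply: (in_ext xD'); first by rewrite symE Ax.
  by rewrite in_setU1 in_setD1 eqxx orbF; apply: contraTneq aA => ->.
- apply: (in_ext xD' pair_adj); rewrite in_setU1 in_setD1 (negPf yA) andbF orbF.
  by rewrite eq_sym.
have [zc zA] := SPoff zSP.
have zD : z \notin x |: A :\ a.
  rewrite in_setU1 in_setD1 (negPf zA) andbF orbF.
  by apply: contraTneq zc => ->; apply: offH.
case/setUP: zSP => /imsetP[b bA zb].
  have [ba|ba] := eqVneq b a.
    have /exists_inP[d dA ed] := no_full_next aA.
    by apply: (@in_ext _ _ _ d) => //; [rewrite in_setU1 dA orbT|rewrite zb ba].
  apply: (in_ext _ (_ : e b z) zD); first by rewrite in_setU1 in_setD1 ba bA orbT.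
  by rewrite zb; apply: (e_next longC); apply: attc.
have [ba|ba] := eqVneq b a.
  have /exists_inP[d dA ed] := no_full_prev aA.
  by apply: (@in_ext _ _ _ d) => //; [rewrite in_setU1 dA orbT|rewrite zb ba].
apply: (in_ext _ (_ : e b z) zD); first by rewrite in_setU1 in_setD1 ba bA orbT.
by rewrite zb symE (e_prev longC) // attc.
Qed.

End Pair.
End Component.

(* Indices run along an arc between two attachment vertices: [b i] and [~~ nn i] *)
(* record the chords to the successors of its two ends, [al i] the attachment    *)
(* vertices. Conflicts between them allow an almost injective assignment.        *)
Lemma interleave m (b al nn : nat -> bool) : 0 < m -> al m.-1 -> nn 0 ->
  (forall i, i.+1 < m -> b i -> nn i.+1) ->
  (forall i, i.+2 < m -> b i -> nn i.+2) ->
  (forall i, i.+1 < m -> al i -> [/\ nn i.+1, ~~ al i.+1 & ~~ b i.+1]) ->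
  \sum_(0 <= i < m) (b i + al i) <= (\sum_(0 <= i < m) nn i).+1.
Proof.
move=> m0 alm nn0 b1 b2 al1.
suff key t : t < m -> \sum_(t <= i < m) (b i + al i) <= (\sum_(t.+1 <= i < m) nn i) + 2.
  have := key 0 m0; rewrite [in X in _ -> _ <= X.+1]big_ltn // nn0 /=.
  by clear; lia.
move: {2}(m - t) (leqnn (m - t)) => d; elim: d t => [|d IH] t dt tm; first by move: dt tm; slia.
have [tm1|tm1] := ltnP t.+1 m; last first.
  have -> : m = t.+1 by move: tm tm1; slia.
  by rewrite big_nat1 big_geq //; case: (b t); case: (al t).
rewrite big_ltn // [X in _ <= X + 2]big_ltn //.
have [/andP[bt at_]|nbt] := boolP (b t && al t); last first.
  have le : b t + al t <= nn t.+1.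
    have := b1 t tm1; have := al1 t tm1; case: (b t) nbt; case: (al t) => //= _ h1 h2.
      by rewrite h2.
    by have [-> _ _] := h1 isT.
  have := IH t.+1; move: le dt tm1; clear; lia.
have [n1 na nb] := al1 t tm1 at_.
have tm2 : t.+2 < m.
  rewrite ltn_neqAle tm1 andbT; apply/eqP => E.
  by move: na; rewrite (_ : t.+1 = m.-1) ?alm // -E.
rewrite big_ltn // [X in _ <= _ + X + 2]big_ltn // (negPf na) (negPf nb) bt at_ n1 b2 //=.
have := IH t.+2; move: dt tm2; clear; lia.
Qed.

(** * Counting along the cycle *)

Section CycleCounting.
Variables (T : finType) (e : rel T).
Hypotheses (symE : symmetric e) (irrE : irreflexive e).
Variable c : seq T.
Hypothesis longC : longest_cycle e c.
Local Notation f := (next c).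
Local Notation n := (size c).

Lemma iter_next_inj i x y : iter i f x = iter i f y -> x = y.
Proof. by elim: i => //= i IH /(next_inj longC). Qed.

(** The translates of [X] by 0, ..., t steps are disjoint. *)
Lemma shift_count t (X : {set T}) : {subset X <= c} ->
  (forall a r, a \in X -> r < t -> iter r.+1 f a \notin X) -> t.+1 * #|X| <= n.
Proof.
move=> sX shX; rewrite -(card_uniqP (uniqC longC)).
pose F (u : T * 'I_t.+1) := iter u.2 f u.1.
have injF : {in setX X [set: 'I_t.+1] &, injective F}.
  suff key a b (i j : 'I_t.+1) : a \in X -> b \in X -> i <= j -> iter i f a = iter j f b -> (a, i) = (b, j).
    move=> [a i] [b j] /setXP[aX _] /setXP[bX _] E; have [ij|ij] := leqP i j; first exact: key.
    by apply/esym/key => //; apply: ltnW.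
  move=> aX bX ij; rewrite -(subnKC ij) iterD => /iter_next_inj E.
  case d : (j - i) E => [|r] E.
    by congr (_, _) => //; apply: val_inj; move: ij d => /=; clear; lia.
  suff /(shX b r bX) : r < t by rewrite -E aX.
  by move: d (ltn_ord j); slia.
have := card_in_imset injF; rewrite cardsX cardsT card_ord mulnC => <-.
by apply: subset_leq_card; apply/subsetP => v /imsetP[[a i] /setXP[/sX aX _] ->]; rewrite (mem_iter).
Qed.

Lemma big_traject (g : T -> nat) x m :
  \sum_(v <- traject f x m) g v = \sum_(0 <= i < m) g (iter i f x).
Proof.
elim: m x => [|m IH] x; first by rewrite big_nil big_geq.
rewrite /= big_cons IH big_nat_recl //; congr (_ + _).
by apply: eq_bigr => i _; rewrite -iterSr.
Qed.

Lemma sum_cycle (g : T -> nat) x m : x \in c -> m <= n ->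
  \sum_(v <- c) g v = \sum_(v <- traject f x m) g v + \sum_(v <- traject f (iter m f x) (n - m)) g v.
Proof.
move=> xc mn; rewrite -big_cat /= -traject_split //.
by apply: perm_big; rewrite perm_sym (perm_traject longC).
Qed.

Lemma sum_cycle_card (B : {set T}) : \sum_(v <- c) (v \in B : nat) = #|B :&: [set v in c]|.
Proof.
rewrite -(big_mkcond (fun v => v \in B) (fun=> 1)) /= sum1_count -size_filter.
rewrite -(card_uniqP (filter_uniq _ (uniqC longC))).
by apply: eq_card => v; rewrite mem_filter in_setI in_set.
Qed.

End CycleCounting.

(** * A larger component: chord counts and gap lengths *)

Section LargeComponent.
Variables (T : finType) (e : rel T) (k : nat).
Hypotheses (symE : symmetric e) (irrE : irreflexive e) (connE : connected e).
Hypotheses (regE : regular e k) (k3 : 2 < k).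
Local Notation nbh := (nbh e).
Local Notation ext := (ext e).
Local Notation cset := (cset e).
Hypothesis leafE : forall D, cset D -> #|ext D| < 2 * k.
Variable c : seq T.
Hypothesis longC : longest_cycle e c.
Local Notation f := (next c).
Local Notation p := (prev c).
Local Notation n := (size c).
Variable x0 : T.
Hypothesis x0c : x0 \notin c.
Local Notation H := (offcomp e c x0).
Local Notation A := (att e c x0).
Hypothesis H2 : 1 < #|H|.
Local Notation nbc := (nbc e c).

Let offH y : y \in H -> y \notin c. Proof. exact: comp_off. Qed.
Let attc a : a \in A -> a \in c. Proof. by case/attP. Qed.

Lemma card_cycle_set : #|[set v in c]| = n.
Proof. by rewrite cardsE (card_uniqP (uniqC longC)). Qed.

Lemma nbc_split y : y \in H -> #|nbc y| + #|nbh y :&: H| = k.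
Proof.
move=> yH; rewrite -(card_nbh regE y) -(cardsID [set v in c] (nbh y)); congr (_ + _).
apply: eq_card => z; rewrite in_setI in_setD in_set andbC.
rewrite in_nbh; have [yz|_] := boolP (e y z); last by rewrite !(andbF, andFb).
by rewrite !(andbT, andTb) /=; apply/idP/idP => [/offH//|zc]; apply: (comp_closed x0c yH yz).
Qed.

Lemma nbh_comp_lt y : y \in H -> #|nbh y :&: H| < #|H|.
Proof.
move=> yH; apply: proper_card; apply/properP; split; first exact: subsetIr.
by exists y; rewrite // in_setI in_nbh irrE.
Qed.

Lemma full_adj w v : w \in H -> v \in H -> v != w -> #|H| <= #|nbh w :&: H|.+1 -> e w v.
Proof.
move=> wH vH vw le; have E : nbh w :&: H = H :\ w.
  apply/eqP; rewrite eqEcard; apply/andP; split; last by move: le; rewrite (cardsD1 w H) wH.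
  apply/subsetP => z /setIP[wz zH]; rewrite in_setD1 zH andbT.
  by apply: contraTneq wz => ->; rewrite in_nbh irrE.
have: v \in nbh w :&: H by rewrite E in_setD1 vw.
by rewrite in_setI in_nbh => /andP[].
Qed.

Lemma edges_count : \sum_(y in H) #|nbc y| = \sum_(a in A) #|nbh a :&: H|.
Proof.
rewrite -double_count //; apply: eq_bigr => y yH; apply: eq_card => a.
rewrite !in_setI in_set in_nbh; have [ya|] //= := boolP (e y a).
apply/idP/idP => [ac|/attc//]; by apply/attP; split=> //; exists y; rewrite // symE.
Qed.

Lemma edges_le : \sum_(y in H) #|nbc y| <= #|A| * (k - 2).
Proof.
rewrite edges_count -sum_nat_const; apply: leq_sum => a aA.
have := att_deg symE regE longC x0c aA; slia.
Qed.

Lemma ear3 y w z : y \in H -> w \in H -> z \in H -> y != w -> w != z -> y != z ->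
  e y w -> e w z -> ear e c y [:: y; w; z] z.
Proof.
move=> yH wH zH yw wz yz eyw ewz; split; first by rewrite /= !eqxx eyw ewz.
  by rewrite /= !inE negb_or yw yz wz.
by move=> u; rewrite !inE => /or3P[]/eqP->; apply: offH.
Qed.

Lemma ear4 y u w z : y \in H -> u \in H -> w \in H -> z \in H -> uniq [:: y; u; w; z] ->
  e y u -> e u w -> e w z -> ear e c y [:: y; u; w; z] z.
Proof.
move=> yH uH wH zH uq yu uw wz; split=> //; first by rewrite /= !eqxx yu uw wz.
by move=> v; rewrite !inE => /or4P[]/eqP->; apply: offH.
Qed.

(** A chord from a vertex of the arc to [f b] forbids chords from the next two vertices to [f a], by
    [cross_second] with an ear of two or more vertices; successors of attachment vertices see
    neither [f a] nor [f b]. These are the conflicts that [interleave] counts. *)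
Lemma arc_count y z a b m : y \in H -> z \in H -> y != z ->
  a \in c -> b \in c -> e a y -> e b z -> 0 < m -> m < n -> iter m f (f a) = f b ->
  \sum_(v <- traject f (f a) m) (e v (f a) + e v (f b) + (v \in A)) <= m.+1.
Proof.
move=> yH zH yz ac bc ay bz m0 mn Eb; rewrite big_traject.
have [h [eh _ h2]] := comp_ear2 symE x0c yH zH yz.
have aA : a \in A by apply/attP; split=> //; exists y.
have bA : b \in A by apply/attP; split=> //; exists z.
have fac : f a \in c by rewrite mem_next.
have Ea : iter n.-1 f (f a) = a.
  by rewrite -iterSr prednK ?(iter_size longC) //; apply: leq_trans mn.
have Eb' : iter m.-1 f (f a) = b by apply: (next_inj longC); rewrite -iterS prednK.
pose v i := iter i f (f a).
have cs i j : i < j -> j < m -> e (v i) (f b) -> e (v j) (f a) -> size h <= j - i.+1.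
  move=> ij jm; rewrite -Eb.
  by apply: (cross_second symE longC eh) => //; rewrite ?Ea ?Eb'.
have key := @interleave m (fun i => e (v i) (f b)) (fun i => v i \in A) (fun i => ~~ e (v i) (f a)).
have {key} : \sum_(0 <= i < m) (e (v i) (f b) + (v i \in A)) <= (\sum_(0 <= i < m) ~~ e (v i) (f a)).+1.
  apply: key => //.
  - by rewrite /v Eb'.
  - by rewrite /v /= irrE.
  - by move=> i im bi; apply/negP => ai; have := cs i i.+1 (ltnSn i) im bi ai; move: h2; slia.
  - move=> i im bi; apply/negP => ai; have := cs i i.+2 (ltnW (ltnSn i.+1)) im bi ai; move: h2; slia.
  - move=> i im vA; split; rewrite /v iterS.
    + by have := att_indep symE irrE longC x0c vA aA.
    + by have := att_next symE longC x0c vA.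
    + by have := att_indep symE irrE longC x0c vA bA.
have -> : m.+1 = (\sum_(0 <= i < m) 1).+1 by rewrite sum_nat_const_nat subn0 muln1.
have -> : \sum_(0 <= i < m) 1 = \sum_(0 <= i < m) ~~ e (v i) (f a) + \sum_(0 <= i < m) e (v i) (f a).
  by rewrite -big_split /=; apply: eq_bigr => i _; case: (e _ _).
have -> : \sum_(0 <= i < m) (e (iter i f (f a)) (f a) + e (iter i f (f a)) (f b) + (iter i f (f a) \in A))
   = \sum_(0 <= i < m) e (v i) (f a) + \sum_(0 <= i < m) (e (v i) (f b) + (v i \in A)).
  by rewrite -big_split /=; apply: eq_bigr => i _; rewrite addnA.
by clear; lia.
Qed.

(** Over both arcs, the edges from [f a] and [f b] to the cycle plus |A| number at most n+2. Off the
    cycle these two vertices have no common neighbour and none in [H], so their remaining edges are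
    paid for by the vertices outside [c] and [H]. *)
Lemma dirac_count : 2 * k + #|H| + #|A| <= #|T| + 2.
Proof.
have [y [z [a [b [[yH zH yz] [ay bz ab]]]]]] := two_edges symE irrE connE regE k3 leafE longC x0c H2.
have /(nbcP symE)[ac eay] := ay; have /(nbcP symE)[bc ebz] := bz.
have [m [m0 mn Eb Ea1 Eb1]] := arc_split longC ac bc ab.
have mn' : n - m < n by move: m0 mn; slia.
have m0' : 0 < n - m by move: m0 mn; slia.
have Ea : iter (n - m) f (f b) = f a.
  by rewrite Eb; apply: (iter_pred longC); rewrite ?mem_next.
have c1 := arc_count yH zH yz ac bc eay ebz m0 mn (esym Eb).
have c2 : \sum_(v <- traject f (f b) (n - m)) (e v (f b) + e v (f a) + (v \in A)) <= (n - m).+1.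
  by apply: (arc_count zH yH _ bc ac ebz eay); rewrite // eq_sym.
have aA : a \in A by apply/attP; split=> //; exists y.
have bA : b \in A by apply/attP; split=> //; exists z.
have tot : \sum_(v <- c) (e v (f a) + e v (f b) + (v \in A)) <= n + 2.
  have fac : f a \in c by rewrite mem_next.
  rewrite (sum_cycle longC _ fac (ltnW mn)) -Eb.
  have -> : \sum_(v <- traject f (f b) (n - m)) (e v (f a) + e v (f b) + (v \in A)) =
     \sum_(v <- traject f (f b) (n - m)) (e v (f b) + e v (f a) + (v \in A)).
    by apply: eq_bigr => v _; rewrite [e v (f a) + _]addnC.
  by apply: leq_trans (leq_add c1 c2) _; move: m0 mn; slia.
have sum_e s : \sum_(v <- c) (e v s : nat) = #|nbh s :&: [set v in c]|.
  rewrite -(sum_cycle_card longC); apply: eq_bigr => v _; by rewrite in_nbh symE.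
have sum_A : \sum_(v <- c) (v \in A : nat) = #|A|.
  rewrite (sum_cycle_card longC); congr #|pred_of_set _|; apply/setIidPl/subsetP => v /attc.
  by rewrite in_set.
move: tot; rewrite !big_split /= !sum_e sum_A => tot.
pose Z := ~: ([set v in c] :|: H).
have cT : #|T| = n + #|H| + #|Z|.
  rewrite -(cardsC ([set v in c] :|: H)) cardsU card_cycle_set (_ : _ :&: _ = set0) ?cards0 ?subn0 //.
  by apply/setP => v; rewrite in_setI in_set in_set0; apply/negP => /andP[vc /offH]; rewrite vc.
have offZ s : s \in A -> nbh (f s) :\: [set v in c] \subset Z.
  move=> sA; apply/subsetP => v; rewrite in_setD in_set in_nbh => /andP[vc sv].
  rewrite in_setC in_setU in_set negb_or vc /=; apply/negP => vH.
  by have := att_next_off symE longC x0c sA vH; rewrite sv.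
have dZ : (nbh (f a) :\: [set v in c]) :&: (nbh (f b) :\: [set v in c]) = set0.
  apply/setP => v; rewrite in_set0; apply/negP.
  rewrite in_setI !in_setD in_set !in_nbh => /andP[/andP[vc av] /andP[_ bv]].
  exact: (att_no_common symE longC x0c aA bA ab vc av bv).
have leZ : #|nbh (f a) :\: [set v in c]| + #|nbh (f b) :\: [set v in c]| <= #|Z|.
  have := cardsU (nbh (f a) :\: [set v in c]) (nbh (f b) :\: [set v in c]).
  rewrite dZ cards0 subn0 => <-; apply: subset_leq_card.
  by rewrite subUset !offZ.
have d1 := cardsID [set v in c] (nbh (f a)); have d2 := cardsID [set v in c] (nbh (f b)).
rewrite !(card_nbh regE) in d1 d2.
move: tot cT leZ d1 d2; slia.
Qed.

Definition gap_at_least (L : nat) : Prop :=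
  forall a b m, a \in A -> b \in A -> a != b -> 0 < m -> m < n -> b = iter m f a -> L < m.

Lemma gap_shift L : gap_at_least L -> 1 < #|A| -> L.+1 * #|A| <= n.
Proof.
move=> gap A2; apply: (shift_count longC) => [a /attc//|a r aA rL].
have [b bA ab] : exists2 b, b \in A & a != b.
  have /card_gt0P[b /setD1P[ba bA]] : 0 < #|A :\ a|.
    by move: A2; rewrite (cardsD1 a A) aA.
  by exists b; rewrite // eq_sym.
have [i ilt Eb] := mem_iterP longC (attc aA) (attc bA).
have i0 : 0 < i by case: i ilt Eb ab => // _ ->; rewrite eqxx.
have Li := gap a b i aA bA ab i0 ilt Eb.
have rn : r.+1 < n by move: rL Li ilt; slia.
apply/negP => rA; have [E|ne] := eqVneq a (iter r.+1 f a).
  by have := iter_inj longC (attc aA) (leq_trans i0 (ltnW ilt)) rn E.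
have := gap _ _ _ aA rA ne (ltn0Sn r) rn erefl; move: rL; slia.
Qed.

Lemma gap_ears L :
  (forall a b, a \in A -> b \in A -> a != b ->
     exists y z h, [/\ e a y, e b z, ear e c y h z & L <= size h]) -> gap_at_least L.
Proof.
move=> ears a b m aA bA ab m0 mn Eb; have [y [z [h [ay bz eh Lh]]]] := ears a b aA bA ab.
have := @gap_ear _ _ symE _ longC _ _ _ eh a m.-1 (attc aA); rewrite prednK // -Eb => /(_ mn ay bz).
by move: Lh m0; slia.
Qed.

Section Chords.
Hypothesis chord : forall a, a \in A -> e (f a) (p a).

(** The tour of [gap_chords] keeps both end vertices of the gap, so the gap must be two vertices
    longer than the ear. The distances 1, 2 and n-1, where this tour degenerates, are excluded
    first. *)
Lemma gap_ears_chords L :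
  (forall a b, a \in A -> b \in A -> a != b ->
     exists y z h, [/\ e a y, e b z, ear e c y h z & L <= size h]) -> gap_at_least L.+2.
Proof.
move=> ears a b m aA bA ab m0 mn Eb; have [y [z [h [ay bz eh Lh]]]] := ears a b aA bA ab.
have m1 : m <> 1.
  by move=> E; have := att_next symE longC x0c aA; rewrite -[f a]/(iter 1 f a) -E -Eb bA.
have m2 : m <> 2.
  move=> E; have := chord bA; rewrite [p b](_ : _ = f a); last by rewrite Eb E /= (nextK longC).
  by rewrite (negPf (att_indep symE irrE longC x0c bA aA)).
have mn1 : m <> n.-1.
  move=> E; have := att_prev symE longC x0c aA.
  by rewrite (prev_iter longC (attc aA)) -E -Eb bA.
have fc : f a \in c by rewrite mem_next attc.
have Ea1 : iter n.-1 f (f a) = a.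
  by rewrite -iterSr prednK ?(iter_size longC) ?attc //; apply: leq_trans mn.
have Eb1 : iter m.-1 f (f a) = b by rewrite -iterSr prednK.
have Ea2 : iter n.-2 f (f a) = p a.
  rewrite (prev_iter longC (attc aA)) -iterSr (_ : n.-2.+1 = n.-1) //; move: (sizeC longC); slia.
have Eb2 : iter m.-2 f (f a) = p b.
  rewrite Eb (_ : iter m f a = f (iter m.-2 f (f a))) ?(nextK longC) // -iterSr -iterS.
  by congr (iter _ f a); move: m0 m1; clear; lia.
have Efb : iter m f (f a) = f b by rewrite -iterSr iterS -Eb.
have m3 : 2 < m by move: m0 m1 m2; clear; lia.
have mn2 : m.+1 < n by move: mn mn1; clear; lia.
have := @gap_chords _ _ symE _ longC _ _ _ eh (f a) m fc m0 mn.
rewrite Ea1 Eb1 Ea2 Eb2 Efb => /(_ ay bz m3 mn2 (chord aA) (chord bA)).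
by move: Lh; slia.
Qed.
End Chords.

Hypothesis H3 : 2 < #|H|.

Lemma att_ge2 : 1 < #|A|.
Proof.
have [y [z [a [b [[yH zH yz] [ay bz ab]]]]]] := two_edges symE irrE connE regE k3 leafE longC x0c H2.
apply: (@leq_trans #|[set a; b]|); first by rewrite cards2 ab.
apply: subset_leq_card; rewrite subUset !sub1set.
by rewrite (subsetP (nbc_comp symE yH)) // (subsetP (nbc_comp symE zH)).
Qed.

Lemma nbc_ge y : y \in H -> k < #|nbc y| + #|H|.
Proof. move=> yH; have := nbc_split yH; have := nbh_comp_lt yH; slia. Qed.

Lemma nbc_le y : y \in H -> #|nbc y| <= #|A|.
Proof. by move=> yH; apply: subset_leq_card; apply: (nbc_comp symE yH). Qed.

Lemma att_nbh a : a \in A -> exists2 y, y \in H & e a y.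
Proof. by case/attP. Qed.

(** Otherwise every other vertex of [H] has a further non-neighbour in [H], hence at least k+2-|H|
    neighbours on the cycle, too many for [edges_le]. *)
Lemma full_vertex y z : y \in H -> z \in H -> y != z ->
  #|A| * (k - 2) < #|nbc y| + #|nbc z| + (#|H| - 2) * (k + 2 - #|H|) ->
  exists w, [/\ w \in H, w != y, w != z & forall v, v \in H -> v != w -> e w v].
Proof.
move=> yH zH yz big.
have [/exists_inP[w]|/exists_inPn nof] :=
    boolP [exists w in H :\ y :\ z, #|H| <= #|nbh w :&: H|.+1].
  rewrite !in_setD1 => /and3P[wz wy wH] full; exists w; split=> // v vH vw.
  exact: full_adj full.
exfalso; have := edges_le; rewrite leqNgt => /negP; apply; apply: leq_trans big _.
rewrite (bigD1 y) //= (bigD1 z) /=; last by rewrite zH eq_sym yz.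
rewrite -addnA leq_add2l leq_add2l.
have cH : #|H :\ y :\ z| = #|H| - 2.
  by have := cardsD1 y H; have := cardsD1 z (H :\ y); rewrite in_setD1 eq_sym yz zH yH; slia.
rewrite -cH -sum_nat_const.
rewrite [X in _ <= X](eq_bigl (fun w => w \in H :\ y :\ z)); last first.
  by move=> w; rewrite !in_setD1; case: (w == z); case: (w == y); case: (w \in H).
apply: leq_sum => w wX; have := nof w wX; rewrite -ltnNge.
have wH : w \in H by move: wX; rewrite !in_setD1 => /and3P[].
have := nbc_split wH; slia.
Qed.

(** With only two attachment vertices, one ear and its reversal serve both gaps. *)
Lemma pair_edges : #|A| = 2 -> exists y z,
  [/\ y \in H, z \in H, y != z, 0 < #|nbc y| & 0 < #|nbc z| ] /\
  forall L, (exists h, ear e c y h z /\ L <= size h) ->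
   forall a b, a \in A -> b \in A -> a != b ->
     exists y z h, [/\ e a y, e b z, ear e c y h z & L <= size h].
Proof.
move=> A2.
have [y [z [a [b [[yH zH yz] [ay bz ab]]]]]] := two_edges symE irrE connE regE k3 leafE longC x0c H2.
exists y, z; split.
  by split=> //; apply/card_gt0P; [exists a|exists b].
move=> L [h [eh Lh]] u v uA vA uv.
have /(nbcP symE)[_ eay] := ay; have /(nbcP symE)[_ ebz] := bz.
have EA : A = [set a; b].
  apply/esym/eqP; rewrite eqEcard cards2 ab A2 andbT subUset !sub1set.
  by rewrite (subsetP (nbc_comp symE yH)) // (subsetP (nbc_comp symE zH)).
move: uA vA uv; rewrite EA !inE => /orP[]/eqP-> /orP[]/eqP->; rewrite ?eqxx // => _.
  by exists y, z, h.
exists z, y, (rev h); split=> //; first exact: ear_rev eh.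
by rewrite size_rev.
Qed.

(** By [dirac_count], |H| + |A| <= 6. Each attachment vertex sends at most k-2 edges to [H], and
    each vertex of [H] at least k+1-|H| to [A]. For (|H|, |A|) this excludes (3,2), forces a
    triangle with equality throughout for (3,3), and gives k <= 4 for (4,2); ears with three or four
    vertices then make the cycle too long. *)
Lemma small_absurd : #|T| <= 2 * k + 4 -> False.
Proof.
move=> small; have A2 := att_ge2; have dc := dirac_count; have el := edges_le.
have cT : n + #|H| <= #|T|.
  rewrite -card_cycle_set -(cardsC [set v in c]) leq_add2l; apply: subset_leq_card.
  by apply/subsetP => v /offH; rewrite in_setC in_set.
have le1 : #|H| * (k.+1 - #|H|) <= \sum_(y in H) #|nbc y|.
  by rewrite -sum_nat_const; apply: leq_sum => y yH; have := nbc_ge yH; slia.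
have [[E1 E2]|[[E1 E2]|[E1 E2]]] : (#|H| = 3 /\ #|A| = 2) \/ ((#|H| = 3 /\ #|A| = 3) \/ (#|H| = 4 /\ #|A| = 2)).
  by move: dc small A2 H3; clear; lia.
- by move: el le1; rewrite E1 E2; move: k3; clear; lia.
- have full y : y \in H -> #|nbc y| = k - 2.
    move=> yH; apply/eqP; rewrite eqn_leq; apply/andP; split; last first.
      by have := nbc_ge yH; rewrite E1; slia.
    move: el; rewrite (bigD1 y) //= E2.
    have : (#|H| - 1) * (k - 2) <= \sum_(i in H | i != y) #|nbc i|.
      have <- : #|[set i in H | i != y]| = #|H| - 1.
        rewrite (cardsD1 y H) yH add1n subn1 /=; apply: eq_card => i.
        by rewrite in_set in_setD1 andbC.
      rewrite -sum_nat_const (eq_bigl (fun i => (i \in H) && (i != y))); last by move=> i; rewrite in_set.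
      by apply: leq_sum => i /andP[iH _]; have := nbc_ge iH; rewrite E1; slia.
    rewrite E1; move: k3; clear; lia.
  have fullA a : a \in A -> #|nbh a :&: H| = k - 2.
    have le a' : a' \in A -> #|nbh a' :&: H| <= k - 2.
      by move=> aA; have := att_deg symE regE longC x0c aA; slia.
    move=> aA; apply/eqP; rewrite eqn_leq le //=.
    have : \sum_(i in A | i != a) #|nbh i :&: H| <= (#|A| - 1) * (k - 2).
      have <- : #|[set i in A | i != a]| = #|A| - 1.
        rewrite (cardsD1 a A) aA add1n subn1 /=; apply: eq_card => i.
        by rewrite in_set in_setD1 andbC.
      rewrite -sum_nat_const [X in _ <= X](eq_bigl (fun i => (i \in A) && (i != a))); last by move=> i; rewrite in_set.
      by apply: leq_sum => i /andP[iA _]; apply: le.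
    move: le1; rewrite edges_count (bigD1 a) //= E1 E2; move: k3; clear; lia.
  have adjH u v : u \in H -> v \in H -> u != v -> e u v.
    move=> uH vH uv; apply: full_adj; rewrite // 1?eq_sym //.
    by have := nbc_split uH; rewrite full // E1; move: k3; slia.
  have gap : gap_at_least 3.
    apply: gap_ears => a b aA bA ab.
    have [y [z [yH zH yz [ay bz]]]] : exists y z, [/\ y \in H, z \in H, y != z & e a y /\ e b z].
      have [y yH ay] := att_nbh aA; have [z zH bz] := att_nbh bA.
      have [yz|] := eqVneq y z; last by exists y, z.
      have [k4|k4] := ltnP 3 k.
        have /card_gt0P[w /setD1P[wy /setIP[aw wH]]] : 0 < #|(nbh a :&: H) :\ y|.
          have := cardsD1 y (nbh a :&: H); rewrite fullA // in_setI in_nbh ay yH; move: k4; slia.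
        by exists w, z; rewrite in_nbh in aw; rewrite -yz wy; split=> //; rewrite yz.
      exfalso; have: #|[set a; b]| <= #|nbc y|.
        apply: subset_leq_card; rewrite subUset !sub1set.
        apply/andP; split; apply/(nbcP symE); split=> //; try exact: attc.
        by rewrite yz.
      by rewrite cards2 ab full //; move: k4; slia.
    have /card_gt0P[w /setD1P[wz /setD1P[wy wH]]] : 0 < #|H :\ y :\ z|.
      have := cardsD1 y H; have := cardsD1 z (H :\ y); rewrite in_setD1 eq_sym yz zH yH E1; slia.
    exists y, z, [:: y; w; z]; split=> //; apply: ear3; rewrite // 1?eq_sym //.
      by apply: adjH; rewrite // eq_sym.
    exact: adjH.
  have n12 := gap_shift gap A2; rewrite E2 in n12.
  have [a aA] : exists a, a \in A by apply/card_gt0P; rewrite E2.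
  have : k - 2 <= 3 by rewrite -(fullA a aA) -E1; apply: subset_leq_card; apply: subsetIr.
  by move: n12 cT small; rewrite E1; clear; lia.
have [y [z [[yH zH yz y0 z0] mk]]] := pair_edges E2.
have k4 : k <= 4 by move: el le1; rewrite E1 E2; move: k3; clear; lia.
have [E|E] : k = 3 \/ k = 4 by move: k3 k4; clear; lia.
  have [w [wH wy wz wf]] : exists w, [/\ w \in H, w != y, w != z & forall v, v \in H -> v != w -> e w v].
    by apply: full_vertex => //; rewrite E1 E2 E /=; move: y0 z0; slia.
  have gap : gap_at_least 3.
    apply: gap_ears => a b aA bA ab; apply: mk => //; exists [:: y; w; z]; split=> //.
    apply: ear3; rewrite // 1?eq_sym //; first by rewrite symE wf // eq_sym.
    by apply: wf; rewrite // eq_sym.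
  have := gap_shift gap A2; rewrite E2; move: cT small; rewrite E1 E; clear; lia.
have one v : v \in H -> #|nbc v| = 1.
  move=> vH; apply/eqP; rewrite eqn_leq; apply/andP; split; last first.
    by have := nbc_ge vH; rewrite E1 E; slia.
  move: el; rewrite (bigD1 v) //= E2 E.
  have : #|H| - 1 <= \sum_(i in H | i != v) #|nbc i|.
    have <- : #|[set i in H | i != v]| = #|H| - 1.
      rewrite (cardsD1 v H) vH add1n subn1 /=; apply: eq_card => i.
      by rewrite in_set in_setD1 andbC.
    rewrite -sum1_card (eq_bigl (fun i => (i \in H) && (i != v))); last by move=> i; rewrite in_set.
    by apply: leq_sum => i /andP[iH _]; have := nbc_ge iH; rewrite E1 E; slia.
  rewrite E1; clear; lia.
have adjH u v : u \in H -> v \in H -> u != v -> e u v.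
  move=> uH vH uv; apply: full_adj; rewrite // 1?eq_sym //.
  by have := nbc_split uH; rewrite one // E1 E; slia.
have cH : #|H :\ y :\ z| = 2.
  have := cardsD1 y H; have := cardsD1 z (H :\ y); rewrite in_setD1 eq_sym yz zH yH E1; slia.
have [u uX] : exists u, u \in H :\ y :\ z by apply/card_gt0P; rewrite cH.
have /card_gt0P[w /setD1P[wu wX]] : 0 < #|(H :\ y :\ z) :\ u|.
  by have := cardsD1 u (H :\ y :\ z); rewrite cH uX; slia.
have gap : gap_at_least 4.
  apply: gap_ears => a b aA bA ab; apply: mk => //; exists [:: y; u; w; z]; split=> //.
  move: uX wX; rewrite !in_setD1 => /and3P[uz uy uH] /and3P[wz wy wH].
  apply: ear4; rewrite //= ?inE ?negb_or.
  - by rewrite [y == u]eq_sym uy [y == w]eq_sym wy yz [u == w]eq_sym wu uz wz.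
  - by apply: adjH; rewrite // eq_sym.
  - by apply: adjH; rewrite // eq_sym.
  - exact: adjH.
have := gap_shift gap A2; rewrite E2; move: cT small; rewrite E1 E; clear; lia.
Qed.

(** The chords give n >= 4|A|, and n >= 5|A| if all gaps admit ears with two vertices. Against the
    bounds on |T| only |A| = 2 and |H| = k with k = 4 or 5 survive; a vertex adjacent to all of [H]
    then yields ears with three vertices and n >= 12. *)
Lemma chords_absurd : (forall a, a \in A -> e (f a) (p a)) ->
  #|T| <= 2 * k + 7 -> (3 < k -> #|T| <= 2 * k + 6) -> (4 < k -> #|T| <= 2 * k + 5) -> False.
Proof.
move=> chord b7 b6 b5; have A2 := att_ge2; have dc := dirac_count; have el := edges_le.
have cT : n + #|H| <= #|T|.
  rewrite -card_cycle_set -(cardsC [set v in c]) leq_add2l; apply: subset_leq_card.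
  by apply/subsetP => v /offH; rewrite in_setC in_set.
have le1 : #|H| * (k.+1 - #|H|) <= \sum_(y in H) #|nbc y|.
  by rewrite -sum_nat_const; apply: leq_sum => y yH; have := nbc_ge yH; slia.
have x0H : x0 \in H by apply: comp_refl.
have kH : k < #|A| + #|H| by have := nbc_ge x0H; have := nbc_le x0H; slia.
have gap3 : gap_at_least 3.
  apply: (gap_ears_chords chord) => a b aA bA ab.
  have [y yH ay] := att_nbh aA; have [z zH bz] := att_nbh bA.
  have [h [eh _]] := comp_ear symE x0c yH zH; exists y, z, h; split=> //; exact: ear_size eh.
have n4 := gap_shift gap3 A2.
have [A3|A3] := ltnP 2 #|A|.
  have [/forall_inP all|/forall_inPn[y yH ny]] := boolP [forall y in H, nbc y == A].
    have gap4 : gap_at_least 4.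
      apply: (gap_ears_chords chord) => a b aA bA ab.
      have /card_gt0P[y /setD1P[yx yH]] : 0 < #|H :\ x0|.
        by have := cardsD1 x0 H; rewrite x0H; move: H2; slia.
      have [h [eh _ h2]] := comp_ear2 symE x0c yH x0H yx.
      exists y, x0, h; split=> //.
        by have := aA; rewrite -(eqP (all y yH)) => /(nbcP symE)[].
      by have := bA; rewrite -(eqP (all _ x0H)) => /(nbcP symE)[].
    have := gap_shift gap4 A2; move: cT dc kH A3 H3 b7 b6 b5 k3; clear; lia.
  have lt : #|nbc y| < #|A|.
    apply: proper_card; rewrite properEneq ny; exact: (nbc_comp symE yH).
  have := nbc_ge yH; move: lt n4 cT dc kH A3 H3 b7 b6 b5 k3; clear; lia.
have E2 : #|A| = 2 by move: A2 A3; slia.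
have [y [z [[yH zH yz y0 z0] mk]]] := pair_edges E2.
have gap4 : gap_at_least 4.
  apply: (gap_ears_chords chord) => a b aA bA ab; apply: mk => //.
  by have [h [eh _ h2]] := comp_ear2 symE x0c yH zH yz; exists h.
have n5 := gap_shift gap4 A2; rewrite E2 in n5 dc kH el.
have qk : k <= #|H|.
  rewrite leqNgt; apply/negP => qk; have E : #|H| = k.-1 by move: qk kH; slia.
  by move: el le1; rewrite E; move: k3; clear; nia.
have [E Hk] : (k = 4 \/ k = 5) /\ #|H| = k.
  have : k <> 3 \/ #|H| <> 3.
    have [E3|] := eqVneq #|H| 3; last by right; apply/eqP.
    left=> E; move: el le1; rewrite E3 E; clear; lia.
  by move: n5 cT dc qk k3 b7 b6 b5; clear; lia.
have [w [wH wy wz wf]] : exists w, [/\ w \in H, w != y, w != z & forall v, v \in H -> v != w -> e w v].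
  by apply: full_vertex => //; rewrite E2 Hk; move: y0 z0; case: E => ->; slia.
have gap5 : gap_at_least 5.
  apply: (gap_ears_chords chord) => a b aA bA ab; apply: mk => //; exists [:: y; w; z]; split=> //.
  apply: ear3; rewrite // 1?eq_sym //; first by rewrite symE wf // eq_sym.
  by apply: wf; rewrite // eq_sym.
have := gap_shift gap5 A2; rewrite E2; move: cT b6 b5; rewrite Hk; case: E => ->; clear; lia.
Qed.

End LargeComponent.

(** * A vertex off the cycle with all its neighbours on it *)

Section Isolated.
Variables (T : finType) (e : rel T) (k : nat).
Hypotheses (symE : symmetric e) (irrE : irreflexive e) (connE : connected e).
Hypotheses (regE : regular e k) (k3 : 2 < k).
Local Notation nbh := (nbh e).
Local Notation ext := (ext e).
Local Notation cset := (cset e).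
Hypothesis leafE : forall D, cset D -> #|ext D| < 2 * k.

(** In the flat case alternation is impossible: two steps after a neighbour of another vertex [z] of
    the component would come a neighbour of [y], a gap too short for an ear from [z] to [y]. So
    every attachment vertex has the chord of [flat_gaps]. *)
Lemma component_absurd c x0 : longest_cycle e c -> x0 \notin c -> 1 < #|offcomp e c x0| -> False.
Proof.
move=> longC x0c H2; have [H3|H3] := ltnP 2 #|offcomp e c x0|; last first.
  have /cards2P[x [y [xy EH]]] : #|offcomp e c x0| == 2 by rewrite eqn_leq H3.
  exact: (pair_absurd symE irrE connE regE k3 leafE longC x0c H2 EH xy).
have [small|big] := leqP #|T| (2 * k + 4).
  exact: (small_absurd symE irrE connE regE k3 leafE longC x0c H2 H3 small).
have flat y : y \in offcomp e c x0 -> nbc e c y != set0 ->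
    (#|T| <= 2 * k + 7 /\ (3 < k -> #|T| <= 2 * k + 6) /\ (4 < k -> #|T| <= 2 * k + 5)) /\
    (forall a, a \in nbc e c y -> e (next c a) (prev c a)).
  move=> yH y0; have yc := comp_off x0c yH.
  have [le|[bd fl]] := flat_or_small symE irrE connE regE k3 leafE longC yc y0.
    by move: big; rewrite ltnNge le.
  split=> //; have [alt|ch] := flat_gaps symE irrE longC yc fl; last by move=> a /ch[].
  have [z [zH zy /set0Pn[b bz]]] :=
    other_vertex symE irrE connE regE k3 leafE longC x0c H2 yH.
  have bA := subsetP (nbc_comp symE zH) _ bz; have /(nbcP symE)[bc ebz] := bz.
  have fbA := att_next symE longC x0c bA.
  have fb : next c b \notin nbc e c y by apply: contra fbA; apply/subsetP/nbc_comp.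
  have fbc : next c b \in c by rewrite mem_next.
  case: (alt _ fbc) => [|/(nbcP symE)[_ ey]]; first by rewrite (negPf fb).
  by case: (no_gap1 symE k3 longC x0c H2 bc zH yH zy ebz ey).
have [z [zH _ z0]] := other_vertex symE irrE connE regE k3 leafE longC x0c H2 (comp_refl e c x0).
have [[b7 [b6 b5]] _] := flat z zH z0.
apply: (chords_absurd symE irrE connE regE k3 leafE longC x0c H2 H3) b7 b6 b5.
move=> a /attP[ac [y yH ay]]; have aN : a \in nbc e c y by apply/(nbcP symE).
by apply: (flat y yH _).2 => //; apply/set0Pn; exists a.
Qed.

Variable c : seq T.
Hypothesis longC : longest_cycle e c.
Local Notation f := (next c).
Local Notation p := (prev c).
Local Notation n := (size c).
Variable x : T.
Hypothesis xc : x \notin c.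
Hypothesis isolX : {subset nbh x <= c}.
Local Notation A := (nbc e c x).
Local Notation S := (f @: A).
Local Notation P := (p @: A).
Let R := ~: (x |: (A :|: S)).

Let A_nbh : A = nbh x.
Proof. by apply/setIidPl/subsetP => z /isolX; rewrite in_set. Qed.

Let in_A a : (a \in A) = e x a.
Proof. by rewrite A_nbh in_nbh. Qed.

Let A_cycle a : a \in A -> a \in c.
Proof. by rewrite A_nbh; apply: isolX. Qed.

Let A_att a : a \in A -> a \in att e c x.
Proof. by apply/subsetP/nbc_att. Qed.

Let card_A : #|A| = k.
Proof. by rewrite A_nbh (card_nbh regE). Qed.

Let in_P v : (v \in P) = (f v \in A).
Proof.
apply/imsetP/idP => [[a aA ->]|vA]; first by rewrite (prevK longC).
by exists (f v); rewrite // (nextK longC).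
Qed.

Let in_S v : (v \in S) = (p v \in A).
Proof. exact: in_nextS. Qed.

Let S_cycle v : v \in S -> v \in c.
Proof. by rewrite in_S => /A_cycle; rewrite mem_prev. Qed.

Let P_cycle v : v \in P -> v \in c.
Proof. by rewrite in_P => /A_cycle; rewrite mem_next. Qed.

Let S_notA v : v \in S -> v \notin A.
Proof.
rewrite in_S => vA; have := att_next symE longC xc (A_att vA); rewrite (prevK longC).
by apply: contra; apply: A_att.
Qed.

Let P_notA v : v \in P -> v \notin A.
Proof.
rewrite in_P => vA; have := att_prev symE longC xc (A_att vA); rewrite (nextK longC).
by apply: contra; apply: A_att.
Qed.

Let S_indep u v : u \in S -> v \in S -> ~~ e u v.
Proof.
rewrite !in_S => uA vA; have := att_indep symE irrE longC xc (A_att uA) (A_att vA).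
by rewrite !(prevK longC).
Qed.

Let P_indep u v : u \in P -> v \in P -> ~~ e u v.
Proof.
rewrite !in_P => uA vA; have := att_prev_indep symE irrE longC xc (A_att uA) (A_att vA).
by rewrite !(nextK longC).
Qed.

Let A_next v : v \in A -> f v \in S.
Proof. by move=> vA; rewrite in_S (nextK longC). Qed.

Let A_prev v : v \in A -> p v \in P.
Proof. by move=> vA; rewrite in_P (prevK longC). Qed.

Let in_R v : (v \in R) = [&& v != x, v \notin A & v \notin S].
Proof. by rewrite in_setC in_setU1 !negb_or in_setU negb_or. Qed.

Let card_R : #|T| = 2 * k + 1 + #|R|.
Proof.
rewrite -(cardsC (x |: (A :|: S))) cardsU1 in_setU.
rewrite (negPf (contra (@A_cycle x) xc)) (negPf (contra (@S_cycle x) xc)) /=.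
rewrite cardsU (_ : A :&: S = set0) ?cards0 ?(card_nextS longC) ?card_A; last first.
  by apply/setP => v; rewrite in_set0; apply/negP => /setIP[vA /S_notA]; rewrite vA.
by rewrite /R; slia.
Qed.

(** Vertices of [S] have neighbours only in [R] and [A], whereas each vertex of [A] also sees [x].
    Comparing the equal degree sums cancels the edges between [A] and [S] and leaves the k edges at
    [x]. *)
Lemma edge_count : k + \sum_(a in A) #|nbh a :&: R| <= \sum_(r in R) #|nbh r :&: S|.
Proof.
have cS : #|S| = k by rewrite (card_nextS longC) card_A.
have sA : \sum_(a in A) (#|nbh a :&: R| + #|nbh a :&: S| + 1) <= \sum_(a in A) k.
  apply: leq_sum => a aA; rewrite -(card_nbh regE a) -(cardsID R (nbh a)) -addnA leq_add2l.
  apply: (@leq_trans #|x |: (nbh a :&: S)|).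
    rewrite cardsU1 addnC in_setI (negPf (contra (@S_cycle x) xc)) andbF //.
  apply: subset_leq_card; rewrite subUset sub1set in_setD in_R eqxx /= in_nbh symE -in_A aA.
  apply/subsetP => v /setIP[va vS]; by rewrite in_setD in_R vS !andbF.
have sS : \sum_(s in S) k <= \sum_(s in S) (#|nbh s :&: R| + #|nbh s :&: A|).
  apply: leq_sum => s sS; rewrite -(card_nbh regE s) -(cardsID R (nbh s)) leq_add2l.
  apply: subset_leq_card; apply/subsetP => v; rewrite in_setD in_R => /andP[vR sv].
  rewrite in_setI sv /=; move: vR; apply: contraR => vA; rewrite vA /=; apply/andP; split.
    apply: contraNneq (S_notA sS) => vx; rewrite in_A symE -vx -in_nbh //.
  by apply/negP => vS; move: sv; rewrite in_nbh (negPf (S_indep sS vS)).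
move: sA sS; rewrite !big_split /= !sum_nat_const cS card_A.
have := @double_count _ e symE A S; have := @double_count _ e symE S R.
slia.
Qed.

(** Both cycle neighbours of [s] are neighbours of [x], which can therefore take its place. *)
Lemma swap_cycle s : s \in S -> f s \in A ->
  longest_cycle e (x :: traject f (f s) n.-1) /\ s \notin x :: traject f (f s) n.-1.
Proof.
move=> sS fsA; have sc := S_cycle sS; have n3 := sizeC longC.
have E : s :: traject f (f s) n.-1 = traject f s n by rewrite -[in RHS](prednK (ltnW (ltnW n3))).
have us : uniq (s :: traject f (f s) n.-1) by rewrite E (uniq_traject longC).
have memE v : (v \in s :: traject f (f s) n.-1) = (v \in c).
  by rewrite E (perm_mem (perm_traject longC sc)).
have sx : s != x by apply: contraNneq xc => <-.
have xs : x \notin traject f (f s) n.-1.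
  by apply: contra xc => xt; rewrite -memE inE xt orbT.
split; last by rewrite inE negb_or sx /=; case/andP: us.
have [_ _ mx] := longC.
have sz : size (x :: traject f (f s) n.-1) = n by rewrite /= size_traject prednK //; slia.
split; rewrite ?sz //; apply/andP; split; last by rewrite /= xs; case/andP: us.
have sg := seg_traject longC (A_cycle fsA) (m := n.-1).
apply: (seg_cycle (u := x) (v := p s)); last by rewrite symE -in_A -in_S.
apply: (seg_cons (v := f s)); first by rewrite -in_A.
rewrite (_ : p s = iter n.-2 f (f s)); first by apply: sg; slia.
by rewrite (prev_iter longC sc) -iterSr; apply: iter_eq; slia.
Qed.

(** Each [s] in [S] can be exchanged with [x]. An edge from [s] to [R] would then lie in a component
    off the new cycle, so there is none, against [edge_count]. *)
Lemma alternation_absurd : (forall v, v \in c -> v \in A \/ v \in S) -> False.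
Proof.
move=> alt; have := edge_count; rewrite leqNgt => /negP; apply.
suff none r : r \in R -> #|nbh r :&: S| = 0.
  by rewrite [X in X < _]big1 //; move: k3; slia.
move=> rR; apply: eq_card0 => s; rewrite in_setI in_nbh; apply/negP => /andP[rs sS].
have rc : r \notin c.
  by move: rR; rewrite in_R => /and3P[_ rA rS]; apply/negP => /alt[]; apply/negP.
have fsA : f s \in A.
  have fsc : f s \in c by rewrite mem_next S_cycle.
  case: (alt _ fsc) => //; rewrite in_S (nextK longC).
  by move=> sA; have := S_notA sS; rewrite sA.
have [lc sc'] := swap_cycle sS fsA.
apply: (component_absurd lc sc'); apply: (@leq_trans #|[set s; r]|).
  by rewrite cards2 (_ : s != r) //; apply: contraNneq rc => <-; apply: S_cycle.
have rc' : r \notin x :: traject f (f s) n.-1.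
  move: rR; rewrite in_R inE negb_or => /and3P[-> _ _] /=.
  apply: contra rc => /trajectP[i _ ->]; by rewrite mem_iter mem_next S_cycle.
apply: subset_leq_card; rewrite subUset !sub1set comp_refl /=.
by apply: (comp_closed sc' (comp_refl _ _ _) _ rc'); rewrite symE.
Qed.

(** Then [S] and [P] are disjoint and give {x} with [A] 2k outer neighbours. *)
Lemma disjoint_absurd : (forall a, a \in A -> p a \notin S) -> False.
Proof.
move=> dis; have cD : cset (x |: A).
  apply: (@cset_addnbrs _ e [set x] A (cset1 _ x)); apply/subsetP => a aA.
  apply: (@in_ext _ _ _ x); rewrite ?set11 -?in_A // in_set1.
  by apply: contraNneq xc => <-; apply: A_cycle.
have := leafE cD; rewrite ltnNge => /negP; apply.
have -> : 2 * k = #|S :|: P|.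
  rewrite cardsU (_ : S :&: P = set0) ?cards0 ?subn0; last first.
    apply/setP => v; rewrite in_set0; apply/negP => /setIP[vS]; rewrite in_P => /dis.
    by rewrite (nextK longC) vS.
  rewrite (card_nextS longC) card_imset ?card_A; last exact: can_inj (prevK longC).
  by slia.
apply: subset_leq_card; rewrite subUset; apply/andP; split; apply/subsetP => v vS.
  apply: (@in_ext _ _ _ (p v)).
  - by rewrite in_setU1 -in_S vS orbT.
  - by have := e_next longC (_ : p v \in c); rewrite (prevK longC) mem_prev S_cycle // => /(_ isT).
  - rewrite in_setU1 negb_or S_notA // andbT; apply: contraNneq xc => <-; exact: S_cycle.
apply: (@in_ext _ _ _ (f v)).
- by rewrite in_setU1 -in_P vS orbT.
- by rewrite symE; apply: (e_next longC); apply: P_cycle.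
- rewrite in_setU1 negb_or P_notA // andbT; apply: contraNneq xc => <-; exact: P_cycle.
Qed.

Lemma small_order : #|R| <= 3.
Proof.
have A0 : A != set0 by rewrite -card_gt0 card_A; move: k3; slia.
have [le|[_ fl]] := flat_or_small symE irrE connE regE k3 leafE longC xc A0.
  by move: le; rewrite card_R; slia.
exfalso; have [alt|ch] := flat_gaps symE irrE longC xc fl.
  apply: alternation_absurd => v vc; rewrite in_S.
  have pvc : p v \in c by rewrite mem_prev.
  by case: (alt _ pvc); rewrite ?(prevK longC); [right|left].
by apply: disjoint_absurd => a /ch[].
Qed.

(** [B] consists of the last vertices of gaps with at least two vertices, [W] of the inner vertices
    of gaps, and [Z] of the part of [R] off the cycle; together they partition [R]. *)
Let B := P :\: S.
Let W := R :&: [set v in c] :\: P.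
Let Z := R :\: [set v in c].

Let in_B v : (v \in B) = (v \notin S) && (f v \in A).
Proof. by rewrite in_setD in_P. Qed.

Let in_W v : (v \in W) = [&& f v \notin A, v \in R & v \in c].
Proof. by rewrite in_setD in_P in_setI in_set. Qed.

Let in_Z v : (v \in Z) = (v \notin c) && (v \in R).
Proof. by rewrite in_setD in_set. Qed.

Let notin_x v : v \in c -> v != x.
Proof. by move=> vc; apply: contraNneq xc => <-. Qed.

Let R_cycle v : v \in c -> (v \in R) = (v \notin A) && (v \notin S).
Proof. by move=> vc; rewrite in_R notin_x. Qed.

Let B_R v : v \in B -> v \in R.
Proof.
move=> vB; have /setDP[vP vS] := vB.
by rewrite R_cycle ?P_cycle // P_notA.
Qed.

Let B_cycle v : v \in B -> v \in c.
Proof. by move=> /setDP[/P_cycle]. Qed.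

Let B_W v : v \in B -> v \notin W.
Proof. by rewrite in_B in_W => /andP[_ ->]. Qed.

Let R_split : (forall g : T -> nat, \sum_(v in R) g v = \sum_(v in B) g v + \sum_(v in W) g v + \sum_(v in Z) g v).
Proof.
move=> g; rewrite (big_setID [set v in c]) /= -/Z; congr (_ + _).
rewrite (big_setID P) /= -/W; congr (_ + _); apply: eq_bigl => v.
rewrite !in_setI in_set in_B in_P.
apply/idP/idP => [/andP[/andP[]]|/andP[vS vA]].
  by rewrite in_R => /and3P[_ _ ->] _ ->.
have vB : v \in B by rewrite in_B vS.
by rewrite B_R // B_cycle // vA.
Qed.

Let card_R_split : #|R| = #|B| + #|W| + #|Z|.
Proof. by rewrite -!sum1_card R_split. Qed.

Let W_next w : w \in W -> (f w \in B) || (f w \in W).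
Proof.
rewrite in_W => /and3P[fw wR wc]; rewrite in_B in_W.
have fS : f w \notin S.
  by rewrite in_S (nextK longC); move: wR; rewrite in_R => /and3P[].
by rewrite fS R_cycle ?mem_next // fw fS wc /=; case: (_ \in A).
Qed.

Let BW_prev w : (w \in B) || (w \in W) -> (p w \in S) || (p w \in W).
Proof.
move=> wBW; have wc : w \in c by case/orP: wBW => [/B_cycle|]; rewrite // in_W => /and3P[].
have : w \in R by case/orP: wBW => [/B_R|]; rewrite // in_W => /and3P[].
rewrite R_cycle // in_S => /andP[wA pA].
rewrite in_W (prevK longC) wA mem_prev wc R_cycle ?mem_prev // pA /= andbT.
by case: (p w \in S).
Qed.

Let B_gt0 : 0 < #|B|.
Proof.
rewrite lt0n; apply/negP => /eqP/cards0_eq B0; apply: alternation_absurd => v vc.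
have cP : #|P| = #|S| by rewrite (card_nextS longC) card_imset //; apply: can_inj (prevK longC).
have EP : P = S.
  by apply/eqP; rewrite eqEcard cP leqnn andbT -setD_eq0; apply/eqP.
have [a aA] : exists a, a \in A by apply/card_gt0P; rewrite card_A; move: k3; slia.
have : v \in A :|: S; last by case/setUP; [left|right].
apply: (orbit_closed longC (X := A :|: S) (a := a)) => //; first by rewrite in_setU aA.
  exact: A_cycle.
move=> u; rewrite !in_setU => /orP[/A_next->|]; rewrite ?orbT // -EP in_P => -> //.
Qed.

Let B_ltk : #|B| < k.
Proof.
rewrite ltnNge; apply/negP => kB; apply: disjoint_absurd => a aA.
have cP : #|P| = k by rewrite card_imset ?card_A //; apply: can_inj (prevK longC).
have EB : B = P by apply/eqP; rewrite eqEcard subsetDl cP.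
by have := A_prev aA; rewrite -EB => /setDP[].
Qed.

Let card_SP : #|S :\: P| = #|B|.
Proof.
have cS : #|S| = k by rewrite (card_nextS longC) card_A.
have cP : #|P| = k by rewrite card_imset ?card_A //; apply: can_inj (prevK longC).
have := cardsID P S; have := cardsID S P; rewrite setIC -/B; move: cS cP; slia.
Qed.

Let B_nbh r : r \in B -> nbh r :&: S \subset S :\: P.
Proof.
case/setDP=> rP _; apply/subsetP => s /setIP[rs sS]; rewrite in_setD sS andbT.
by apply: contraL rs => sP; rewrite in_nbh P_indep.
Qed.

Let Z_nbh z : z \in Z -> #|nbh z :&: S| <= 1.
Proof.
rewrite in_Z => /andP[zc _]; rewrite leqNgt; apply/negP => /card_gt1P[u [v [+ + uv]]].
rewrite !in_setI !in_nbh !in_S => /andP[zu uA] /andP[zv vA].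
apply: (att_no_common symE longC xc (A_att uA) (A_att vA) _ zc); rewrite ?(prevK longC) 1?symE //.
by apply: contraNneq uv => E; rewrite -[u](prevK longC) E (prevK longC).
Qed.

Let W_nbh w : w \in W -> #|nbh w :&: S| < k.
Proof.
move=> wW; have := wW; rewrite in_W => /and3P[_ wR wc].
rewrite -(card_nbh regE w); apply: proper_card; apply/properP; split; first exact: subsetIl.
exists (f w); first by rewrite in_nbh (e_next longC).
by rewrite in_setI in_S (nextK longC); move: wR; rewrite in_R => /and3P[_ /negPf-> _]; rewrite andbF.
Qed.

Let count_RA : \sum_(a in A) #|nbh a :&: R| = \sum_(r in R) #|nbh r :&: A|.
Proof. exact: double_count. Qed.

Let B_nbhA r : r \in B -> 0 < #|nbh r :&: A|.
Proof.
move=> rB; apply/card_gt0P; exists (f r); rewrite in_setI in_nbh (e_next longC) ?B_cycle //=.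
by move: rB; rewrite in_B => /andP[].
Qed.

Let edges_B : #|B| + \sum_(z in Z) #|nbh z :&: A| <= \sum_(a in A) #|nbh a :&: R|.
Proof.
rewrite count_RA R_split leq_add2r -[#|B|]addn0 leq_add //.
by rewrite -sum1_card; apply: leq_sum => r; apply: B_nbhA.
Qed.

(** [cross_second] for consecutive chord ends and the ear [x]: nothing would be lost. *)
Lemma cross_att s y i : s \in S -> y \in S -> (forall t, t <= i.+1 -> y != iter t f s) ->
  e (iter i f s) y -> e (iter i.+1 f s) s -> False.
Proof.
move=> sS yS far iy is_; have sc := S_cycle sS; have yc := S_cycle yS.
have [m mn Ey] := mem_iterP longC sc yc.
have im : i.+1 < m.
  by rewrite ltnNge; apply/negP => mi; have := far m mi; rewrite -Ey eqxx.
have m0 : 0 < m by apply: leq_trans im.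
have := @cross_second _ _ symE _ longC _ _ _ (ear1 e xc) s m sc m0 mn.
rewrite -(prev_iter longC sc) -Ey.
have -> : iter m.-1 f s = p y by rewrite Ey -{2}(prednK m0) iterS (nextK longC).
have px u : u \in S -> e (p u) x by rewrite in_S in_A symE.
by move=> /(_ (px s sS) (px y yS) i i.+1 (ltnSn i) im iy is_); rewrite subnn.
Qed.

(** [cross_gap2] for the two-vertex gap at [s1] and the gap from [s2] to [iter d f s2]; the side
    conditions place the second gap after the first. *)
Lemma cross_pair s1 s2 d : s1 \in S -> s2 \in S -> f (f s1) \in A -> f (iter d f s2) \in A ->
  (forall i, i <= d -> iter i f s2 != s1) -> (forall i, i <= d -> iter i f s2 \notin A) ->
  e s1 (iter d f s2) -> e s2 (f s1) -> False.
Proof.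
move=> s1S s2S ffA fdA far nA ch1 ch2; have s1c := S_cycle s1S; have s2c := S_cycle s2S.
have [m mn E2] := mem_iterP longC s1c s2c.
have m3 : 2 < m.
  case: m mn E2 => [|[|[|m]]] // _ E2.
  - by have := far 0 (leq0n _); rewrite E2 eqxx.
  - by have := S_notA s2S; have := P_indep; move: ch2; rewrite E2 /= irrE.
  - by have := S_notA s2S; rewrite E2 ffA.
have qn : (m + d).+1 < n.
  have md i : i <= d -> m + i < n.
    elim: i => [|i IH] id; first by rewrite addn0.
    have lt := IH (ltnW id); rewrite addnS ltn_neqAle lt andbT; apply/eqP => E.
    have := far i.+1 id; rewrite E2 -iterD addnC addnS E (iter_size longC) // eqxx //.
  rewrite ltn_neqAle (md d) // andbT; apply/eqP => E.
  have := S_notA s1S; rewrite -[s1](iter_size longC s1c) -E iterS addnC iterD -E2 fdA //.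
apply: (@cross_gap2 _ _ symE _ longC x s1 m (m + d) xc s1c m3 (leq_addr _ _) qn).
- by rewrite symE -in_A.
- suff -> : iter m.-1 f s1 = p s2 by rewrite symE -in_A -in_S.
  by rewrite E2 -{2}(prednK (ltnW (ltnW m3))) iterS (nextK longC).
- by rewrite addnC iterD -E2 symE -in_A.
- by rewrite addnC iterD -E2.
- by rewrite -E2.
Qed.

(** Gaps have one or two vertices, and for two distinct gaps with two vertices at most one of the
    two crossing chords exists. With b = |B|, at most b(b+1)/2 edges go from [B] to [S], and at most
    one from each vertex of [Z]. Since b + |Z| <= 3 and b < k, this is below the required k + b. *)
Lemma no_inner : W = set0 -> False.
Proof.
move=> W0; have := edge_count; have := edges_B; rewrite R_split W0 big_set0 addn0.
have b1 := B_gt0; have bk := B_ltk; have r3 := small_order.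
rewrite card_R_split W0 cards0 addn0 in r3.
have z1 : \sum_(z in Z) #|nbh z :&: S| <= #|Z|.
  by rewrite -sum1_card; apply: leq_sum => z; apply: Z_nbh.
have pS r : r \in B -> p r \in S.
  by move=> rB; have := @BW_prev r; rewrite rB W0 !in_set0 !orbF => /(_ isT).
have SPE : S :\: P = p @: B.
  apply/esym/eqP; rewrite eqEcard card_SP card_imset ?leqnn ?andbT; last exact: can_inj (prevK longC).
  apply/subsetP => s /imsetP[r rB ->]; rewrite in_setD pS // andbT in_P (prevK longC).
  by apply: P_notA; case/setDP: rB.
pose g (r r' : T) : nat := e r (p r').
have nbE r : r \in B -> #|nbh r :&: S| <= \sum_(r' in B) g r r'.
  move=> rB; have -> : nbh r :&: S = nbh r :&: (p @: B).
    apply/eqP; rewrite eqEsubset subsetI subsetIl -SPE B_nbh //=; apply: setIS; exact: subsetDl.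
  rewrite -sum1_card (eq_bigl (fun s => (s \in p @: B) && e r s)); last first.
    by move=> s; rewrite in_setI in_nbh andbC.
  rewrite big_mkcondr big_imset /=; last by move=> a b _ _; apply: (can_inj (prevK longC)).
  by apply: leq_sum => s _; rewrite /g; case: (e _ _).
have gg r r' : r \in B -> r' \in B -> g r r' + g r' r <= (r == r').+1.
  move=> rB r'B; have [<-|rr] /= := eqVneq; first by rewrite /g; case: (e _ _).
  rewrite /g; case E1: (e r (p r')); case E2: (e r' (p r)) => //; exfalso.
  have fA v : v \in B -> f v \in A by rewrite in_B => /andP[].
  have nBA v : v \in B -> v \notin A by case/setDP=> /P_notA.
  apply: (@cross_pair (p r) (p r') 1); rewrite ?pS //= ?(prevK longC) ?fA //.
  - case=> [|[|]] //= _.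
      by apply: contra rr => /eqP E; rewrite -[r](prevK longC) -E (prevK longC).
    rewrite (prevK longC); apply: contraNneq (nBA _ rB) => E; rewrite -[r](prevK longC) -E; exact: fA.
  - case=> [|[|]] //= _; first exact/S_notA/pS.
    by rewrite (prevK longC) nBA.
  - by rewrite symE.
  - by rewrite symE.
have b2 : 2 * \sum_(r in B) #|nbh r :&: S| <= #|B| * #|B|.+1.
  apply: (@leq_trans (\sum_(r in B) \sum_(r' in B) (g r r' + g r' r))).
    under [X in _ <= X]eq_bigr do rewrite big_split.
    rewrite big_split /= [X in _ + X]exchange_big /= mul2n -addnn.
    by apply: leq_add; apply: leq_sum => r rB; apply: nbE.
  apply: (@leq_trans (\sum_(r in B) \sum_(r' in B) (r == r').+1)).
    by apply: leq_sum => r rB; apply: leq_sum => r' r'B; apply: gg.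
  rewrite -sum_nat_const; apply: leq_sum => r rB.
  under eq_bigr do rewrite -addn1.
  rewrite big_split /= sum1_card addnC -[#|B|.+1]addn1 leq_add2l.
  rewrite (bigD1 r) //= eqxx big1 // => r' /andP[_]; rewrite eq_sym => /negPf->//.
move: b2 z1 r3 b1 bk k3; clear; move: (\sum_(r in B) _) (\sum_(r in Z) _) (\sum_(r in Z) _) (\sum_(a in A) _) (#|B|) (#|Z|).
move=> sB sZ sZA sA b z b2 z1 r3 b1 bk k3 eA eS.
have [E|[E|E]] : b = 1 \/ b = 2 \/ b = 3 by lia.
all: by subst b; lia.
Qed.

(** The edge count requires a vertex [z] off the cycle with one neighbour in [S] and none in [A],
    and k-1 neighbours of [w] in [S]. The last neighbour of [w] is [r], so [z] can see only [r] and
    one vertex of [S]. *)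
Lemma one_inner_one : #|B| = 1 -> #|W| = 1 -> False.
Proof.
move=> b1 w1; have := edge_count; have := edges_B; rewrite R_split.
have := small_order; rewrite card_R_split b1 w1 => z1.
have /cards1P[r EB] : #|B| == 1 by rewrite b1.
have /cards1P[w EW] : #|W| == 1 by rewrite w1.
have rB : r \in B by rewrite EB set11.
have wW : w \in W by rewrite EW set11.
have wc : w \in c by move: wW; rewrite in_W => /and3P[].
have Efw : f w = r.
  have := W_next wW; rewrite EB EW !in_set1 => /orP[/eqP//|/eqP E].
  by have := next_neq irrE longC wc; rewrite E eqxx.
have nr := subset_leq_card (B_nbh rB); rewrite card_SP b1 in nr.
have nw := W_nbh wW.
rewrite EB EW !big_set1.
have [Z0|/set0Pn[z zZ]] := eqVneq Z set0.
  by rewrite Z0 !big_set0; move: nr nw; slia.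
have EZ : Z = [set z].
  by apply/esym/eqP; rewrite eqEcard sub1set zZ cards1; move: z1; slia.
have nz := Z_nbh zZ; rewrite EZ !big_set1 => eA eS.
have zA0 : #|nbh z :&: A| = 0.
  have := count_RA; rewrite R_split EB EW EZ !big_set1.
  by have := B_nbhA rB; move: eA eS nz nr nw; slia.
have nwk : #|nbh w :&: S| = k.-1 by move: eA eS nz nr nw; slia.
have rS : r \notin S by case/setDP: rB.
have zw : ~~ e z w.
  apply/negP => zw.
  have : #|z |: (r |: (nbh w :&: S))| <= #|nbh w|.
    apply: subset_leq_card; rewrite !subUset !sub1set !in_nbh [e w z]symE zw subsetIl.
    by rewrite -Efw (e_next longC).
  have zc : z \notin c by move: zZ; rewrite in_Z => /andP[].
  rewrite !cardsU1 !in_setU1 !in_setI (negPf rS) (negPf (contra (@S_cycle z) zc)) !andbF orbF.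
  rewrite (_ : z != r) ?nwk ?(card_nbh regE) //; first by move: k3; slia.
  by apply: contraNneq zc => ->; apply: B_cycle.
have : #|nbh z| <= #|r |: (nbh z :&: S)|.
  apply: subset_leq_card; apply/subsetP => v zv; rewrite in_setU1 in_setI zv /=.
  rewrite in_nbh in zv.
  have [|vS] := boolP (v \in S); first by rewrite orbT.
  have vx : v != x.
    apply: contraTneq zv => ->; rewrite symE -in_nbh; apply: contraL zZ => /isolX.
    by rewrite in_Z => ->.
  have vA : v \notin A.
    by apply/negP => vA; have := cards0_eq zA0; move/setP/(_ v); rewrite in_set0 in_setI in_nbh zv vA.
  have vR : v \in R by rewrite in_R vx vA.
  have [//|rv] := eqVneq v r.
  have := R_split (fun u => u == v); rewrite (bigD1 v) //= eqxx EB EW EZ !big_set1 [r == v]eq_sym (negPf rv).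
  have [E|_] := eqVneq w v; first by move: zv; rewrite -E (negPf zw).
  by have [E|//] := eqVneq z v; move: zv; rewrite -E irrE.
by rewrite (card_nbh regE) cardsU1; case: (_ \notin _); move: nz k3; slia.
Qed.

(** The long gap is s, w, f w, r, and all other gaps have one vertex [y], which [x] can replace. So
    no such [y] sees both [w] and [f w] ([swap_insert]), and an edge from [w] or [f w] to such a [y]
    excludes the chord to [s] from the next vertex ([cross_att]). At most k edges reach [S], but k+1
    are required. *)
Lemma one_inner_two : #|B| = 1 -> #|W| = 2 -> False.
Proof.
move=> b1 w2.
have /cards1P[r EB] : #|B| == 1 by rewrite b1.
have rB : r \in B by rewrite EB set11.
have Wc w : w \in W -> w \in c by rewrite in_W => /and3P[].
have [w [wW fwW]] : exists w, w \in W /\ f w \in W.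
  have /cards2P[w [w' [ww EW]]] : #|W| == 2 by rewrite w2.
  have wW : w \in W by rewrite EW !inE eqxx.
  have w'W : w' \in W by rewrite EW !inE eqxx orbT.
  have /orP[|] := W_next wW; last by exists w.
  have /orP[|] := W_next w'W; last by exists w'.
  rewrite EB !in_set1 => /eqP E1 /eqP E2; move: ww.
  by rewrite (next_inj longC (etrans E2 (esym E1))) eqxx.
have EW : W = [set w; f w].
  apply/esym/eqP; rewrite eqEcard subUset !sub1set wW fwW w2 cards2 eq_sym.
  by rewrite (next_neq irrE longC (Wc w wW)).
have Er : f (f w) = r.
  have := W_next fwW; rewrite EB EW !inE => /or3P[/eqP//||] /eqP E.
    by have := next2_neq longC (Wc w wW); rewrite E eqxx.
  by have := next_neq irrE longC (Wc _ fwW); rewrite E eqxx.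
have sS : p w \in S.
  have := @BW_prev w; rewrite wW orbT => /(_ isT) /orP[//|].
  rewrite EW !inE => /orP[] /eqP E.
    by have := next_neq irrE longC (Wc w wW); rewrite -{1}E (prevK longC) eqxx.
  by have := next2_neq longC (Wc w wW); rewrite -E (prevK longC) eqxx.
set s := p w in sS.
have Es : f s = w by rewrite (prevK longC).
have EZ : Z = set0.
  by apply/eqP; rewrite -cards_eq0; have := small_order; rewrite card_R_split b1 w2; slia.
have sB : s \in S :\: P.
  rewrite in_setD sS andbT in_P Es; move: (wW); rewrite in_W R_cycle ?Wc // => /and3P[_ /andP[]//].
have ESP : S :\: P = [set s].
  by apply/esym/eqP; rewrite eqEcard sub1set sB card_SP b1 cards1.
have yP y : y \in S -> y != s -> f y \in A.
  move=> yS ys; have := in_set1 y s; rewrite (negPf ys) -ESP in_setD yS andbT in_P.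
  by move/negbFE.
have RnS v : v \in R -> v \notin S by rewrite in_R => /and3P[].
have RnA v : v \in R -> v \notin A by rewrite in_R => /and3P[].
have WR v : v \in W -> v \in R by rewrite in_W => /and3P[].
have far y t : y \in S -> y != s -> t <= 3 -> y != iter t f s.
  move=> yS ys; case: t => [|[|[|[|t]]]] //= _; rewrite !Es.
  - by apply: contraTneq yS => ->; apply/RnS/WR.
  - by apply: contraTneq yS => ->; apply/RnS/WR.
  - by rewrite Er; apply: contraTneq yS => ->; apply/RnS/B_R.
have only y : y \in S -> y != s -> e w y -> e (f w) y -> False.
  move=> yS ys wy fwy; have := yS; rewrite in_S => pyA.
  apply: (@swap_insert _ _ symE _ longC x (p y) w xc (A_cycle pyA) (Wc w wW));
    rewrite ?(prevK longC) 1?[e _ w]symE 1?[e _ (f w)]symE //.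
  - by rewrite symE -in_A.
  - by rewrite symE -in_A; apply: yP.
  - by apply: contraTneq pyA => <-; apply/RnA/WR.
  - by apply: contraTneq yS => <-; apply/RnS/WR.
have c1 y : y \in S -> y != s -> e w y -> e (f w) s -> False.
  move=> yS ys wy ws; apply: (cross_att (i := 1) sS yS); rewrite /= ?Es //.
  by move=> t t2; apply: far => //; apply: leq_trans t2 _.
have c2 y : y \in S -> y != s -> e (f w) y -> e r s -> False.
  move=> yS ys wy ws; apply: (cross_att (i := 2) sS yS); rewrite /= ?Es ?Er //.
  by move=> t t2; apply: far.
pose Y u := (nbh u :&: S) :\ s.
have cY u : #|nbh u :&: S| = e u s + #|Y u| by rewrite (cardsD1 s) in_setI in_nbh sS andbT.
have rY : #|Y r| = 0.
  apply/eqP; rewrite cards_eq0; apply/eqP/setP => v; rewrite in_set0 in_setD1.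
  have := subsetP (B_nbh rB) v; rewrite ESP in_set1 => h.
  by apply/negP => /andP[vs /h]; rewrite (negPf vs).
have cYY : #|Y w| + #|Y (f w)| < k.
  have := cardsU (Y w) (Y (f w)); rewrite (_ : _ :&: _ = set0) ?cards0 ?subn0 => [<-|].
    have cS : #|S| = k by rewrite (card_nextS longC) card_A.
    rewrite -cS (cardsD1 s S) sS ltnS; apply: subset_leq_card.
    by rewrite subUset !setSD // subsetIr.
  apply/setP => v; rewrite in_set0 in_setI !in_setD1 !in_setI !in_nbh; apply/negP.
  by case/andP => /and3P[vs wv vS] /and3P[_ fv _]; apply: (only v).
have k1 : #|Y w| + 2 <= k.
  rewrite -(card_nbh regE w) (_ : _ + 2 = #|s |: (f w |: Y w)|).
    apply: subset_leq_card; rewrite !subUset !sub1set !in_nbh (e_next longC) ?Wc //.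
    have -> : e w s by rewrite symE -[X in e _ X]Es (e_next longC) ?S_cycle.
    by apply: subset_trans (subsetDl _ _) (subsetIl _ _).
  rewrite !cardsU1 in_setU1 !in_setD1 !in_setI (negPf (RnS _ (WR _ fwW))) eqxx !andbF orbF.
  rewrite (_ : s != f w); first by slia.
  by apply: contraTneq sS => ->; apply/RnS/WR.
have k2 : #|Y (f w)| + 2 + e (f w) s <= k.
  rewrite -(card_nbh regE (f w)).
  have -> : #|Y (f w)| + 2 + e (f w) s = #|r |: (w |: (nbh (f w) :&: S))|.
    rewrite !cardsU1 in_setU1 !in_setI (negPf (RnS _ (WR _ wW))) (negPf (RnS _ (B_R rB))) !andbF orbF.
    rewrite (_ : r != w) ?cY; first by slia.
    by apply: contraTneq rB => ->; apply: contraL wW; apply: B_W.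
  apply: subset_leq_card; rewrite !subUset !sub1set !in_nbh -Er (e_next longC) ?Wc // symE.
  by rewrite (e_next longC) ?Wc //= subsetIl.
have := edge_count; have := edges_B; rewrite R_split EZ !big_set0 b1 EB EW big_set1 big_setU1 ?big_set1; last first.
  by rewrite in_set1 eq_sym (next_neq irrE longC) ?Wc.
rewrite !cY rY /=.
have [Yw0|/set0Pn[y]] := eqVneq (Y w) set0; last first.
  rewrite in_setD1 in_setI in_nbh => /and3P[ys wy yS].
  have -> : e (f w) s = false by apply/negP => /(c1 y yS ys wy).
  have [Yfw0|/set0Pn[u]] := eqVneq (Y (f w)) set0.
    by rewrite Yfw0 cards0; case: (e r s); case: (e w s); move: k1 k3; slia.
  rewrite in_setD1 in_setI in_nbh => /and3P[us wu uS].
  have -> : e r s = false by apply/negP => /(c2 u uS us wu).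
  by case: (e w s); move: cYY k3; slia.
rewrite Yw0 cards0.
have [Yfw0|/set0Pn[u]] := eqVneq (Y (f w)) set0.
  by rewrite Yfw0 cards0; case: (e r s); case: (e w s); case: (e (f w) s); move: k3; slia.
rewrite in_setD1 in_setI in_nbh => /and3P[us wu uS].
have -> : e r s = false by apply/negP => /(c2 u uS us wu).
by move: k2; case: (e w s); case: (e (f w) s); move: k3; slia.
Qed.

(** The longer gaps are s, w, r and t, q. The edge count can hold only with equality, which forces
    the chord from [r] to [s] and a second neighbour of [w] in [S]; [cross_att] forbids this. *)
Lemma two_inner_one : #|B| = 2 -> #|W| = 1 -> False.
Proof.
move=> b2 w1.
have /cards1P[w EW] : #|W| == 1 by rewrite w1.
have wW : w \in W by rewrite EW set11.
have wc : w \in c by move: wW; rewrite in_W => /and3P[].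
have wR : w \in R by move: wW; rewrite in_W => /and3P[].
have wA : w \notin A by move: wR; rewrite in_R => /and3P[].
have wS : w \notin S by move: wR; rewrite in_R => /and3P[].
have rB : f w \in B.
  have := W_next wW; rewrite EW !in_set1 => /orP[//|/eqP E].
  by have := next_neq irrE longC wc; rewrite E eqxx.
set r := f w in rB.
have [q qr EB] : exists2 q, q != r & B = [set r; q].
  have /card_gt0P[q /setD1P[qr qB]] : 0 < #|B :\ r| by have := cardsD1 r B; rewrite rB b2; slia.
  exists q => //; apply/esym/eqP; rewrite eqEcard subUset !sub1set rB qB b2 cards2.
  by rewrite eq_sym qr.
have qB : q \in B by rewrite EB !inE eqxx orbT.
have fA v : v \in B -> f v \in A by rewrite in_B => /andP[].
have nBA v : v \in B -> v \notin A by case/setDP=> /P_notA.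
have nBS v : v \in B -> v \notin S by case/setDP.
have qS : p q \in S.
  have := @BW_prev q; rewrite qB => /(_ isT) /orP[//|]; rewrite EW in_set1 => /eqP E.
  by move: qr; rewrite /r -E (prevK longC) eqxx.
have sS : p w \in S.
  have := @BW_prev w; rewrite wW orbT => /(_ isT) /orP[//|]; rewrite EW in_set1 => /eqP E.
  by have := next_neq irrE longC wc; rewrite -{1}E (prevK longC) eqxx.
set s := p w in sS; have Es : f s = w by rewrite (prevK longC).
set t := p q in qS; have Et : f t = q by rewrite (prevK longC).
have st : s != t.
  apply/eqP => E; move: (congr1 f E); rewrite Es Et => Ewq.
  by have := B_W qB; rewrite -Ewq wW.
have ESP : S :\: P = [set s; t].
  apply/esym/eqP; rewrite eqEcard cards2 st card_SP b2 andbT subUset !sub1set !in_setD qS sS.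
  by rewrite !in_P Es Et wA nBA.
have nb v : v \in B -> #|nbh v :&: S| <= e v s + e v t.
  move=> vB; have sub := B_nbh vB; rewrite ESP in sub.
  rewrite (cardsD1 s) (cardsD1 t (_ :\ s)) in_setD1 !in_setI !in_nbh eq_sym st sS qS !andbT /=.
  rewrite (_ : _ :\ t = set0) ?cards0 ?addn0 //.
  apply/setP => u; rewrite in_set0 !in_setD1; apply/negP => /and3P[ut us /(subsetP sub)].
  by rewrite !inE (negPf ut) (negPf us).
have cross : e r t + e q s <= 1.
  case E1: (e r t); case E2: (e q s) => //; exfalso.
  apply: (@cross_pair t s 2) => //=; rewrite ?Et ?Es -/r ?fA //.
  - case=> [|[|[|]]] //= _; rewrite ?Es -/r //.
      by apply: contraNneq wS => ->.
    by apply: contraNneq (nBS r rB) => ->.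
  - case=> [|[|[|]]] //= _; rewrite ?Es -/r //; first exact: S_notA.
    exact: nBA.
  - by rewrite symE.
  - by rewrite symE.
have nw := W_nbh wW.
have EZ : Z = set0.
  by apply/eqP; rewrite -cards_eq0; have := small_order; rewrite card_R_split b2 w1; slia.
have := edge_count; have := edges_B.
rewrite R_split EZ !big_set0 b2 EB EW big_set1 big_setU1 ?big_set1 ?in_set1 1?eq_sym //= => eA eS.
have nr := nb r rB; have nq := nb q qB.
have := nw; case E: (e r s) nr => nr nw'; last first.
  by move: nr nq cross nw eA eS; case: (e q t); case: (e r t); case: (e q s); slia.
have /card_gt0P[y /setD1P[ys /setIP[wy yS]]] : 0 < #|(nbh w :&: S) :\ s|.
  have := cardsD1 s (nbh w :&: S); rewrite in_setI sS andbT.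
  move: nr nq cross nw eA eS k3.
  by case: (e q t); case: (e r t); case: (e q s); case: (_ \in _); slia.
rewrite in_nbh in wy.
apply: (@cross_att s y 1) => //=; rewrite ?Es //.
case=> [|[|[|]]] //= _; rewrite ?Es -/r.
  by apply: contraNneq wS => <-.
by apply: contraNneq (nBS r rB) => <-.
Qed.

Lemma isolated_absurd : False.
Proof.
have b1 := B_gt0; have r3 := small_order; rewrite card_R_split in r3.
have [/eqP W0|W0] := posnP #|W|; first by apply: no_inner; apply/eqP; rewrite -cards_eq0.
have : (#|B| = 1 /\ #|W| = 1) \/ (#|B| = 1 /\ #|W| = 2) \/ (#|B| = 2 /\ #|W| = 1).
  by move: b1 W0 r3; clear; lia.
case=> [[]|[[]|[]]]; [exact: one_inner_one|exact: one_inner_two|exact: two_inner_one].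
Qed.

End Isolated.

(** * Longest cycles exist, and the hamiltonicity criterion *)

Section Hamiltonicity.
Variables (T : finType) (e : rel T) (k : nat).
Hypotheses (symE : symmetric e) (irrE : irreflexive e) (connE : connected e).
Hypotheses (regE : regular e k) (nontriv : nontrivial T).

Lemma degree_gt0 (e' : rel T) x : connected e' -> 0 < degree e' x.
Proof.
move=> conn'; have [|| u [v [/set1P-> _ xv]]] := @connected_cut _ e' conn' [set x].
- by apply/set0Pn; exists x; rewrite set11.
- by apply: contraTneq nontriv => E; rewrite /nontrivial -cardsT -E cards1.
by apply/card_gt0P; exists v; rewrite in_set.
Qed.

Lemma one_regular_leaves : k = 1 -> #|T| <= leaf_number e.
Proof.
move=> k1; have [F sF] : exists F, spanning_tree e F.
  by apply: exists_spanning_tree => //; apply: ltnW.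
apply: leq_trans (leq_bigmax_cond _ sF); rewrite -cardsT; apply: subset_leq_card.
have /andP[subF /andP[connF _]] := sF.
apply/subsetP => x _; rewrite in_set eqn_leq degree_gt0 // andbT -k1 -(regE x).
by apply: subset_leq_card; apply/subsetP => y; rewrite !in_set => /(adj_edge symE irrE subF).
Qed.

(** A path extends beyond its first vertex unless all neighbours of that vertex are on the path;
    then one other than the second vertex closes a cycle. *)
Lemma path_or_cycle m : 1 < k ->
  (exists c, ucycle e c /\ 2 < size c) \/ (exists x s, [/\ path e x s, uniq (x :: s) & size s = m]).
Proof.
move=> k2; elim: m => [|m [?|[x [s [ps us Es]]]]]; [|by left|].
  have /card_gt0P[x _] : 0 < #|T| by apply: ltnW.
  by right; exists x, [::].
have [/existsP[y /andP[xy ys]]|/existsPn all] := boolP [exists y, e x y && (y \notin x :: s)].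
  right; exists y, (x :: s); split; rewrite /= ?Es //; first by rewrite symE xy ps.
  by rewrite ys.
have /card_gt0P[y /setD1P[yh xy]] : 0 < #|nbh e x :\ head x s|.
  by have := cardsD1 (head x s) (nbh e x); rewrite (card_nbh regE); case: (_ \in _); move: k2; slia.
rewrite in_nbh in xy; have := all y; rewrite xy negbK inE => /orP[/eqP yx|].
  by move: xy; rewrite yx irrE.
move=> ys; left; case/splitPr: ys ps us yh {Es all} => s1 s2 ps us yh.
case: s1 => [|z s1] in ps us yh *; first by rewrite /= eqxx in yh.
exists (x :: rcons (z :: s1) y); split; last by rewrite /= size_rcons.
move: ps us; rewrite -cat_rcons cat_path -cat_cons cat_uniq => /andP[ps _] /andP[us _].
by apply/andP; split=> //; rewrite /cycle rcons_path ps last_rcons symE.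
Qed.

Lemma exists_longest_cycle : 1 < k -> exists c, longest_cycle e c.
Proof.
move=> k2; pose Q m := (2 < m) && [exists c : m.-tuple T, ucycleb e c].
have inQ c : ucycle e c -> 2 < size c -> Q (size c).
  by move=> uc c2; rewrite /Q c2; apply/existsP; exists (in_tuple c).
have exQ : exists m, Q m.
  have [[c [uc c2]]|[x [s [_ us Es]]]] := path_or_cycle #|T| k2; first by exists (size c); apply: inQ.
  by have := max_card (mem (x :: s)); rewrite (card_uniqP us) /= Es ltnn.
have leQ m : Q m -> m <= #|T|.
  case/andP => _ /existsP[c /andP[_ uc]].
  by rewrite -{1}(size_tuple c) -(card_uniqP uc) max_card.
case: (ex_maxnP exQ leQ) => m /andP[m2 /existsP[c uc]] mx.
by exists c; split; rewrite ?size_tuple // => c' uc' c2; apply: mx; apply: inQ.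
Qed.

Lemma few_leaves_hamiltonian : leaf_number e <= 2 * k - 1 -> hamiltonian e.
Proof.
move=> few.
have [x0 _] : exists x0 : T, x0 \in T by apply/card_gt0P; apply: ltnW.
have k0 : 0 < k by rewrite -(regE x0); apply: degree_gt0.
have k2 : 1 < k.
  rewrite ltn_neqAle k0 andbT; apply/eqP => k1.
  (* For k = 1 all vertices are leaves of a spanning tree, so the bound would give at most one
     vertex. *)
  by have := one_regular_leaves (esym k1); move: few nontriv; rewrite /nontrivial -k1; slia.
have [c longC] := exists_longest_cycle k2.
have [uc c2 _] := longC.
have [/forallP all|/forallPn[z zc]] := boolP [forall x, x \in c]; first by exists c.
exfalso.
have [|| a [x [+ + ax]]] := @connected_cut _ e connE [set v in c].
- by apply/set0Pn; case: (c) c2 => // a s _; exists a; rewrite in_set inE eqxx.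
- by apply/eqP => /setP/(_ z); rewrite in_set in_setT (negPf zc).
rewrite !in_set => ac xc.
(* The vertex [a] is adjacent to [x] and to its two neighbours on the cycle. *)
have k3 : 2 < k.
  have <- : #|x |: [set next c a; prev c a]| = 3.
    rewrite cardsU1 cards2 !inE negb_or (_ : next c a != prev c a).
      by rewrite !(contraNneq _ xc) // => ->; rewrite ?mem_next ?mem_prev.
    apply/eqP => E; have := next2_neq longC ac; by rewrite E (prevK longC) eqxx.
  rewrite -(card_nbh regE a); apply: subset_leq_card; rewrite !subUset !sub1set !in_nbh ax.
  by rewrite (e_next longC) //= symE (e_prev longC).
have leafE D : cset e D -> #|ext e D| < 2 * k.
  by move=> /(cset_leaves irrE connE); move: few k3; slia.
have [big|small] := ltnP 1 #|offcomp e c x|.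
  exact: (component_absurd symE irrE connE regE k3 leafE longC xc big).
apply: (isolated_absurd symE irrE connE regE k3 leafE longC xc) => y; rewrite in_nbh => xy.
apply: contraLR small => yc; rewrite -ltnNge.
apply: (@leq_trans #|[set x; y]|).
  by rewrite cards2 (_ : x != y) //; apply: contraTneq xy => <-; rewrite irrE.
apply: subset_leq_card; rewrite subUset !sub1set comp_refl /=.
exact: (comp_closed xc (comp_refl e c x) xy yc).
Qed.

End Hamiltonicity.

(** * Sharpness *)

Section CutVertices.
Variables (T : finType) (e : rel T).
Hypotheses (symE : symmetric e) (irrE : irreflexive e).

(** [X] is a union of some but not all components of the graph minus [v]. *)
Definition cut_vertex (v : T) : Prop := exists X : {set T},
  [/\ X != set0, v \notin X, v |: X != setT & forall u, u \in X -> nbh e u \subset v |: X].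

Lemma cut_not_hamiltonian v : cut_vertex v -> ~ hamiltonian e.
Proof.
case=> X [/set0Pn[x xX] vX XT clX] [c [c2 /andP[cc uc] all]].
have [i s rc] := rot_to (all v).
have cs : cycle e (v :: s) by rewrite -rc rot_cycle.
have us : uniq (v :: s) by rewrite -rc rot_uniq.
have mems u : u != v -> u \in s.
  by move=> uv; have := all u; rewrite -(mem_rot i) rc inE (negPf uv).
have same u w : u != v -> w != v -> e u w -> (u \in X) = (w \in X).
  have half a b : b != v -> e a b -> a \in X -> b \in X.
    by move=> bv ab /clX/subsetP/(_ b); rewrite in_nbh in_setU1 (negPf bv) => /(_ ab).
  move=> uv wv uw; apply/idP/idP; first exact: half.
  by apply: half; rewrite // symE.
have {cs}[vs pth] : v \notin s /\ sorted e s.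
  move: us cs => /= /andP[vs _]; rewrite rcons_path => /andP[+ _].
  by move=> ps; split=> //; case: (s) ps => //= a t /andP[].
have const a t : path e a t -> v \notin a :: t -> forall u, u \in a :: t -> (u \in X) = (a \in X).
  elim: t a => [|b t IH] a /=; first by move=> _ _ u; rewrite inE => /eqP->.
  rewrite !inE !negb_or => /andP[ab bt] /and3P[va vb vt] u /predU1P[->//|].
  have -> : (a \in X) = (b \in X) by apply: same; rewrite // eq_sym.
  by move=> ub; apply: IH => //; rewrite inE ?negb_or ?vb.
have [y yv yX] : exists2 y, y != v & y \notin X.
  have /subsetPn[y _] : ~~ (setT \subset v |: X) by rewrite subTset.
  by rewrite in_setU1 negb_or => /andP[]; exists y.
have xv : x != v by apply: contraNneq vX => <-.
move: (mems x xv) (mems y yv); case: s {rc us mems} vs pth => [|b t] // vs pth xs ys.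
by have := const b t pth vs x xs; rewrite -(const b t pth vs y ys) xX (negPf yX).
Qed.

Variable F : rel T.
Hypotheses (symF : symmetric F) (subF : subrel F e) (connF : connected F).

(** Edges of [F] leaving either side can only end in [v], so [v] has a neighbour on both sides. *)
Lemma cut_not_leaf v : cut_vertex v -> degree F v != 1.
Proof.
case=> X [X0 vX XT clX].
have [|x [y [xX yX xy]]] := connected_cut connF X0.
  by apply: contraNneq vX => ->.
have yv : y = v.
  have := subsetP (clX x xX) y; rewrite in_nbh in_setU1 (negPf yX) orbF => /(_ (subF xy)).
  by move/eqP.
have [||z [w [zY wY zw]]] := @connected_cut _ F connF (~: (v |: X)).
- by rewrite -setCT (inj_eq (@setC_inj _)).
- by apply/eqP => /setP/(_ v); rewrite in_setC in_setU1 eqxx in_setT.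
have zX : z \notin X by move: zY; rewrite in_setC in_setU1 negb_or => /andP[].
have wv : w = v.
  move: wY; rewrite in_setC negbK in_setU1 => /predU1P[//|wX].
  have := subsetP (clX w wX) z; rewrite in_nbh symE => /(_ (subF zw)).
  by move=> zVX; move: zY; rewrite in_setC zVX.
rewrite neq_ltn; apply/orP; right; apply: (@leq_trans #|[set x; z]|).
  by rewrite cards2 (_ : x != z) //; apply: contraNneq zX => <-.
apply: subset_leq_card; rewrite subUset !sub1set !in_set symF -{1}yv xy symF -wv zw //.
Qed.

(** Two adjacent vertices of degree one would form a whole component of [F]. *)
Lemma nbh_non_leaf z : 2 < #|T| -> exists2 w, w \in z |: nbh e z & degree F w != 1.
Proof.
move=> T3; have nt : nontrivial T by apply: ltnW.
have [dz|] := eqVneq (degree F z) 1; last by exists z; rewrite // setU11.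
have /cards1P[w Ew] : #|[set y | F z y]| == 1 by apply/eqP.
have zw : F z w by have := set11 w; rewrite -Ew in_set.
exists w; first by rewrite in_setU1 in_nbh subF ?orbT.
apply/negP => /cards1P[u Eu].
have Ez : [set y | F w y] = [set z].
  by rewrite Eu; congr [set _]; apply/esym/eqP; rewrite -in_set1 -Eu in_set symF.
have [|| a [b [aP bP ab]]] := @connected_cut _ F connF [set z; w].
- by apply/set0Pn; exists z; rewrite !inE eqxx.
- by apply: contraTneq T3 => E; rewrite -cardsT -E cards2; case: eqP.
move: aP ab bP; rewrite !inE => /orP[]/eqP-> ab.
  have bw : b \in [set w] by rewrite -Ew in_set.
  by rewrite (set1P bw) eqxx orbT.
have bz : b \in [set z] by rewrite -Ez in_set.
by rewrite (set1P bz) eqxx.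
Qed.

End CutVertices.

Section Example.
Variables (T : finType) (e : rel T).
Hypotheses (symE : symmetric e) (irrE : irreflexive e).

Lemma leaf_number_le (C : {set T}) z1 z2 : 2 < #|T| ->
  (forall v, v \in C -> cut_vertex e v) ->
  [disjoint C & z1 |: nbh e z1] -> [disjoint C & z2 |: nbh e z2] ->
  [disjoint z1 |: nbh e z1 & z2 |: nbh e z2] -> leaf_number e <= #|T| - (#|C| + 2).
Proof.
move=> T3 cutC d1 d2 d12; apply/bigmax_leqP => F /andP[sF /andP[conn _]].
have subF : subrel (adj F) e by move=> x y; apply: adj_edge.
have symF : symmetric (adj F) by apply: adj_sym.
have [w1 w1N l1] := nbh_non_leaf symF subF conn z1 T3.
have [w2 w2N l2] := nbh_non_leaf symF subF conn z2 T3.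
have w1C : w1 \notin C by rewrite (disjointFl d1).
have w2C : w2 \notin C by rewrite (disjointFl d2).
have w12 : w1 != w2 by apply: contraTneq w2N => <-; rewrite (disjointFr d12).
rewrite /num_leaves -(cardsC [set x | degree (adj F) x == 1]) -[X in X <= _]addn0.
suff : #|C| + 2 <= #|~: [set x | degree (adj F) x == 1]| by slia.
apply: (@leq_trans #|w1 |: (w2 |: C)|).
  by rewrite !cardsU1 in_setU1 negb_or w12 w1C w2C; slia.
apply: subset_leq_card; rewrite !subUset !sub1set !in_setC !in_set l1 l2 /=.
apply/subsetP => v vC; rewrite in_setC in_set; apply: (cut_not_leaf symE symF subF conn).
exact: cutC.
Qed.

Lemma dominating_connected (D : {set T}) : cset e D -> out e D = set0 -> connected e.
Proof.
move=> cD O0; have : cset e (D :|: ext e D) by apply: cset_addnbrs.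
rewrite -[_ :|: _]setCK -/(out e D) O0 setC0 => /cset_tree[F [sF _ cF _]].
apply/forallP => x; apply/forallP => y; apply: connect_sub (cF x y (in_setT x) (in_setT y)).
by move=> u v uv; apply/connect1/(adj_edge symE irrE sF).
Qed.

End Example.

(** For even [d], the complete graph minus the matching {0,1}, {2,3}, ... on the indices below
    [d]. *)
Definition side_adj (d i j : nat) : bool := (i != j) && ~~ [&& i < d, j < d & i./2 == j./2].

Lemma side_adj_sym d : symmetric (side_adj d).
Proof.
by move=> i j; rewrite /side_adj eq_sym andbCA [i./2 == _]eq_sym.
Qed.

Lemma side_adj_card d m (i : 'I_m.+1) : ~~ odd d -> d <= m ->
  \sum_(j < m.+1) side_adj d i j + (i < d) = m.
Proof.
move=> od dm.
have -> : \sum_(j < m.+1) side_adj d i j = #|[set j : 'I_m.+1 | side_adj d i j]|.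
  by rewrite -sum1_card [RHS]big_mkcond; apply: eq_bigr => j _; rewrite in_set; case: (side_adj _ _ _).
have cT := cardsC [set j : 'I_m.+1 | side_adj d i j]; rewrite card_ord in cT.
suff : #|~: [set j : 'I_m.+1 | side_adj d i j]| = (i < d).+1 by move: cT; slia.
have [id|di] := ltnP i d; last first.
  rewrite (_ : ~: _ = [set i]) ?cards1 //; apply/setP => j.
  by rewrite in_setC !inE /side_adj [i < d]ltnNge di andbT negbK eq_sym.
(* The partner of [i] in the removed matching. *)
pose i' : 'I_m.+1 := inord (if odd i then i.-1 else i.+1).
have lt : (if odd i then i.-1 else i.+1) < d.
  by case: ifP => oi; move: id od oi; clear; lia.
have Ei' : i' = (if odd i then i.-1 else i.+1) :> nat by rewrite inordK // ltnS (leq_trans (ltnW lt)).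
rewrite (_ : ~: _ = [set i; i']).
  by rewrite cards2 (_ : i != i') // -val_eqE /= Ei'; case: ifP; clear; lia.
apply/setP => j; rewrite in_setC !inE /side_adj id -!val_eqE /= Ei'.
move: (nat_of_ord i) (nat_of_ord j) id od => a b; case: ifP; clear; lia.
Qed.

Lemma sum_lt_ord d m : d <= m -> \sum_(j < m) (j < d) = d.
Proof.
move=> dm; rewrite -[RHS]card_ord -sum1_card (big_ord_widen _ (fun=> 1) dm) [RHS]big_mkcond /=.
by apply: eq_bigr => j _; case: (_ < _).
Qed.

Section CutGraph.
Variables (k : nat) (R : finType) (rho : bool -> R) (d : bool -> nat).

(* Two copies of [K_(k+1)], each minus a perfect matching of its first [d b]   *)
(* vertices, which are joined to the root [rho b] instead.                     *)
Definition cut_graph : rel (R + bool * 'I_k.+1) := fun x y =>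
  match x, y with
  | inl r, inl r' => r != r'
  | inl r, inr (b, i) | inr (b, i), inl r => (r == rho b) && (i < d b)
  | inr (b, i), inr (b', j) => (b == b') && side_adj (d b) i j
  end.
Local Notation e := cut_graph.
Local Notation T := (R + bool * 'I_k.+1)%type.

Hypothesis rho_onto : forall r, exists b, rho b = r.
Hypothesis d_even : forall b, ~~ odd (d b).
Hypothesis d_bounds : forall b, 0 < d b <= k.
Hypothesis root_degree :
  forall r, #|R|.-1 + ((r == rho true) * d true + (r == rho false) * d false) = k.

Lemma cut_graph_sym : symmetric e.
Proof.
case=> [r|[b i]] [r'|[b' j]] //=; first by rewrite eq_sym.
by rewrite eq_sym; have [->|//] := eqVneq; rewrite side_adj_sym.
Qed.

Lemma cut_graph_irr : irreflexive e.
Proof. by case=> [r|[b i]] /=; rewrite /side_adj ?eqxx ?andbF. Qed.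

Lemma cut_graph_regular : regular e k.
Proof.
move=> x; rewrite /degree -sum1_card big_mkcond /=.
have -> : \sum_(y : T) (if y \in [set y | e x y] then 1 else 0) = \sum_(y : T) e x y.
  by apply: eq_bigr => y _; rewrite in_set; case: (e x y).
rewrite big_sumType /=.
have -> : \sum_(q : bool * 'I_k.+1) e x (inr q) = \sum_b \sum_(j < k.+1) e x (inr (b, j)).
  by rewrite pair_bigA; apply: eq_bigr => -[].
rewrite big_bool /=.
case: x => [r|[b i]] /=.
  have sb b : \sum_(j < k.+1) ((r == rho b) && (j < d b)) = (r == rho b) * d b.
    case: (r == _) => /=; last by rewrite big1.
    by rewrite sum_lt_ord ?mul1n //; have /andP[_ /leqW] := d_bounds b.
  rewrite !sb -(root_degree r); congr (_ + _).
  rewrite (bigD1 r) //= eqxx (eq_bigr (fun=> 1)); last by move=> i; rewrite eq_sym => ->.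
  by rewrite sum1dep_card cardsE; apply: cardC1.
rewrite (bigD1 (rho b)) //= eqxx big1 ?addn0 /=; last by move=> r /negPf->.
have /andP[_ dk] := d_bounds b; rewrite -[RHS](side_adj_card i (d_even b) dk) [RHS]addnC.
congr (_ + _); by case: b {dk} i => i /=; [rewrite [X in _ + X]big1 ?addn0|rewrite [X in X + _]big1 ?add0n].
Qed.

Let a b : T := inr (b, ord0).
Let roots : {set T} := [set inl r | r : R].
Let D : {set T} := roots :|: [set a true; a false].

Lemma in_roots x : (x \in roots) = (if x is inl _ then true else false).
Proof. by case: x => [r|p]; [rewrite imset_f|apply/imsetP => -[]]. Qed.

Lemma cset_roots : cset e roots.
Proof.
pose r0 := rho true.
have -> : roots = [set inl r0] :|: (roots :\ inl r0) by rewrite setD1K // in_roots.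
apply: cset_addnbrs; first exact: cset1.
apply/subsetP => -[r|p]; rewrite in_setD1 in_roots ?andbF // andbT => rr.
by apply: (@in_ext _ e _ (inl r0)); rewrite ?in_set1 //= eq_sym.
Qed.

Lemma cset_core : cset e D.
Proof.
apply: cset_addnbrs cset_roots _; apply/subsetP => x xa.
have [b ->] : exists b, x = a b by move: xa; rewrite !inE => /orP[]/eqP->; eexists.
apply: (@in_ext _ e _ (inl (rho b))); rewrite ?in_roots //= eqxx /=.
by have /andP[] := d_bounds b.
Qed.

Lemma core_dominating : out e D = set0.
Proof.
apply/setP => x; rewrite in_set0; apply/negP => /outP[xD no].
case: x xD no => [r|[b j]]; first by rewrite in_setU in_roots.
move=> _ no; have /andP[d0 _] := d_bounds b.
have /= := no (inl (rho b)); rewrite in_setU in_roots eqxx /= => /(_ isT) jd.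
have aD : a b \in D by rewrite !inE; case: b {d0 no jd}; rewrite eqxx ?orbT.
have := no (a b) aD; rewrite /= eqxx /side_adj (negPf jd) !andbF !andbT negbK => /eqP j0.
by move: jd; rewrite -j0 d0.
Qed.

Lemma card_roots : #|roots| = #|R|.
Proof. by rewrite card_imset //; apply: inl_inj. Qed.

Lemma card_cut_graph : #|{: T}| = #|R| + 2 * k.+1.
Proof. by rewrite card_sum card_prod card_bool card_ord. Qed.

Lemma card_core : #|D| = #|R| + 2.
Proof.
rewrite cardsU card_roots cards2 (_ : _ :&: _ = set0) ?cards0 ?subn0 //.
by apply/setP => x; rewrite in_setI in_roots !inE; case: x.
Qed.

Lemma root_cut r : cut_vertex e (inl r).
Proof.
have [b Eb] := rho_onto r; exists [set x | if x is inr (b', _) then b' == b else false]; split.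
- by apply/set0Pn; exists (a b); rewrite in_set /= eqxx.
- by rewrite in_set.
- by apply/eqP => /setP/(_ (a (~~ b))); rewrite !inE /=; case: b {Eb}.
move=> [r'|[b' i]]; rewrite in_set // => /eqP->.
apply/subsetP => -[r'|[b'' j]]; rewrite in_nbh !inE /=.
  by move=> /andP[/eqP-> _]; rewrite Eb eqxx.
by case/andP => /eqP->.
Qed.

Lemma cut_graph_leaves : leaf_number e = 2 * k.
Proof.
apply/eqP; rewrite eqn_leq; apply/andP; split; last first.
  have := dominating_leaves cset_core core_dominating.
  have := card_out e D; rewrite core_dominating cards0 card_core card_cut_graph; slia.
(* As [d b <= k], the last vertex of a copy sees no root, so its closed neighbourhood stays within
   the copy. *)
pose z b : T := inr (b, ord_max).
have zN b : z b |: nbh e (z b) \subset [set x | if x is inr (b', _) then b' == b else false].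
  rewrite subUset sub1set in_set /= eqxx; apply/subsetP => -[r|[b' j]]; rewrite in_nbh in_set /=.
    by rewrite ltnNge; have /andP[_ ->] := d_bounds b; rewrite andbF.
  by rewrite eq_sym => /andP[].
have dz b : [disjoint roots & z b |: nbh e (z b)].
  apply/pred0P => x; apply/negP => /andP[/= + /(subsetP (zN b))].
  by rewrite in_set in_roots; case: x.
have T3 : 2 < #|{: T}|.
  have /andP[d0 dk] := d_bounds true; rewrite card_cut_graph; move: d0 dk; slia.
have := @leaf_number_le _ e cut_graph_sym cut_graph_irr roots (z true) (z false) T3.
rewrite card_roots card_cut_graph => le.
apply: (@leq_trans (#|R| + 2 * k.+1 - (#|R| + 2))); last by slia.
apply: le => //; first by move=> x; rewrite in_roots; case: x => // r _; apply: root_cut.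
apply/pred0P => x; apply/negP => /andP[/(subsetP (zN true)) + /(subsetP (zN false))]; rewrite !in_set.
by case: x => // -[[] j].
Qed.

Lemma cut_graph_example : exists (T : finType) (e : rel T),
  simple_graph e /\ nontrivial T /\ connected e /\ regular e k /\
  leaf_number e = 2 * k /\ ~ hamiltonian e.
Proof.
have symE := cut_graph_sym; have irrE := cut_graph_irr.
exists T, e; split; first by split.
split; first by rewrite /nontrivial card_cut_graph; slia.
split; first exact: (dominating_connected symE irrE cset_core core_dominating).
split; first exact: cut_graph_regular.
split; first exact: cut_graph_leaves.
exact: (cut_not_hamiltonian symE (root_cut (rho true))).
Qed.

End CutGraph.

Lemma bool_example : exists (T : finType) (e : rel T),
  simple_graph e /\ nontrivial T /\ connected e /\ regular e 1 /\
  leaf_number e = 2 * 1 /\ ~ hamiltonian e.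
Proof.
pose e : rel bool := fun x y => x != y.
have symE : symmetric e by move=> x y; rewrite /e eq_sym.
have irrE : irreflexive e by move=> x; rewrite /e eqxx.
have nt : nontrivial bool by rewrite /nontrivial card_bool.
have connE : connected e.
  apply/forallP => x; apply/forallP => y; have [->|xy] := eqVneq x y; first exact: connect0.
  exact: connect1.
have regE : regular e 1.
  by move=> x; rewrite /degree (_ : [set y | e x y] = [set ~~ x]) ?cards1 //; apply/setP => -[]; rewrite !inE; case: x.
exists bool, e; do 4!split=> //; split; last first.
  by case=> c [c2 /andP[_ uc] _]; have := max_card (mem c); rewrite (card_uniqP uc) card_bool; move: c2; slia.
apply/eqP; rewrite eqn_leq; apply/andP; split; last first.
  by have := one_regular_leaves symE irrE connE regE nt (erefl 1); rewrite card_bool.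
by apply/bigmax_leqP => F _; apply: leq_trans (max_card _) _; rewrite card_bool.
Qed.

(** For odd k >= 3, two adjacent roots are each joined to k-1 vertices of their own copy; for even
    k, a single root is joined to 2 vertices of one copy and k-2 of the other; for k = 1 the graph
    is K_2. No nontrivial connected graph is 0-regular, and the connected 2-regular ones are
    cycles. *)
Lemma sharpness k : k <> 0 -> k <> 2 -> exists (T : finType) (e : rel T),
  simple_graph e /\ nontrivial T /\ connected e /\ regular e k /\
  leaf_number e = 2 * k /\ ~ hamiltonian e.
Proof.
move=> k0 k2; have [->|k1] := eqVneq k 1; first exact: bool_example.
have k3 : 2 < k by move: k0 k2 k1 => + + /eqP; clear; lia.
have [ok|ek] := boolP (odd k).
  apply: (@cut_graph_example k bool id (fun=> k.-1)).
  - by move=> b; exists b.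
  - by move=> _; move: ok k3; clear; lia.
  - by move=> _; move: k3; clear; lia.
  - by move=> b; rewrite card_bool; case: b => /=; move: k3; clear; lia.
apply: (@cut_graph_example k unit (fun=> tt) (fun b => if b then 2 else k - 2)).
- by case; exists true.
- by case=> //; move: ek k3; clear; lia.
- by case; move: ek k3; clear; lia.
- by case; rewrite card_unit /=; move: k3; clear; lia.
Qed.

Theorem theorem13 (k : nat) :
  (forall (T : finType) (e : rel T),
      simple_graph e -> nontrivial T -> connected e -> regular e k ->
      leaf_number e <= 2 * k - 1 -> hamiltonian e)
  /\
  (k <> 0 -> k <> 2 ->
   exists (T : finType) (e : rel T),
     simple_graph e /\ nontrivial T /\ connected e /\ regular e k /\
     leaf_number e = 2 * k /\ ~ hamiltonian e).
Proof.
split; last exact: sharpness.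
by move=> T e [symE irrE] nt conn reg; apply: few_leaves_hamiltonian.
Qed.
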